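(* There exist a complex manifold $X$, a quasi-plurisubharmonic function $\Psi$ on $X$ with log canonical singularities (that is, $c_x(\Psi)\ge 1$ for every $x\in X$; $\Psi$ is not required to have analytic singularities), and an irreducible component $Y$ of the non-integrable locus $Y_0$ of $e^{-\Psi}$, such that: (1) the log canonical pair $(X,\Psi)$ has a unique log canonical place for $Y$ (unique up to positive scaling of valuations); and (2) the Ohsawa norm of $\Psi$ is entirely singular on $Y$, i.e. every point of $Y$ is a singular point of the Ohsawa norm of $\Psi$; so that, for every smooth hermitian holomorphic line bundle $(L,h)$ on $X$, every holomorphic section $f$ of $(K_X+L)|_{Y_0}$ with $\|f\|_\Psi<\infty$ vanishes identically on $Y$.
   Context: Let $X$ be a complex manifold of dimension $n$ and $\Psi$ a quasi-plurisubharmonic (quasi-psh) function on $X$ (locally the sum of a psh function and a smooth function). Log canonical threshold: $c_x(\Psi):=\sup\{c\ge 0: e^{-c\Psi}\text{ is integrable near }x\}$. The pair $(X,\Psi)$ is log canonical if $c_x(\Psi)\ge 1$ for all $x\in X$. The non-integrable locus $Y_0$ is the set of $x\in X$ such that $e^{-\Psi}$ is not integrable in any neighborhood of $x$; it is the closed analytic subset defined by the multiplier ideal sheaf of $\Psi$, and in the log canonical case it is equal to $\{x\in X: c_x(\Psi)=1\}$ and is taken with its reduced structure. Ohsawa norm of a section: let $(L,h)$ be a holomorphic line bundle with smooth hermitian metric $h=e^{-\phi}$, and let $f$ be a holomorphic section of $(K_X+L)|_{Y_0}$ ($K_X$ is the canonical bundle). Let $F=\sum_j\chi_jF_j$, where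 $(\chi_j)$ is a partition of unity subordinate to an open Stein covering $(U_j)$ of $X$ and $F_j$ is a holomorphic extension of $f$ to $U_j$. Put $$\|f\|_\Psi:=\sup_{K\text{ compact in }X}\ \limsup_{t\to-\infty}\int_{\{t<\Psi<t+1\}\cap K} i^{n^2}F\wedge\overline{F}\,e^{-(\phi+\Psi)},$$ which is independent of the choice of $F$. The same definition applies on any open subset of $X$; near a point, after trivializing the bundles, it defines $\|f\|_\Psi$ for holomorphic functions $f$ on $Y_0$. Singularity: the Ohsawa norm of $\Psi$ is singular at $x\in Y_0$ if $\|f\|_\Psi=\infty$ for every holomorphic function $f$ defined on a neighborhood of $x$ in $Y_0$ with $f(x)\ne 0$. The set of singular points is denoted $Z$. The Ohsawa norm is entirely singular on an irreducible component $Y$ of $Y_0$ if $Z\cap Y=Y$. Quasimonomial valuations: let $\mu:X'\to U$ be a proper bimeromorphic morphism from a complex manifold $X'$ to an open set $U\subset X$, let $E_1,\dots,E_r$ be components of a simple normal crossing divisor on $X'$, let $W$ be an irreducible component of $E_1\cap\dots\cap E_r$, and let $\alpha\in\mathbb R^r_{>0}$. With $w_1,\dots,w_r$ local equations of $E_1,\dots,E_r$ near a point of $W$, these data define a quasimonomial valuation $v$ by $$v(\Psi):=\sup\Bigl\{t\ge 0:\ \Psi\circ\mu\le t\log\max_{1\le i\le r}|w_i|^{2/\alpha_i}+O(1)\Bigr\},\qquad v(f):=v(\log|f|^2)$$ for holomorphic $f$ (the normalization is such that $v(w_i)=\alpha_i$). Its center on $X$ is (the closure of) $\mu(W)$, and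 its log discrepancy is $A(v)=\sum_{i=1}^r\alpha_i\bigl(1+\mathrm{ord}_{E_i}(K_{X'/U})\bigr)$. Two such valuations are considered equivalent if they agree on holomorphic germs up to a positive scalar factor. (Monomial valuations in given coordinates are the case $\mu=\mathrm{id}$ with $E_i$ coordinate hyperplanes.) Log canonical place: a log canonical place of the log canonical pair $(X,\Psi)$ for $Y$ is a quasimonomial valuation $v$ with center $Y$ such that $A(v)=v(\Psi)$ (equivalently, $v$ computes the log canonical threshold $1$: $A(v)/v(\Psi)=1$). *)

(* Defs.v *)
From HB Require Import structures.
From mathcomp Require Import all_boot all_order all_algebra complex.
From mathcomp Require Import all_classical all_reals all_analysis.

Set Implicit Arguments.
Unset Strict Implicit.
Unset Printing Implicit Defensive.

Import Order.TTheory GRing.Theory Num.Theory numFieldNormedType.Exports.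

Local Open Scope classical_set_scope.
Local Open Scope ring_scope.

(* Naming the structure [R[i]] as a [numClosedFieldType] gives it its norm
   topology; [differentiable] over it is then complex (Frechet)
   differentiability, i.e. holomorphy when it holds on an open set. *)
Definition C (R : realType) : numClosedFieldType := R[i].

Definition cabs (R : realType) (z : C R) : R := complex.Re (`|z| : R[i]).

Section AffineSpace.
Variables (R : realType).

Definition polar (t : R) : C R := (cos t +i* sin t)%C.

(* Derivatives along all real directions [v] of C^n = R^(2n). *)
Fixpoint Ck n (k : nat) (Om : set 'rV[C R]_n) (f : 'rV[C R]_n -> R) : Prop :=
  (forall z, Om z -> {for z, continuous f}) /\
  match k with
  | 0 => True
  | k'.+1 => forall v : 'rV[C R]_n,
      (forall z, Om z ->
         derivable (fun t : R => f (z + ((t%:C)%C : C R) *: v)) 0 1) /\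
      Ck k' Om (fun z => derive1 (fun t : R => f (z + ((t%:C)%C : C R) *: v)) 0)
  end.

Lemma Ck_cst n k (Om : set 'rV[C R]_n) (a : R) : Ck k Om (fun=> a).
Proof.
by elim: k a => [|k IH] a /=; split=> //; move=> z _; exact: cst_continuous.
Qed.

Definition smooth n (Om : set 'rV[C R]_n) (f : 'rV[C R]_n -> R) : Prop :=
  forall k, Ck k Om f.

(* A psh function is not allowed to be identically -oo on a connected component
   of its domain. *)
Definition psh n (Om : set 'rV[C R]_n) (u : 'rV[C R]_n -> \bar R) : Prop :=
  [/\ forall z, Om z -> (u z < +oo)%E,
      forall z, Om z -> forall a : R, (u z < a%:E)%E ->
        \forall y \near z, (u y < a%:E)%E,
      forall z, Om z ->
        exists2 y, connected_component Om z y & u y <> -oo%E &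
      forall a b : 'rV[C R]_n,
        (forall s : C R, cabs s <= 1 -> Om (a + s *: b)) ->
        (u a <= ((2 * pi)^-1)%R%:E *
           \int[lebesgue_measure]_(t in `[0%R, (2 * pi)%R]%classic)
             u (a + polar t *: b)%R)%E].

(* Integral of a nonnegative measurable function for the Lebesgue measure of
   C^n = R^(2n), written as an iterated integral (Tonelli). *)
Fixpoint cint n : ('rV[C R]_n -> \bar R) -> \bar R :=
  match n with
  | 0 => fun g => g 0
  | n'.+1 => fun g =>
      (\int[lebesgue_measure]_x \int[lebesgue_measure]_y
         cint (fun z : 'rV[C R]_n' =>
                 g (row_mx (((x +i* y)%C : C R)%:M : 'M[C R]_1) z)))%E
  end.

Definition cint_on n (B : set 'rV[C R]_n) (g : 'rV[C R]_n -> \bar R) : \bar R :=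
  cint (patch (fun=> 0%E) B g).

End AffineSpace.

Section Manifolds.
Variables (R : realType) (n : nat).

Record chart (T : topologicalType) := Chart {
  cdom : set T;
  cfun : T -> 'rV[C R]_n;
  cinv : 'rV[C R]_n -> T;
  cdom_open : open cdom;
  cimg_open : open (cfun @` cdom);
  cfunK : forall x, cdom x -> cinv (cfun x) = x;
  cfun_continuous : forall x, cdom x -> {for x, continuous cfun};
  cinv_continuous : forall z, (cfun @` cdom) z -> {for z, continuous cinv} }.

Definition holo_transition (T : topologicalType) (c c' : chart T) : Prop :=
  forall x, cdom c x -> cdom c' x ->
    differentiable (cfun c' \o cinv c) (cfun c x).

Record cmanifold := CManifold {
  carrier :> topologicalType;
  atlas : set (chart carrier);
  atlas_cover : forall x, exists2 c, atlas c & cdom c x;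
  atlas_compat : forall c c', atlas c -> atlas c' -> holo_transition c c';
  manifold_hausdorff : hausdorff_space carrier;
  manifold_second_countable : @second_countable carrier }.
Arguments atlas : clear implicits.

(* Charts of the maximal atlas, i.e. all holomorphic coordinate systems. *)
Definition hchart (X : cmanifold) (c : chart X) : Prop :=
  forall c', atlas X c' -> holo_transition c c' /\ holo_transition c' c.

Definition holo_on (X : cmanifold) (V : set X) (f : X -> C R) : Prop :=
  forall x, V x -> forall c, atlas X c -> cdom c x ->
    differentiable (f \o cinv c) (cfun c x).

Definition smooth_on (X : cmanifold) (V : set X) (f : X -> R) : Prop :=
  forall c, atlas X c -> smooth (cfun c @` (cdom c `&` V)) (f \o cinv c).

Definition holo_map (X Y : cmanifold) (V : set X) (f : X -> Y) : Prop :=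
  forall x, V x -> {for x, continuous f} /\
    forall c c', atlas X c -> atlas Y c' -> cdom c x -> cdom c' (f x) ->
      differentiable (cfun c' \o f \o cinv c) (cfun c x).

(* [S] is a closed analytic subset of the open set [U]. *)
Definition analytic_in (X : cmanifold) (U S : set X) : Prop :=
  S `<=` U /\
  forall x, U x -> exists (N : set X) (m : nat) (f : 'I_m -> X -> C R),
    [/\ open N, N x, N `<=` U, forall i, holo_on N (f i) &
        S `&` N = [set y | N y /\ forall i, f i y = 0]].

Definition irreducible (X : cmanifold) (S : set X) : Prop :=
  [/\ analytic_in setT S, S !=set0 &
      forall A B, analytic_in setT A -> analytic_in setT B ->
        S = A `|` B -> S = A \/ S = B].

Definition irreducible_component (X : cmanifold) (A S : set X) : Prop :=
  [/\ irreducible S, S `<=` A &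
      forall S', irreducible S' -> S `<=` S' -> S' `<=` A -> S' = S].

(* Sections over [V] of the structure sheaf of the reduced analytic set [A]. *)
Definition holo_on_reduced (X : cmanifold) (V A : set X) (f : X -> C R) : Prop :=
  forall x, V x -> A x -> exists (N : set X) (h : X -> C R),
    [/\ open N, N x, N `<=` V, holo_on N h &
        forall y, N y -> A y -> h y = f y].

Definition stein (X : cmanifold) (U : set X) : Prop :=
  [/\ open U,
      forall K : set X, compact K -> K `<=` U ->
        compact [set x | U x /\ forall f, holo_on U f ->
          forall M : R, (forall y, K y -> cabs (f y) <= M) -> cabs (f x) <= M] &
      forall x y, U x -> U y -> x <> y ->
        exists2 f, holo_on U f & f x <> f y].

Definition quasi_psh (X : cmanifold) (Psi : X -> \bar R) : Prop :=
  forall x, exists (c : chart X) (N : set X) u g,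
    [/\ hchart c, [/\ open N, N x & N `<=` cdom c],
        psh (cfun c @` N) u, smooth (cfun c @` N) g &
        forall y, N y -> Psi y = (u (cfun c y) + (g (cfun c y))%:E)%E].

Definition exp_integrable_near (X : cmanifold) (Psi : X -> \bar R) (a : R)
    (x : X) : Prop :=
  exists (c : chart X) (N : set X),
    [/\ hchart c, [/\ open N, N x & N `<=` cdom c] &
        (cint_on (cfun c @` N)
           (fun z => expeR (- (a%:E * Psi (cinv c z)))) < +oo)%E].

Definition lct (X : cmanifold) (Psi : X -> \bar R) (x : X) : \bar R :=
  ereal_sup [set a%:E | a in [set a : R |
    0 <= a /\ exp_integrable_near Psi a x]].

Definition log_canonical (X : cmanifold) (Psi : X -> \bar R) : Prop :=
  forall x, (1%:E <= lct Psi x)%E.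

Definition nonint_locus (X : cmanifold) (Psi : X -> \bar R) : set X :=
  [set x | ~ exp_integrable_near Psi 1 x].

End Manifolds.

Arguments atlas {R n} _ _.

Section OhsawaNorm.
Variables (R : realType) (n : nat) (X : cmanifold R n).

(* A hermitian holomorphic line bundle over the open set [V], given by a cover
   by trivializing coordinate charts, transition functions g_ij and weights
   phi_i: sections are families with s_i = g_ij s_j, and |s|_h^2 is
   |s_i|^2 exp (- phi_i).  A trivializing cover can always be refined to
   coordinate charts, so every such bundle is of this form. *)
Record hlbundle (V : set X) := HLBundle {
  lidx : Type;
  lchart : lidx -> chart R n X;
  lchartP : forall i, hchart (lchart i);
  lcover : forall x, V x -> exists i, cdom (lchart i) x;
  ltrans : lidx -> lidx -> X -> C R;
  ltrans_holo : forall i j,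
    holo_on (V `&` (cdom (lchart i) `&` cdom (lchart j))) (ltrans i j);
  ltrans_neq0 : forall i j x, V x ->
    cdom (lchart i) x -> cdom (lchart j) x -> ltrans i j x != 0;
  ltransM : forall i j k x, V x ->
    cdom (lchart i) x -> cdom (lchart j) x -> cdom (lchart k) x ->
    ltrans i j x * ltrans j k x = ltrans i k x;
  lweight : lidx -> X -> R;
  lweight_smooth : forall i, smooth_on (V `&` cdom (lchart i)) (lweight i);
  lweightE : forall i j x, V x ->
    cdom (lchart i) x -> cdom (lchart j) x ->
    cabs (ltrans i j x) ^+ 2 * expR (- lweight i x) = expR (- lweight j x) }.

(* Transition functions of K_X + L: the i-th coefficient of a section is taken
   with respect to the frame dz_1 /\ ... /\ dz_n of the chart [lchart i]. *)
Definition kl_trans V (L : hlbundle V) (i j : lidx L) (x : X) : C R :=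
  ltrans i j x *
  \det (jacobian (cfun (lchart j) \o cinv (lchart i)) (cfun (lchart i) x)).

Definition kl_section V (L : hlbundle V) (S : set X)
    (s : lidx L -> X -> C R) : Prop :=
  forall i j x, S x -> cdom (lchart i) x -> cdom (lchart j) x ->
    s i x = kl_trans i j x * s j x.

Definition holo_kl_section V (L : hlbundle V) (U : set X)
    (s : lidx L -> X -> C R) : Prop :=
  kl_section U s /\ forall i, holo_on (U `&` cdom (lchart i)) (s i).

(* Holomorphic sections over [V] of the restriction of K_X + L to the reduced
   analytic set [A]; the values of [f] outside [A] are irrelevant. *)
Definition holo_kl_section_on V (L : hlbundle V) (A : set X)
    (f : lidx L -> X -> C R) : Prop :=
  kl_section (V `&` A) f /\
  forall i, holo_on_reduced (V `&` cdom (lchart i)) A (f i).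

Definition partition_of_unity (V : set X) (J : choiceType)
    (U : J -> set X) (chi : J -> X -> R) : Prop :=
  [/\ forall j, smooth_on V (chi j),
      forall j x, V x -> 0 <= chi j x,
      forall j, closure [set x | V x /\ chi j x <> 0] `&` V `<=` U j,
      forall x, V x -> exists N : set X, [/\ open N, N x &
        finite_set [set j | exists y, [/\ N y, V y & chi j y <> 0]]] &
      forall x, V x -> \sum_(j \in [set: J]) chi j x = 1].

(* [F] is a smooth extension of [f] of the form \sum_j chi_j F_j used to
   compute the Ohsawa norm of [f] over [V]. *)
Definition ohsawa_extension V (L : hlbundle V) (A : set X)
    (f F : lidx L -> X -> C R) : Prop :=
  exists (J : choiceType) (U : J -> set X) (chi : J -> X -> R)
         (G : J -> lidx L -> X -> C R),
    [/\ (forall j, stein (U j) /\ U j `<=` V) /\ V `<=` \bigcup_j U j,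
        partition_of_unity V U chi,
        forall j, holo_kl_section (U j) (G j),
        forall j i x, U j x -> A x -> cdom (lchart i) x -> G j i x = f i x &
        forall i x, V x -> cdom (lchart i) x ->
          F i x = \sum_(j \in [set: J]) ((chi j x)%:C)%C * G j i x].

(* Density of i^(n^2) F /\ \bar F exp (- (phi + Psi)) with respect to the
   Lebesgue measure of the chart [lchart i]; the factor 2^n comes from
   i dz /\ d\bar z = 2 dx /\ dy. *)
Definition kl_density V (L : hlbundle V) (Psi : X -> \bar R)
    (F : lidx L -> X -> C R) (i : lidx L) (x : X) : \bar R :=
  ((2 ^+ n * cabs (F i x) ^+ 2 * expR (- lweight i x))%:E
     * expeR (- Psi x))%E.

(* Integral of that form over a Borel set [B] of [V]: supremum over the finite
   families of disjoint Borel pieces of [B], each contained in some chart. *)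
Definition kl_integral V (L : hlbundle V) (Psi : X -> \bar R)
    (F : lidx L -> X -> C R) (B : set X) : \bar R :=
  ereal_sup [set v | exists (m : nat) (P : 'I_m -> set X) (i : 'I_m -> lidx L),
    [/\ trivIset setT P,
        forall k, <<s [set O : set X | open O] >> (P k),
        forall k, P k `<=` B `&` cdom (lchart (i k)) &
        v = (\sum_(k < m) cint_on (cfun (lchart (i k)) @` P k)
               (kl_density Psi F (i k) \o cinv (lchart (i k))))%E]].

Definition ohsawa_value V (L : hlbundle V) (Psi : X -> \bar R)
    (F : lidx L -> X -> C R) : \bar R :=
  ereal_sup [set limf_esup (fun t : R => kl_integral Psi F
      ([set x | (t%:E < Psi x)%E /\ (Psi x < (t + 1)%:E)%E] `&` K)) -oo
    | K in [set K : set X | compact K /\ K `<=` V]].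

(* The value does not depend on the extension [F]; the infimum selects it. *)
Definition ohsawa_norm V (L : hlbundle V) (Psi : X -> \bar R)
    (f : lidx L -> X -> C R) : \bar R :=
  ereal_inf [set ohsawa_value Psi F
    | F in ohsawa_extension (nonint_locus Psi) f].

Section TrivialBundle.
Variables (c : chart R n X) (V : set X).
Hypotheses (hc : hchart c) (Vc : V `<=` cdom c).

Definition triv_bundle : hlbundle V.
Proof.
refine (@HLBundle V unit (fun=> c) (fun=> hc) _ (fun _ _ _ => 1) _ _ _
  (fun _ _ => 0) _ _).
- by move=> x /Vc cx; exists tt.
- by move=> i j x _ c' _ _; exact: differentiable_cst.
- by move=> *; exact: oner_neq0.
- by move=> *; rewrite mulr1.
- by move=> i c' _ k; exact: Ck_cst.
- by move=> *; rewrite /cabs normr1 expr1n mul1r.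
Defined.

End TrivialBundle.

Definition ohsawa_singular (Psi : X -> \bar R) (x : X) : Prop :=
  forall (c : chart R n X) (V : set X) (hc : hchart c) (Vc : V `<=` cdom c)
         (f : X -> C R),
    open V -> V x -> holo_on_reduced V (nonint_locus Psi) f -> f x <> 0 ->
    ohsawa_norm (L := triv_bundle hc Vc) Psi (fun=> f) = +oo%E.

Definition ohsawa_singular_set (Psi : X -> \bar R) : set X :=
  [set x | nonint_locus Psi x /\ ohsawa_singular Psi x].

Definition entirely_singular (Psi : X -> \bar R) (Y : set X) : Prop :=
  ohsawa_singular_set Psi `&` Y = Y.

End OhsawaNorm.

Section Valuations.
Variables (R : realType) (n : nat).

Definition proper_bimeromorphic (X' X : cmanifold R n) (U : set X)
    (mu : X' -> X) : Prop :=
  [/\ open U, forall p, U (mu p), holo_map setT mu,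
      forall K : set X, compact K -> K `<=` U -> compact (mu @^-1` K) &
      exists (S : set X) (nu : X -> X'),
        [/\ analytic_in U S, interior S = set0, interior (mu @^-1` S) = set0,
            holo_map (U `\` S) nu &
            (forall x, U x -> ~ S x -> mu (nu x) = x) /\
            (forall p, ~ S (mu p) -> nu (mu p) = p)]].

(* [E_1, ..., E_r] are irreducible components of a simple normal crossing
   divisor: near every point [p], those passing through [p] are distinct
   coordinate hyperplanes of some holomorphic chart. *)
Definition snc (X : cmanifold R n) r (E : 'I_r -> set X) : Prop :=
  (forall i, irreducible (E i)) /\
  forall p, exists (c : chart R n X) (s : 'I_r -> 'I_n),
    [/\ hchart c, cdom c p,
        forall i j, E i p -> E j p -> s i = s j -> i = j &
        forall i, E i p ->
          E i `&` cdom c = [set y | cdom c y /\ cfun c y 0 (s i) = 0]].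

(* [w] is a local equation at [p] of the smooth hypersurface [E]. *)
Definition local_equation (X : cmanifold R n) (E : set X) (p : X)
    (w : X -> C R) : Prop :=
  exists (N : set X) (c : chart R n X),
    [/\ open N /\ N p, holo_on N w, E `&` N = [set y | N y /\ w y = 0],
        atlas X c /\ cdom c p &
        exists v, 'D_v (w \o cinv c) (cfun c p) <> 0].

Record qmval (X : cmanifold R n) := QMVal {
  qspace : cmanifold R n;
  qopen : set X;
  qmap : qspace -> X;
  qmap_bimero : proper_bimeromorphic qopen qmap;
  qrank : nat;
  qrank_gt0 : (0 < qrank)%N;
  qdiv : 'I_qrank -> set qspace;
  qdiv_snc : snc qdiv;
  qstratum : set qspace;
  qstratumP : irreducible_component (\bigcap_i qdiv i) qstratum;
  qweight : 'I_qrank -> R;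
  qweight_gt0 : forall i, 0 < qweight i }.
Arguments qstratum {X} q _.
Arguments qmap {X q} _.

Definition qbound (X : cmanifold R n) (v : qmval X) (u : X -> \bar R) (t : R)
    (p : qspace v) : Prop :=
  exists (w : 'I_(qrank v) -> qspace v -> C R) (M : R),
    (forall i, local_equation (qdiv i) p (w i)) /\
    \forall q \near p,
      (u (qmap q) <= t%:E *
         lne (\big[Num.max/0]_(i < qrank v)
                (cabs (w i q) `^ (2 / qweight i))%R)%:E + M%:E)%E.

(* Value of [v] on [u], the bound being required at the points of the stratum
   lying over [S].  For quasi-psh [u] on all of X the value computed near a
   point of the stratum does not depend on that point, so that [S = setT] gives
   v(u).  For germs at [x] one takes [S = [set x]]; several branches of the
   stratum may lie over [x], in which case this is their minimum. *)
Definition qvalue (X : cmanifold R n) (v : qmval X) (S : set X)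
    (u : X -> \bar R) : \bar R :=
  ereal_sup [set t%:E | t in [set t : R | 0 <= t /\
    forall p : qspace v, qstratum v p -> S (qmap p) -> qbound u t p]].

Definition qvalue_germ (X : cmanifold R n) (v : qmval X) (x : X)
    (f : X -> C R) : \bar R :=
  qvalue v [set x] (fun y => lne (cabs (f y) ^+ 2)%:E).

Definition qcenter (X : cmanifold R n) (v : qmval X) : set X :=
  closure (qmap @` qstratum v).

(* [k] is the order of vanishing along [E] of the Jacobian determinant of
   [mu], i.e. the coefficient of [E] in the relative canonical divisor. *)
Definition jacobian_order (X' X : cmanifold R n) (mu : X' -> X) (E : set X')
    (k : nat) : Prop :=
  forall p (c : chart R n X') (c' : chart R n X) w,
    E p -> hchart c -> hchart c' -> cdom c p -> cdom c' (mu p) ->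
    local_equation E p w ->
    let Jac q := \det (jacobian (cfun c' \o mu \o cinv c) (cfun c q)) in
    let divides m := exists (N : set X') (g : X' -> C R),
      [/\ open N, N p, holo_on N g & forall q, N q -> Jac q = w q ^+ m * g q] in
    divides k /\ ~ divides k.+1.

Definition log_discrepancy (X : cmanifold R n) (v : qmval X) (a : R) : Prop :=
  exists k : 'I_(qrank v) -> nat,
    (forall i, jacobian_order (@qmap X v) (qdiv i) (k i)) /\
    a = \sum_(i < qrank v) qweight i * (1 + (k i)%:R).

(* Germs are compared at the points over which both strata have points: when
   the centers coincide with Y, these form a dense relatively open subset of
   Y. *)
Definition qequiv (X : cmanifold R n) (v1 v2 : qmval X) : Prop :=
  exists2 a : R, 0 < a &
    forall x, (qmap @` qstratum v1) x -> (qmap @` qstratum v2) x ->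
    forall (N : set X) (f : X -> C R), open N -> N x -> holo_on N f ->
      qvalue_germ v1 x f = (a%:E * qvalue_germ v2 x f)%E.

Definition lc_place (X : cmanifold R n) (Psi : X -> \bar R) (Y : set X)
    (v : qmval X) : Prop :=
  qcenter v = Y /\
  exists2 a : R, log_discrepancy v a & qvalue v setT Psi = a%:E.

End Valuations.

(* Main.v *)
(* On the complex line, with s = log |z|^2, take Psi = s - log (- s) near 0,
   prolonged linearly in s, and Y = {0}.  It is psh because it is an upper
   envelope of increasing affine functions of log |z|^2.  Its exponential
   e^(- c Psi) = (- s)^c e^(- c s) is integrable at 0 exactly when c < 1.

   The set {t < Psi < t + 1} contains an annulus around log |z|^2 = s, with
   s close to t, whose area is comparable to e^s; there e^(- Psi) is comparable
   to (- s) e^(- s).  If F(0) <> 0, the integral of |F|^2 e^(- Psi) over it is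
   thus at least of order - s, and the Ohsawa norm is infinite.

   The logarithm is too weak to be seen by valuations: since
   2 log |z|^2 + 1 <= Psi <= log |z|^2 near 0, every log canonical place v with
   center 0 gives z a finite positive value.  By Cauchy's formula a nonzero
   germ f satisfies |f| ~ |z|^m for some m, whence v(f) = m v(z), so v is
   proportional to the order of vanishing at 0. *)
Require Import Defs.
From HB Require Import structures.
From mathcomp Require Import all_boot all_order all_algebra complex.
From mathcomp Require Import all_classical all_reals all_analysis.
From mathcomp Require Import measurable_realfun numfun.
From mathcomp Require Import ring lra.

Set Implicit Arguments.
Unset Strict Implicit.
Unset Printing Implicit Defensive.

Import Order.TTheory GRing.Theory Num.Theory numFieldNormedType.Exports.

Local Open Scope classical_set_scope.
Local Open Scope ring_scope.

(** * Holomorphic functions of one variable *)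

(** Holomorphy is complex differentiability at each point, with no continuity of the derivative, so
    Cauchy's formula comes from Goursat's bisection. It serves twice: the Taylor expansion compares
    a germ with a power of z, and differentiation under the integral makes the Jacobian of a
    coordinate change holomorphic, which the log discrepancy of the order at 0 requires. Coordinates
    are arbitrary holomorphic charts. Lower bounds of integrals therefore rest on one small
    rectangle inside a shell, which survives any coordinate change; one shell far out suffices for
    both divergence statements, its mass being of order -s. Upper bounds use a single chart and
    separate the variables through |x| |y| <= |z|^2. The sub-mean inequality passes through log
    (|z|^2 + delta): an algebraic identity reduces its circle mean to that of log |1 + k zeta|^2
    with |k| < 1, where Taylor polynomials converge uniformly. A place exists because the order of
    vanishing gives Psi the value exactly 1: log (-s) is eventually below eta (-s) for every eta >
    0. *)

Notation Re := complex.Re.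
Notation Im := complex.Im.

(** * Modulus and polar form of complex numbers *)

Section ComplexModulus.
Context {R : realType}.
Implicit Types (z w : C R) (x y : R).

Lemma normE z : `|z| = ((cabs z)%:C)%C :> C R.
Proof. by rewrite /cabs normc_def. Qed.

Lemma cabsE z : cabs z = Num.sqrt (Re z ^+ 2 + Im z ^+ 2).
Proof. by rewrite /cabs normc_def. Qed.

Lemma cabs_ge0 z : 0 <= cabs z.
Proof. by rewrite cabsE sqrtr_ge0. Qed.

Lemma cabs_sqr z : cabs z ^+ 2 = Re z ^+ 2 + Im z ^+ 2.
Proof. by rewrite cabsE sqr_sqrtr// addr_ge0// sqr_ge0. Qed.

Lemma cabs0 : cabs (0 : C R) = 0.
Proof. by rewrite /cabs normr0. Qed.

Lemma cabs1 : cabs (1 : C R) = 1.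
Proof. by rewrite /cabs normr1. Qed.

Lemma cabsM z w : cabs (z * w) = cabs z * cabs w.
Proof. by apply: complexI; rewrite rmorphM/= -!normE normrM. Qed.

Lemma cabsN z : cabs (- z) = cabs z.
Proof. by rewrite /cabs normrN. Qed.

Lemma cabsX z n : cabs (z ^+ n) = cabs z ^+ n.
Proof. by elim: n => [|n IH]; rewrite ?expr0 ?cabs1// !exprS cabsM IH. Qed.

Lemma cabsV z : cabs z^-1 = (cabs z)^-1.
Proof. by apply: complexI; rewrite fmorphV/= -!normE normfV. Qed.

Lemma cabsD z w : cabs (z + w) <= cabs z + cabs w.
Proof. by rewrite -lecR rmorphD/= -!normE ler_normD. Qed.

Lemma cabsB z w : cabs (z - w) <= cabs z + cabs w.
Proof. by rewrite -(cabsN w); exact: cabsD. Qed.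

Lemma cabsDB z w : cabs z - cabs w <= cabs (z + w).
Proof.
by have := cabsB (z + w) w; rewrite addrK lerBlDr.
Qed.

Lemma cabs_eq0 z : (cabs z == 0) = (z == 0).
Proof.
apply/eqP/eqP => [z0|->]; last exact: cabs0.
by apply: (@normr0_eq0 _ (C R)); rewrite normE z0.
Qed.

Lemma cabs_gt0 z : (0 < cabs z) = (z != 0).
Proof. by rewrite lt_def cabs_eq0 cabs_ge0 andbT. Qed.

Lemma cabs_real x : cabs ((x%:C)%C : C R) = `|x|.
Proof. by rewrite cabsE/= expr0n/= addr0 sqrtr_sqr. Qed.

Lemma cabsi : cabs ('i%C : C R) = 1.
Proof. by rewrite cabsE/= expr0n expr1n add0r sqrtr1. Qed.

Lemma Re_le_cabs z : `|Re z| <= cabs z.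
Proof. by rewrite -sqrtr_sqr cabsE ler_wsqrtr// lerDl sqr_ge0. Qed.

Lemma Im_le_cabs z : `|Im z| <= cabs z.
Proof. by rewrite -sqrtr_sqr cabsE ler_wsqrtr// lerDr sqr_ge0. Qed.

Lemma cabs_le_ReIm z : cabs z <= `|Re z| + `|Im z|.
Proof.
rewrite -(@ler_pXn2r _ 2)// ?nnegrE ?cabs_ge0// ?addr_ge0//.
rewrite cabs_sqr sqrrD !real_normK ?num_real//.
have : 0 <= `|Re z| * `|Im z| by rewrite mulr_ge0.
by move=> ?; rewrite mulr2n; lra.
Qed.

Lemma ReM z w : Re (z * w) = Re z * Re w - Im z * Im w.
Proof. by case: z; case: w. Qed.

Lemma ImM z w : Im (z * w) = Re z * Im w + Im z * Re w.
Proof. by case: z; case: w. Qed.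

Lemma ReD z w : Re (z + w) = Re z + Re w.
Proof. by case: z; case: w. Qed.

Lemma ImD z w : Im (z + w) = Im z + Im w.
Proof. by case: z; case: w. Qed.

Lemma ReN z : Re (- z) = - Re z.
Proof. by case: z. Qed.

Lemma ImN z : Im (- z) = - Im z.
Proof. by case: z. Qed.

Lemma ceqP z w : Re z = Re w -> Im z = Im w -> z = w.
Proof. by case: z; case: w => a b c d /= -> ->. Qed.

Lemma cabs_polar x : cabs (polar x) = 1.
Proof. by rewrite cabsE/= cos2Dsin2 sqrtr1. Qed.

Lemma polarD x y : polar (x + y) = polar x * polar y.
Proof.
apply: ceqP; rewrite ?ReM ?ImM/= ?cosD ?sinD//.
by rewrite addrC mulrC; congr (_ + _); rewrite mulrC.
Qed.

Lemma polar0 : polar 0 = 1 :> C R.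
Proof. by apply: ceqP; rewrite /= ?cos0 ?sin0. Qed.

Lemma polarV x : (polar x)^-1 = polar (- x) :> C R.
Proof.
apply: (@mulfI _ (polar x)); first by rewrite -cabs_gt0 cabs_polar.
by rewrite -polarD subrr polar0 mulfV// -cabs_gt0 cabs_polar.
Qed.

Lemma polarX x n : polar x ^+ n = polar (n%:R * x) :> C R.
Proof.
elim: n => [|n IH]; first by rewrite mul0r polar0.
by rewrite exprS IH -polarD -natr1 mulrDl mul1r addrC.
Qed.

Lemma polar2pi : polar (2 * pi) = 1 :> C R.
Proof. by apply: ceqP; rewrite /= mulrC mulr_natr ?cos2pi ?sin2pi. Qed.

End ComplexModulus.

(** * Derivatives and integrals of complex functions of a real variable *)

Section ComplexCalculus.
Context {R : realType}.
Implicit Types (u v U V : R -> C R) (x y : R).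

(** Real and imaginary parts are differentiated separately, so that the mean value theorem and the
    fundamental theorem of calculus for real functions apply to each. *)
Definition cder U x (d : C R) : Prop :=
  is_derive x 1 (fun t => Re (U t)) (Re d) /\
  is_derive x 1 (fun t => Im (U t)) (Im d).

Definition ccont u : Prop :=
  continuous (fun t => Re (u t)) /\ continuous (fun t => Im (u t)).

Lemma cder_eq U x d e : cder U x d -> d = e -> cder U x e.
Proof. by move=> + <-. Qed.

Lemma cder_cst (c : C R) x : cder (fun=> c) x 0.
Proof. by split; exact: is_derive_cst. Qed.

Lemma cderD U V x d e : cder U x d -> cder V x e ->
  cder (fun t => U t + V t) x (d + e).
Proof.
move=> [a b] [a' b']; split.
  by under eq_fun do rewrite ReD; rewrite ReD; exact: is_deriveD.
by under eq_fun do rewrite ImD; rewrite ImD; exact: is_deriveD.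
Qed.

Lemma cderN U x d : cder U x d -> cder (fun t => - U t) x (- d).
Proof.
move=> [a b]; split.
  by under eq_fun do rewrite ReN; rewrite ReN; exact: is_deriveN.
by under eq_fun do rewrite ImN; rewrite ImN; exact: is_deriveN.
Qed.

Lemma cderB U V x d e : cder U x d -> cder V x e ->
  cder (fun t => U t - V t) x (d - e).
Proof. by move=> a b; apply: cderD => //; exact: cderN. Qed.

Lemma cderM U V x d e : cder U x d -> cder V x e ->
  cder (fun t => U t * V t) x (d * V x + U x * e).
Proof.
move=> [a b] [a' b']; split.
  under eq_fun do rewrite ReM.
  by apply: is_derive_eq; rewrite !(ReD, ReM, ImD, ImM)/= /GRing.scale/=; ring.
under eq_fun do rewrite ImM.
by apply: is_derive_eq; rewrite !(ReD, ReM, ImD, ImM)/= /GRing.scale/=; ring.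
Qed.

Lemma cderMl (c : C R) U x d : cder U x d -> cder (fun t => c * U t) x (c * d).
Proof.
move=> h; apply: cder_eq; first by apply: cderM h; exact: cder_cst.
by rewrite mul0r add0r.
Qed.

Lemma cderMr (c : C R) U x d : cder U x d -> cder (fun t => U t * c) x (d * c).
Proof.
move=> h; apply: cder_eq; first by apply: (cderM h); exact: cder_cst.
by rewrite mulr0 addr0.
Qed.

Lemma cder_polar (k x : R) :
  cder (fun t => polar (k * t)) x ((k%:C)%C * 'i%C * polar (k * x)).
Proof.
have h : is_derive x 1 (fun t : R => k * t) k.
  by apply: is_derive_eq; rewrite /GRing.scale/= mulr1.
split; rewrite !(ReM, ImM)/=.
  rewrite [X in is_derive _ _ _ X](_ : _ = - sin (k * x) * k); last by ring.
  exact: (@is_derive1_comp _ (@cos R) (fun t => k * t)).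
rewrite [X in is_derive _ _ _ X](_ : _ = cos (k * x) * k); last by ring.
exact: (@is_derive1_comp _ (@sin R) (fun t => k * t)).
Qed.

Lemma cder_polar1 (x : R) : cder (@polar R) x ('i%C * polar x).
Proof.
have := cder_polar 1 x; under [X in cder X]eq_fun do rewrite mul1r.
by rewrite mul1r mul1r.
Qed.

Lemma cder_expR (x : R) :
  cder (fun t => ((expR t)%:C)%C) x ((expR x)%:C)%C.
Proof.
split=> /=; first exact: is_derive_expR.
exact: is_derive_cst.
Qed.

(* The factor 2 comes from treating the two real components separately. *)
Lemma cder_mvt U u (a b M : R) : a <= b ->
  (forall x, a <= x <= b -> cder U x (u x)) ->
  (forall x, a <= x <= b -> cabs (u x) <= M) ->
  cabs (U b - U a) <= 2 * M * (b - a).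
Proof.
move=> ab dU uM.
have key (g : C R -> R) : (forall z, `|g z| <= cabs z) ->
    (forall x, a <= x <= b -> is_derive x 1 (fun t => g (U t)) (g (u x))) ->
    `|g (U b) - g (U a)| <= M * (b - a).
  move=> gle gd.
  have [c cab ->] : exists2 c, c \in `[a, b]%R &
      g (U b) - g (U a) = g (u c) * (b - a).
    apply: (@MVT_segment _ (fun t => g (U t)) (fun t => g (u t))) => //.
      move=> x; rewrite in_itv/= => /andP[ax xb]; apply: gd.
      by rewrite !ltW.
    apply: derivable_within_continuous => x; rewrite in_itv/= => /gd h.
    by case: h.
  rewrite normrM (ger0_norm (_ : 0 <= b - a)) ?subr_ge0//.
  rewrite ler_wpM2r ?subr_ge0// (le_trans (gle _))// uM//.
have h1 := key (@Re R) Re_le_cabs (fun x h => (dU x h).1).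
have h2 := key (@Im R) Im_le_cabs (fun x h => (dU x h).2).
apply: (le_trans (cabs_le_ReIm _)); rewrite ReD ReN ImD ImN.
lra.
Qed.

Lemma ccont_cder U (d : R -> C R) : (forall x, cder U x (d x)) -> ccont U.
Proof.
move=> h; split=> x; apply: differentiable_continuous; apply/derivable1_diffP.
  by case: (h x) => [[]].
by case: (h x) => _ [].
Qed.

Lemma ccontM u v : ccont u -> ccont v -> ccont (fun t => u t * v t).
Proof.
move=> [a b] [c d]; split=> x.
  under [X in continuous_at _ X]eq_fun do rewrite ReM.
  by apply: cvgB; apply: cvgM; [exact: a|exact: c|exact: b|exact: d].
under [X in continuous_at _ X]eq_fun do rewrite ImM.
by apply: cvgD; apply: cvgM; [exact: a|exact: d|exact: b|exact: c].
Qed.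

Lemma ccontD u v : ccont u -> ccont v -> ccont (fun t => u t + v t).
Proof.
move=> [a b] [c d]; split=> x.
  under [X in continuous_at _ X]eq_fun do rewrite ReD.
  by apply: cvgD; [exact: a|exact: c].
under [X in continuous_at _ X]eq_fun do rewrite ImD.
by apply: cvgD; [exact: b|exact: d].
Qed.

Lemma ccont_cst (c : C R) : ccont (fun=> c).
Proof. by split=> x; exact: cst_continuous. Qed.

Lemma ccontP u :
  ccont u <-> forall x e, 0 < e -> exists2 d, 0 < d &
    forall y, `|y - x| < d -> cabs (u y - u x) < e.
Proof.
split=> [[hr hi] x e e0|h].
  have e20 : 0 < e / 2 by rewrite divr_gt0.
  have /cvgrPdist_lt /(_ _ e20) := hr x.
  have /cvgrPdist_lt /(_ _ e20) := hi x.
  move=> /nbhs_ballP[d1 /= d10 h1] /nbhs_ballP[d2 /= d20 h2].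
  exists (Num.min d1 d2); first by rewrite lt_min d10.
  move=> y; rewrite lt_min => /andP[y1 y2].
  apply: (le_lt_trans (cabs_le_ReIm _)); rewrite ReD ReN ImD ImN.
  have := h1 y; rewrite /ball/= distrC => /(_ y1).
  have := h2 y; rewrite /ball/= distrC => /(_ y2).
  by rewrite distrC => a1; rewrite distrC => a2; lra.
split=> x; apply/cvgrPdist_lt => e e0; have [d d0 hd] := h x e e0;
  near=> y; rewrite distrC.
  rewrite -ReN -ReD; apply: (le_lt_trans (Re_le_cabs _)); apply: hd.
  near: y; apply/nbhs_ballP; exists d => //= y.
  by rewrite /ball/= distrC.
rewrite -ImN -ImD; apply: (le_lt_trans (Im_le_cabs _)); apply: hd.
near: y; apply/nbhs_ballP; exists d => //= y.
by rewrite /ball/= distrC.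
Unshelve. all: by end_near. Qed.

Lemma ccontV u : ccont u -> (forall x, u x != 0) -> ccont (fun t => (u t)^-1).
Proof.
move=> /ccontP hu u0; apply/ccontP => x e e0.
have c0 : 0 < cabs (u x) by rewrite cabs_gt0.
have e1 : 0 < Num.min (cabs (u x) / 2) (e * cabs (u x) ^+ 2 / 2).
  by rewrite lt_min !divr_gt0// mulr_gt0// exprn_gt0.
have [d d0 hd] := hu x _ e1; exists d => // y /hd.
rewrite lt_min => /andP[h1 h2].
have hy : cabs (u x) / 2 < cabs (u y).
  have := cabsDB (u x) (u y - u x); rewrite [u x + _]addrC subrK; lra.
have cy : 0 < cabs (u y) by lra.
have -> : (u y)^-1 - (u x)^-1 = (u x - u y) / (u y * u x).
  by field; rewrite !u0.
rewrite cabsM cabsV cabsM ltr_pdivrMr; last exact: mulr_gt0.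
rewrite -cabsN opprB (lt_le_trans h2)//.
rewrite expr2 [leLHS](_ : _ = e * (cabs (u x) / 2 * cabs (u x))); last by ring.
by rewrite ler_pM2l// ler_pM2r// ltW.
Qed.

(** The integral from [a], differentiated at an interior point of [[a, x + 1]]; this yields a
    primitive only to the right of [a]. *)
Lemma real_primitive (g : R -> R) (a : R) : continuous g ->
  exists G : R -> R, forall x, a < x -> is_derive x 1 G (g x).
Proof.
move=> cg.
exists (fun x => \int[lebesgue_measure]_(t in `[a, x]) (g t))%R => x ax.
have [d1 d2] := @continuous_FTC1_closed R g a x (x + 1) ltac:(lra)
  (@continuous_compact_integrable R g _ (@segment_compact R a (x + 1))
     (continuous_subspaceT cg)) ax (cg x).
by rewrite -d2 derive1E; exact: derivableP.
Qed.

Lemma primitive_exists u (a : R) : ccont u ->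
  exists U, forall x, a < x -> cder U x (u x).
Proof.
move=> [cr ci]; have [G hG] := real_primitive a cr.
have [H hH] := real_primitive a ci.
by exists (fun t => G t +i* H t)%C => x ax; split=> /=; [exact: hG|exact: hH].
Qed.

(** A choice that depends on the integrand alone: equal integrands get the same primitive, which
    later identifies the two sides of a rectangle glued by periodicity. The default 0 never occurs
    for a continuous integrand. *)
Definition prim (a : R) u : R -> C R :=
  xget (fun=> 0) [set U | forall x, a < x -> cder U x (u x)].

Lemma primP a u : ccont u -> forall x, a < x -> cder (prim a u) x (u x).
Proof.
move=> cu; rewrite /prim; case: xgetP => //= h.
by have [U hU] := primitive_exists a cu; have := h U.
Qed.

(* Integral over a period; the primitive is taken on a neighbourhood of
   [[0, 2 pi]]. *)
Definition cI u : C R := prim (-1) u (2 * pi) - prim (-1) u 0.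

Lemma pi2_gt0 : 0 < 2 * pi :> R.
Proof. by rewrite mulr_gt0// pi_gt0. Qed.

(** The difference of two primitives has derivative 0, and [cder_mvt] with [M = 0] makes it
    constant. Values and linearity of [cI] are then read off explicit primitives. *)
Lemma cI_unique u U : ccont u -> (forall x, -1 < x -> cder U x (u x)) ->
  cI u = U (2 * pi) - U 0.
Proof.
move=> cu hU; apply/eqP; rewrite -subr_eq0 -cabs_eq0; apply/eqP.
have p0 := pi2_gt0.
have /(_ 0) := @cder_mvt (fun t => prim (-1) u t - U t) (fun=> 0) 0 (2 * pi) _.
rewrite mulr0 mul0r => h; apply: le_anti; rewrite cabs_ge0 andbT.
have -> : cI u - (U (2 * pi) - U 0) = (prim (-1) u (2 * pi) - U (2 * pi)) -
  (prim (-1) u 0 - U 0) by rewrite /cI; ring.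
apply: h; [exact: ltW| |by move=> *; rewrite cabs0].
move=> x /andP[x0 _]; rewrite -(subrr (u x)); apply: cderB.
  by apply: primP => //; lra.
by apply: hU; lra.
Qed.

(** The constant is the factor 2 of [cder_mvt] times the length of the period. *)
Lemma cI_bound u M : ccont u ->
  (forall t, 0 <= t <= 2 * pi -> cabs (u t) <= M) ->
  cabs (cI u) <= 4 * pi * M.
Proof.
move=> cu uM; have -> : 4 * pi * M = 2 * M * (2 * pi - 0) by ring.
apply: (@cder_mvt _ u) => //; first exact: ltW pi2_gt0.
by move=> x /andP[x0 _]; apply: primP => //; lra.
Qed.

Lemma cID u v : ccont u -> ccont v -> cI (fun t => u t + v t) = cI u + cI v.
Proof.
move=> cu cv.
rewrite (@cI_unique _ (fun t => prim (-1) u t + prim (-1) v t)).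
- by rewrite /cI; ring.
- exact: ccontD.
- by move=> x x1; apply: cderD; exact: primP.
Qed.

Lemma cIM (c : C R) u : ccont u -> cI (fun t => c * u t) = c * cI u.
Proof.
move=> cu.
rewrite (@cI_unique _ (fun t => c * prim (-1) u t)).
- by rewrite /cI; ring.
- by apply: ccontM => //; exact: ccont_cst.
- by move=> x x1; apply: cderMl; exact: primP.
Qed.

Lemma cIB u v : ccont u -> ccont v -> cI (fun t => u t - v t) = cI u - cI v.
Proof.
move=> cu cv; rewrite -[- cI v]mulN1r -cIM//.
rewrite -cID//; last by apply: ccontM => //; exact: ccont_cst.
by congr cI; apply/funext => t; rewrite mulN1r.
Qed.

Lemma cI_cst (c : C R) : cI (fun=> c) = ((2 * pi)%:C)%C * c.
Proof.
rewrite (@cI_unique _ (fun t => (t%:C)%C * c)).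
- by rewrite mul0r subr0.
- exact: ccont_cst.
- move=> x _; apply: cder_eq.
    apply: (@cderMr c (fun t => (t%:C)%C) x 1).
    by split=> /=; [exact: is_derive_id|exact: is_derive_cst].
  by rewrite mul1r.
Qed.

End ComplexCalculus.

(** * Goursat's bisection of rectangles *)

Section Goursat.
Context {R : realType}.
Variable J : R -> R -> R -> R -> C R.
Hypothesis J1 : forall m a b c d, J a b c d = J a m c d + J m b c d.
Hypothesis J2 : forall m a b c d, J a b c d = J a b c m + J a b m d.

Let quarter (q : R * R * (R * R)) (p : bool * bool) :=
  let m := (q.1.1 + q.1.2) / 2 in let n := (q.2.1 + q.2.2) / 2 in
  ((if p.1 then (q.1.1, m) else (m, q.1.2)),
   (if p.2 then (q.2.1, n) else (n, q.2.2))).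

Let val (q : R * R * (R * R)) := cabs (J q.1.1 q.1.2 q.2.1 q.2.2).

(** Additivity bounds the value on a rectangle by the sum over its four quarters, which cannot all
    stay below a fourth of it. *)
Let quarter_large q : exists p, val q / 4 <= val (quarter q p).
Proof.
apply/not_existsP => h.
have lt p : val (quarter q p) < val q / 4.
  by rewrite ltNge; apply/negP; exact: h.
have : val q <= val (quarter q (true, true)) + val (quarter q (true, false)) +
   (val (quarter q (false, true)) + val (quarter q (false, false))).
  set m := (q.1.1 + q.1.2) / 2; set n := (q.2.1 + q.2.2) / 2.
  rewrite /val/= -/m -/n (J1 m) (J2 n q.1.1 m) (J2 n m).
  by rewrite (le_trans (cabsD _ _))// lerD// cabsD.
have := lt (true, true); have := lt (true, false).
have := lt (false, true); have := lt (false, false); lra.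
Qed.

Let step q := quarter q (sval (cid (quarter_large q))).

(* [J a b c d] stands for a boundary integral over [[a, b] x [c, d]]: it is
   additive under subdivision, and complex differentiability makes it small
   with respect to the squared diameter. *)
Lemma goursat_bisection (a b c d : R) : a <= b -> c <= d ->
  (forall (s t e : R), a <= s <= b -> c <= t <= d -> 0 < e ->
    exists2 del : R, 0 < del & forall a' b' c' d',
      a <= a' -> a' <= s -> s <= b' -> b' <= b ->
      c <= c' -> c' <= t -> t <= d' -> d' <= d ->
      b' - a' < del -> d' - c' < del ->
      cabs (J a' b' c' d') <= e * (b' - a' + (d' - c')) ^+ 2) ->
  J a b c d = 0.
Proof.
move=> ab cd loc.
pose Q n := iter n step ((a, b), (c, d)).
have QS n : exists p, Q n.+1 = quarter (Q n) p /\ val (Q n) / 4 <= val (Q n.+1).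
  exists (sval (cid (quarter_large (Q n)))); split => //.
  by rewrite /Q iterS -/(Q n) /step; case: cid.
have Qord n : (Q n).1.1 <= (Q n).1.2 /\ (Q n).2.1 <= (Q n).2.2.
  elim: n => [//|n [h1 h2]]; have [[[] []] [-> _]] := QS n; rewrite /quarter/=; lra.
have Qmono n : [/\ (Q n).1.1 <= (Q n.+1).1.1, (Q n.+1).1.2 <= (Q n).1.2,
    (Q n).2.1 <= (Q n.+1).2.1 & (Q n.+1).2.2 <= (Q n).2.2].
  have [h1 h2] := Qord n.
  by have [[[] []] [-> _]] := QS n; rewrite /quarter/=; split; lra.
have Qsz n : (Q n).1.2 - (Q n).1.1 = (b - a) / 2 ^+ n /\
    (Q n).2.2 - (Q n).2.1 = (d - c) / 2 ^+ n.
  elim: n => [|n [h1 h2]]; first by rewrite expr0 !divr1.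
  have E x : x / 2 ^+ n.+1 = x / 2 ^+ n / 2 :> R by rewrite exprSr invfM mulrA.
  by have [[[] []] [-> _]] := QS n; rewrite !E -h1 -h2 /quarter/=; split; lra.
have Qval n : val (Q 0%N) / 4 ^+ n <= val (Q n).
  elim: n => [|n IH]; first by rewrite expr0 divr1.
  have [_ [_]] := QS n; apply: le_trans.
  by rewrite exprSr invfM mulrA ler_pM2r// invr_gt0.
have Qmono' n k : [/\ (Q n).1.1 <= (Q (n + k)%N).1.1,
    (Q (n + k)%N).1.2 <= (Q n).1.2,
    (Q n).2.1 <= (Q (n + k)%N).2.1 & (Q (n + k)%N).2.2 <= (Q n).2.2].
  elim: k => [|k [h1 h2 h3 h4]]; first by rewrite addn0; split.
  have [g1 g2 g3 g4] := Qmono (n + k)%N; rewrite addnS.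
  by split; [exact: le_trans g1|exact: le_trans h2|exact: le_trans g3|
    exact: le_trans h4].
have nested (l r : nat -> R) : (forall n, l n <= r n) ->
    (forall n k, l n <= l (n + k)%N /\ r (n + k)%N <= r n) ->
    exists x, forall n, l n <= x <= r n.
  move=> lr mono.
  have ub m n : l m <= r n.
    have [h1 _] := mono m n; have [_ h2] := mono n m.
    apply: (le_trans h1); apply: (le_trans (lr _)).
    by rewrite addnC.
  exists (sup (range l)) => n; apply/andP; split.
    apply: ub_le_sup; last by exists n.
    by exists (r 0%N) => _ [m _ <-].
  apply: ge_sup; first by exists (l 0%N), 0%N.
  by move=> _ [m _ <-].
have [s hs] : exists s, forall n, (Q n).1.1 <= s <= (Q n).1.2.
  apply: (nested (fun n => (Q n).1.1) (fun n => (Q n).1.2)).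
    by move=> n; case: (Qord n).
  by move=> n k; case: (Qmono' n k).
have [t ht] : exists t, forall n, (Q n).2.1 <= t <= (Q n).2.2.
  apply: (nested (fun n => (Q n).2.1) (fun n => (Q n).2.2)).
    by move=> n; case: (Qord n).
  by move=> n k; case: (Qmono' n k).
apply/eqP; rewrite -cabs_eq0; apply/eqP/le_anti; rewrite cabs_ge0 andbT.
apply/ler_addgt0Pr => e e0; rewrite add0r.
pose L := b - a + (d - c).
have L0 : 0 <= L by rewrite /L; lra.
(* The n-th rectangle has half perimeter [L / 2 ^+ n], so its value is at most
   [e' * L ^+ 2 / 4 ^+ n], while bisection keeps it above [val (Q 0) / 4 ^+ n]; the powers of 4
   cancel. The [+ 1] covers [L = 0]. *)
pose e' := e / (L ^+ 2 + 1).
have L1 : 0 < L ^+ 2 + 1 by rewrite ltr_wpDl// sqr_ge0.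
have e'0 : 0 < e' by rewrite divr_gt0.
have [del del0 hdel] := loc s t e' (hs 0%N) (ht 0%N) e'0.
have [n hn] : exists n, L / 2 ^+ n < del.
  have := archi_boundP (divr_ge0 L0 (ltW del0)); set n := Num.bound _ => hn.
  exists n; rewrite ltr_pdivrMr ?exprn_gt0// mulrC -ltr_pdivrMr//.
  apply: (lt_trans hn); rewrite -natrX ltr_nat.
  exact: ltn_expl.
have := hdel (Q n).1.1 (Q n).1.2 (Q n).2.1 (Q n).2.2.
have [m1 m2 m3 m4] := Qmono' 0%N n; rewrite add0n in m1 m2 m3 m4.
move: (hs n) (ht n) => /andP[s1 s2] /andP[t1 t2].
have [z1 z2] := Qsz n; rewrite z1 z2 -mulrDl -/L.
have p2 : 0 < 2 ^+ n :> R by rewrite exprn_gt0.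
have lt1 : (b - a) / 2 ^+ n < del.
  by apply: le_lt_trans hn; rewrite ler_pM2r ?invr_gt0// /L; lra.
have lt2 : (d - c) / 2 ^+ n < del.
  by apply: le_lt_trans hn; rewrite ler_pM2r ?invr_gt0// /L; lra.
move=> /(_ m1 s1 s2 m2 m3 t1 t2 m4 lt1 lt2) => hJ.
have := le_trans (Qval n) hJ.
rewrite expr_div_n -exprM mulnC exprM (_ : 2 ^+ 2 = 4 :> R); last by ring.
rewrite mulrA ler_pM2r ?invr_gt0 ?exprn_gt0// => /le_trans; apply.
by rewrite /e' mulrAC ler_pdivrMr// ler_pM2l// lerDl.
Qed.

End Goursat.

(** * Cauchy's integral formula on a disc *)

Section Cauchy.
Context {R : realType}.
Implicit Types (f : C R -> C R) (z d : C R).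

(** Written without a quotient and with real radii, so that [h = 0] is harmless and all estimates
    stay among real numbers. *)
Definition cdiff f z d : Prop := forall e : R, 0 < e -> exists2 del : R, 0 < del &
  forall h, cabs h < del -> cabs (f (z + h) - f z - d * h) <= e * cabs h.

Lemma cdiff_continuous f z d : cdiff f z d -> forall e : R, 0 < e ->
  exists2 del, 0 < del & forall w, cabs (w - z) < del -> cabs (f w - f z) < e.
Proof.
move=> fd e e0; have [del del0 h] := fd 1 ltr01.
have p : 0 < 2 + cabs d by have := cabs_ge0 d; lra.
exists (Num.min del (e / (2 + cabs d))); first by rewrite lt_min del0 divr_gt0.
move=> w; rewrite lt_min => /andP[/h]; rewrite (addrC z) subrK mul1r => hw.
rewrite ltr_pdivlMr// => we.
have := cabsD (f w - f z - d * (w - z)) (d * (w - z)); rewrite subrK cabsM.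
have := cabs_ge0 (w - z).
lra.
Qed.

Variables (f : C R -> C R) (rho r : R) (z : C R).
Hypothesis r_rho : r < rho.
Hypothesis zr : cabs z < r.
Hypothesis fD : forall w, cabs w < rho -> exists d, cdiff f w d.

Let r0 : 0 < r. Proof. exact: le_lt_trans (cabs_ge0 z) zr. Qed.

Definition circle (t : R) : C R := (r%:C)%C * polar t.
Let w t := circle t - z.
(* Contracts the circle to [z] as [s] goes to -oo; the exponential scale turns
   the homotopy annulus into a rectangle for [(s, t)]. *)
Let gam (s t : R) : C R := z + ((expR (Num.min s 0))%:C)%C * w t.
Let Phi s t := f (gam s t).
(** The derivative of [w] is ['i * circle], so ['i * ker t] dt is d zeta / (zeta - z) pulled back to
    the circle. *)
Let ker t := circle t / w t.

Lemma circleE t : circle t = (r%:C)%C * polar t.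
Proof. by []. Qed.

Lemma cabs_circle t : cabs (circle t) = r.
Proof. by rewrite /circle cabsM cabs_real cabs_polar mulr1 ger0_norm// ltW. Qed.

Let w_ge t : r - cabs z <= cabs (w t).
Proof. by have := cabsDB (circle t) (- z); rewrite cabsN cabs_circle. Qed.

Let w_le t : cabs (w t) <= 2 * r.
Proof. by apply: (le_trans (cabsB _ _)); rewrite cabs_circle; move: zr; lra. Qed.

Let w_neq0 t : w t != 0.
Proof. by rewrite -cabs_gt0 (lt_le_trans _ (w_ge t))// subr_gt0. Qed.

Let ker_bound t : cabs (ker t) <= r / (r - cabs z).
Proof.
rewrite /ker cabsM cabsV cabs_circle ler_pM2l// lef_pV2 ?posrE//.
- by rewrite cabs_gt0.
- by rewrite subr_gt0.
Qed.

Let cder_w t : cder w t ('i%C * circle t).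
Proof.
rewrite /w /circle.
apply: cder_eq; first by apply: cderB; [apply: cderMl; exact: cder_polar1|exact: cder_cst].
by rewrite subr0 mulrCA.
Qed.

Let ccont_w : ccont w. Proof. exact: ccont_cder cder_w. Qed.

Lemma ccont_circle : ccont circle.
Proof.
apply: (@ccont_cder _ _ (fun t => (r%:C)%C * ('i%C * polar t))) => t.
by apply: cderMl; exact: cder_polar1.
Qed.

Let ccont_ker : ccont ker.
Proof.
by apply: ccontM; [exact: ccont_circle|exact: ccontV].
Qed.

(** [gam s t] is a convex combination of [z] and a point of the circle. Truncating [s] at 0 makes
    this true for all real [s], so that primitives in [s] exist past the edge of the rectangle. *)
Let gam_bound s t : cabs (gam s t) < rho.
Proof.
have -> : gam s t = ((1 - expR (Num.min s 0))%:C)%C * z +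
    ((expR (Num.min s 0))%:C)%C * circle t.
  by rewrite /gam /w rmorphB/= rmorph1; ring.
have e0 := expR_gt0 (Num.min s 0).
have e1 : expR (Num.min s 0) <= 1 by rewrite -expR0 ler_expR ge_min lexx orbT.
apply: (le_lt_trans (cabsD _ _)).
rewrite (cabsM _ z) (cabsM _ (circle t)) cabs_circle !cabs_real.
rewrite !ger0_norm ?subr_ge0// ?ltW//.
have : (1 - expR (Num.min s 0)) * cabs z <= (1 - expR (Num.min s 0)) * r.
  by rewrite ler_wpM2l ?subr_ge0// ltW.
move: r_rho; lra.
Qed.

Let w_lip t t' : cabs (w t - w t') <= 2 * r * `|t - t'|.
Proof.
wlog tt : t t' / t' <= t.
  move=> h; have [/h//|/ltW /h] := leP t' t.
  by rewrite -(cabsN (w t' - _)) opprB (distrC t').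
rewrite ger0_norm ?subr_ge0//.
apply: (@cder_mvt _ _ (fun t => 'i%C * circle t)) => //.
by move=> x _; rewrite cabsM cabsi cabs_circle mul1r.
Qed.

Let expR_lip (s s' : R) : s <= 0 -> s' <= 0 -> `|expR s - expR s'| <= `|s - s'|.
Proof.
wlog ss : s s' / s' <= s.
  move=> h a b; have [/h|/ltW /h] := leP s' s; first exact.
  by rewrite distrC (distrC s); apply.
move=> s0 s'0; rewrite !ger0_norm ?subr_ge0 ?ler_expR//.
have [c cs ->] := @MVT_segment R expR expR s' s ss
   (fun x _ => is_derive_expR x) (continuous_subspaceT (@continuous_expR R)).
rewrite ler_piMl ?subr_ge0// -expR0 ler_expR.
by move: cs; rewrite in_itv/= => /andP[_ /le_trans]; apply.
Qed.

Let min_lip (s s' : R) : `|Num.min s 0 - Num.min s' 0| <= `|s - s'|.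
Proof.
by rewrite !minEle; case: (leP s 0) => a; case: (leP s' 0) => b //;
  rewrite ?subr0 ?sub0r ?normr0 ?normrN//;
  [rewrite !ler0_norm|rewrite ler0_norm// ger0_norm]; lra.
Qed.

(** One constant serves both variables: [2 * r] bounds [w] and is also the Lipschitz constant that
    [cder_mvt] gives for it. *)
Let gam_lip s t s' t' :
  cabs (gam s t - gam s' t') <= 2 * r * (`|s - s'| + `|t - t'|).
Proof.
have -> : gam s t - gam s' t' =
   ((expR (Num.min s 0) - expR (Num.min s' 0))%:C)%C * w t +
   ((expR (Num.min s' 0))%:C)%C * (w t - w t').
  by rewrite /gam rmorphB/=; ring.
have m0 (x : R) : Num.min x 0 <= 0 by rewrite ge_min lexx orbT.
rewrite (le_trans (cabsD _ _))// !cabsM !cabs_real mulrDr lerD//.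
  rewrite mulrC ler_pM ?cabs_ge0 ?w_le//.
  exact: le_trans (expR_lip (m0 _) (m0 _)) (min_lip _ _).
rewrite -[leRHS]mul1r ler_pM ?cabs_ge0//.
by rewrite ger0_norm ?expR_ge0// -expR0 ler_expR.
Qed.

Let ccontPhi (a b : R -> R) : (forall x y, `|a x - a y| <= `|x - y|) ->
  (forall x y, `|b x - b y| <= `|x - y|) -> ccont (fun t => Phi (a t) (b t)).
Proof.
move=> la lb; apply/ccontP => x e e0.
have [d fd] := fD (gam_bound (a x) (b x)).
have [del del0 h] := cdiff_continuous fd e0.
have p : 0 < 4 * r by rewrite mulr_gt0.
exists (del / (4 * r)); first by rewrite divr_gt0.
move=> y; rewrite ltr_pdivlMr// => yx; apply: h.
apply: (le_lt_trans (gam_lip _ _ _ _)).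
apply: le_lt_trans yx.
rewrite [leRHS](_ : _ = 2 * r * (`|y - x| + `|y - x|)); last by ring.
by rewrite ler_pM2l ?mulr_gt0// lerD.
Qed.

Let cPhi1 t : ccont (fun s => Phi s t).
Proof. by apply: (@ccontPhi id (fun=> t)) => // x y; rewrite subrr normr0. Qed.

Let cPhi2 s : ccont (fun t => Phi s t).
Proof. by apply: (@ccontPhi (fun=> s) id) => // x y; rewrite subrr normr0. Qed.

Let cPhiker s : ccont (fun t => Phi s t * ker t).
Proof. exact: ccontM. Qed.

(** In the variables (s, t) the form f(zeta) d zeta / (zeta - z) is Phi (ds + i ker dt), and [J] is
    its integral over the boundary of a rectangle. Goursat gives [J = 0], and the sides at [t = 0]
    and [t = 2 * pi] cancel because the loop closes. *)
Let homotopy_invariance (S : R) : S <= 0 ->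
  cI (fun t => Phi S t * ker t) = cI (fun t => Phi 0 t * ker t).
Proof.
move=> S0.
pose P s := prim (-1) (fun t => Phi s t * ker t).
pose Q t := prim (S - 1) (fun s => Phi s t).
pose J (a b c d : R) := 'i%C * ((P b d - P b c) - (P a d - P a c)) -
   ((Q d b - Q d a) - (Q c b - Q c a)).
have p0 := @pi2_gt0 R.
have : J S 0 0 (2 * pi) = 0.
  apply: goursat_bisection => //.
  - by move=> *; rewrite {}/J; clearbody P Q; ring.
  - by move=> *; rewrite {}/J; clearbody P Q; ring.
  - exact: ltW.
  move=> s t e /andP[Ss s0] /andP[t0 t2] e0.
  have [d fd] := fD (gam_bound s t).
  pose B := r / (r - cabs z).
  have B0 : 0 < B by rewrite divr_gt0// subr_gt0.
  (* The errors on the four sides add up to at most [4 * (e' * (2 * r * L)) * (B * L + L)], which is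
     [e * L ^+ 2]. *)
  pose e' := e / (8 * r * (B + 1)).
  have k0 : 0 < 8 * r * (B + 1) by rewrite !mulr_gt0//; lra.
  have e'0 : 0 < e' by rewrite divr_gt0.
  have [del del0 hdel] := fd e' e'0.
  exists (del / (8 * r)); first by rewrite divr_gt0// mulr_gt0.
  move=> a' b' c' d' Sa as' sb b0 c0 ct td d2.
  rewrite !ltr_pdivlMr ?mulr_gt0// => ab cd.
  pose L := b' - a' + (d' - c').
  (* Error of the affine approximation of [f] at [gam s t], the only part of [f] that survives in
     [J]. *)
  pose E s' t' := Phi s' t' - f (gam s t) - d * (gam s' t' - gam s t).
  have Ele s' t' : a' <= s' <= b' -> c' <= t' <= d' ->
      cabs (E s' t') <= e' * (2 * r * L).
    move=> /andP[s1 s2] /andP[t1 t3].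
    have le1 : cabs (gam s' t' - gam s t) <= 2 * r * L.
      apply: (le_trans (gam_lip _ _ _ _)); rewrite ler_pM2l ?mulr_gt0//.
      by rewrite /L lerD// ler_norml; apply/andP; split; lra.
    rewrite /E /Phi -{1}(subrK (gam s t) (gam s' t')) [in f _]addrC.
    apply: (@le_trans _ _ (e' * cabs (gam s' t' - gam s t))).
      apply: hdel; apply: (le_lt_trans le1).
      rewrite (_ : _ * L = ((b' - a') * (8 * r) + (d' - c') * (8 * r)) / 4).
        by lra.
      by rewrite /L; field.
    by rewrite ler_pM2l.
  have gamE s' t' : s' <= 0 -> gam s' t' = z + ((expR s')%:C)%C * w t'.
    by move=> s'0; rewrite /gam min_l.
  (* Contribution of the linear part of [f]: it is the same for the two pairs of opposite sides and
     drops out of their difference [J]. *)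
  pose D := d * (((expR b')%:C)%C - ((expR a')%:C)%C) * (w d' - w c').
  have L0 : 0 <= L by rewrite /L; lra.
  have rL : 0 <= e' * (2 * r * L) 
    by apply: mulr_ge0 (ltW e'0) _; apply: mulr_ge0 => //; apply: mulr_ge0 (ltW r0).
  have h1 : cabs ('i%C * ((P b' d' - P b' c') - (P a' d' - P a' c')) - D) <=
      2 * (2 * (e' * (2 * r * L)) * B) * (d' - c').
    have -> : 'i%C * ((P b' d' - P b' c') - (P a' d' - P a' c')) - D =
       ('i%C * (P b' d' - P a' d') -
          d * (((expR b')%:C)%C - ((expR a')%:C)%C) * w d') -
       ('i%C * (P b' c' - P a' c') -
          d * (((expR b')%:C)%C - ((expR a')%:C)%C) * w c').
      by rewrite /D; ring.
    apply: (@cder_mvt _ (fun t => 'i%C * (P b' t - P a' t) -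
          d * (((expR b')%:C)%C - ((expR a')%:C)%C) * w t)
          (fun t => 'i%C * ker t * (E b' t - E a' t))).
    - lra.
    - move=> x /andP[cx xd]; apply: cder_eq.
        apply: cderB; last by apply: cderMl; exact: cder_w.
        by apply: cderMl; apply: cderB; apply: primP => //; lra.
      rewrite /E (gamE b')// (gamE a'); last by lra.
      have -> : circle x = ker x * w x by rewrite /ker divfK.
      ring.
    - move=> x xcd; rewrite cabsM cabsM cabsi mul1r mulrC.
      apply: ler_pM; rewrite ?cabs_ge0//.
      rewrite (le_trans (cabsB _ _))//.
      have := @Ele b' x; rewrite lexx andbT => /(_ ltac:(lra) xcd).
      have := @Ele a' x; rewrite lexx /= => /(_ ltac:(lra) xcd).
      lra.
  have h2 : cabs ((Q d' b' - Q d' a') - (Q c' b' - Q c' a') - D) <=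
      2 * (2 * (e' * (2 * r * L))) * (b' - a').
    have -> : (Q d' b' - Q d' a') - (Q c' b' - Q c' a') - D =
       (Q d' b' - Q c' b' - ((expR b')%:C)%C * (d * (w d' - w c'))) -
       (Q d' a' - Q c' a' - ((expR a')%:C)%C * (d * (w d' - w c'))).
      by rewrite /D; ring.
    apply: (@cder_mvt _ (fun s => Q d' s - Q c' s -
          ((expR s)%:C)%C * (d * (w d' - w c')))
          (fun s => E s d' - E s c')).
    - lra.
    - move=> x /andP[ax xb]; apply: cder_eq.
        apply: cderB; last by apply: cderMr; exact: cder_expR.
        by apply: cderB; apply: primP => //; lra.
      have x0 : x <= 0 by lra.
      rewrite /E !(gamE x)//.
      ring.
    - move=> x xab; rewrite (le_trans (cabsB _ _))//.
      have := @Ele x d'; rewrite lexx andbT => /(_ xab ltac:(lra)).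
      have := @Ele x c'; rewrite lexx /= => /(_ xab ltac:(lra)).
      lra.
  have -> : J a' b' c' d' =
     ('i%C * ((P b' d' - P b' c') - (P a' d' - P a' c')) - D) -
     ((Q d' b' - Q d' a') - (Q c' b' - Q c' a') - D) by rewrite /J; ring.
  apply: (le_trans (cabsB _ _)); apply: (le_trans (lerD h1 h2)).
  have e'E : e' * (8 * r * (B + 1)) = e by rewrite /e' divfK// gt_eqF.
  rewrite -e'E -/L.
  have X1 : B * (d' - c') <= B * L by rewrite ler_pM2l// /L; lra.
  have X2 : b' - a' <= L by rewrite /L; lra.
  apply: (@le_trans _ _ (4 * (e' * (2 * r * L)) * (B * L + L))).
    rewrite [leLHS](_ : _ = 4 * (e' * (2 * r * L)) * (B * (d' - c') + (b' - a')));
      last by ring.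
    by apply: ler_wpM2l; [exact: mulr_ge0|exact: lerD].
  by rewrite le_eqVlt; apply/orP; left; apply/eqP; ring.
rewrite /J => J0.
have Q0 : Q (2 * pi) = Q 0.
  rewrite /Q; congr prim; apply/funext => s.
  by rewrite /Phi /gam /w /circle polar2pi polar0.
have cancel (p p' q q' : C R) : 'i%C * (p - p') - (q - q') = 0 -> q = q' -> p = p'.
  move=> h qq; move: h; rewrite qq subrr subr0 => /eqP.
  by rewrite mulf_eq0 -cabs_eq0 cabsi oner_eq0/= subr_eq0 => /eqP.
by apply: esym; apply: (cancel _ _ _ _ J0); rewrite Q0.
Qed.

(** Shrinking the circle to [z] along the homotopy leaves the integral unchanged, while continuity
    of [f] at [z] freezes the factor [f]. The integral of the kernel is evaluated in
    [cauchy_kernel_mean]. *)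
Let cauchy_pre : cI (fun t => f (circle t) * ker t) = f z * cI ker.
Proof.
have -> : cI (fun t => f (circle t) * ker t) = cI (fun t => Phi 0 t * ker t).
  congr cI; apply/funext => t; congr (f _ * _).
  by rewrite /gam minxx expR0 mul1r /w addrC subrK.
apply/eqP; rewrite -subr_eq0 -cabs_eq0; apply/eqP/le_anti; rewrite cabs_ge0 andbT.
apply/ler_addgt0Pr => e e0; rewrite add0r.
pose B := r / (r - cabs z).
have B0 : 0 < B by rewrite divr_gt0// subr_gt0.
have p0 := @pi_gt0 R.
pose K := 4 * pi * B.
have K0 : 0 < K by rewrite /K mulr_gt0// mulr_gt0.
have [d fd] := fD (lt_trans zr r_rho).
have [del del0 h] := cdiff_continuous fd (divr_gt0 e0 K0).
(* Since [cabs (w t) <= 2 * r], the loop at time [S] stays within [del / 2] of [z]. *)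
pose S := Num.min 0 (ln (del / (4 * r))).
have S0 : S <= 0 by rewrite ge_min lexx.
have eS : expR S <= del / (4 * r).
  rewrite -[leRHS]lnK ?posrE ?divr_gt0 ?mulr_gt0// ler_expR /S.
  by rewrite ge_min lexx orbT.
rewrite -(homotopy_invariance S0) -cIM// -cIB//; last exact: ccontM (ccont_cst _) _.
rewrite (_ : e = 4 * pi * (e / K * B)); last first.
  by rewrite mulrCA -/K divfK// gt_eqF.
apply: cI_bound.
  by apply: ccontD => //; under eq_fun do rewrite -mulNr;
    apply: ccontM => //; exact: ccont_cst.
move=> t _; rewrite -mulrBl cabsM ler_pM ?cabs_ge0//.
apply/ltW/h; rewrite /gam min_l// addrC addKr cabsM cabs_real ger0_norm ?expR_ge0//.
apply: (@le_lt_trans _ _ (del / (4 * r) * (2 * r))).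
  by rewrite ler_pM ?cabs_ge0 ?expR_ge0.
rewrite (_ : _ * _ = del / 2); last by field; rewrite gt_eqF.
lra.
Qed.

Lemma cauchy_formula_pre :
  cI (fun t => f (circle t) * (circle t / (circle t - z))) =
  f z * cI (fun t => circle t / (circle t - z)).
Proof. exact: cauchy_pre. Qed.

End Cauchy.

(** * Taylor expansion at the origin and holomorphy of the derivative *)

Section CauchyConsequences.
Context {R : realType}.
Implicit Types (f : C R -> C R) (u : R -> C R) (z : C R) (r rho : R).

Lemma le0_geometric (x K : R) : 0 <= K -> (forall n, x <= K / 2 ^+ n) -> x <= 0.
Proof.
move=> K0 h; rewrite leNgt; apply/negP => x0.
have := archi_boundP (divr_ge0 K0 (ltW x0)); set n := Num.bound _ => hn.
have := h n; rewrite ler_pdivlMr ?exprn_gt0// leNgt => /negP; apply.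
rewrite mulrC -ltr_pdivrMr// (lt_trans hn)// -natrX ltr_nat.
exact: ltn_expl.
Qed.

Lemma circle_neq0 r t : 0 < r -> circle r t != 0.
Proof. by move=> r0; rewrite -cabs_gt0 (@cabs_circle _ r 0)// cabs0. Qed.

Lemma circle_sub_ge r z t : cabs z < r -> r - cabs z <= cabs (circle r t - z).
Proof. by move=> zr; have := cabsDB (circle r t) (- z); rewrite cabsN (cabs_circle zr). Qed.

Lemma circle_sub_neq0 r z t : cabs z < r -> circle r t - z != 0.
Proof.
by move=> zr; rewrite -cabs_gt0 (lt_le_trans _ (circle_sub_ge t zr))// subr_gt0.
Qed.

Lemma ccontX u n : ccont u -> ccont (fun t => u t ^+ n).
Proof.
move=> cu; elim: n => [|n IH]; first exact: ccont_cst.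
by under eq_fun do rewrite exprS; exact: ccontM.
Qed.

Lemma ccont_pole u r z n : cabs z < r -> ccont u ->
  ccont (fun t => u t * (circle r t / (circle r t - z) ^+ n)).
Proof.
move=> zr cu; apply: ccontM => //; apply: ccontM; first exact: ccont_circle.
apply: ccontV => [|t]; last by rewrite expf_neq0// circle_sub_neq0.
apply: ccontX; apply: ccontD; last exact: ccont_cst.
exact: ccont_circle.
Qed.

Lemma ccont_circleX u r n : 0 < r -> ccont u ->
  ccont (fun t => u t / circle r t ^+ n).
Proof.
move=> r0 cu; apply: ccontM => //; apply: ccontV.
  by apply: ccontX; exact: ccont_circle.
by move=> t; rewrite expf_neq0// circle_neq0.
Qed.

(** Repeated use of c / (c - z) = 1 + (z / c) (c / (c - z)). Keeping the exact remainder avoids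
    exchanging a series with the integral. *)
Lemma cauchy_kernel_expansion u r z n : cabs z < r -> ccont u ->
  cI (fun t => u t * (circle r t / (circle r t - z))) =
  \sum_(k < n) z ^+ k * cI (fun t => u t / circle r t ^+ k) +
  z ^+ n * cI (fun t => u t / circle r t ^+ n * (circle r t / (circle r t - z))).
Proof.
move=> zr cu; have r0 : 0 < r := le_lt_trans (cabs_ge0 z) zr.
elim: n => [|n IH].
  rewrite big_ord0 add0r mul1r; congr cI; apply/funext => t.
  by rewrite expr0 divr1.
rewrite big_ord_recr/= IH -addrA; congr (_ + _).
have cpole k : ccont (fun t => u t / circle r t ^+ k * (circle r t / (circle r t - z))).
  have := @ccont_pole (fun t => u t / circle r t ^+ k) r z 1 zr.
  by move=> /(_ (ccont_circleX k r0 cu)).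
rewrite exprSr -mulrA -mulrDr; congr (_ * _).
rewrite -cIM// -cID.
- congr cI; apply/funext => t.
  have c0 := circle_neq0 t r0; have w0 := circle_sub_neq0 t zr.
  rewrite exprSr.
  have E : circle r t / (circle r t - z) =
      1 + z / circle r t * (circle r t / (circle r t - z)) by field; rewrite c0 w0.
  rewrite {1}E.
  field.
  by rewrite w0 c0 expf_neq0.
- exact: ccont_circleX.
- by apply: ccontM; [exact: ccont_cst|exact: cpole].
Qed.

(** The factor 2 bounds c / (c - z) on the circle, whose distance to [z] is at least [r / 2]. *)
Lemma cauchy_kernel_bound u r z M n : cabs z <= r / 2 -> 0 < r -> ccont u ->
  (forall t, cabs (u t) <= M) ->
  cabs (cI (fun t => u t / circle r t ^+ n * (circle r t / (circle r t - z)))) <=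
  4 * pi * (M / r ^+ n * 2).
Proof.
move=> zr2 r0 cu uM; have zr : cabs z < r by lra.
have M0 : 0 <= M := le_trans (cabs_ge0 _) (uM 0).
apply: cI_bound.
  have := @ccont_pole (fun t => u t / circle r t ^+ n) r z 1 zr.
  by move=> /(_ (ccont_circleX n r0 cu)).
move=> t _; have h := circle_sub_ge t zr.
have := cabs_circle zr t; move: (circle r t) h => c h cr.
rewrite !cabsM !cabsV cabsX cr.
apply: ler_pM; rewrite ?mulr_ge0 ?invr_ge0 ?exprn_ge0 ?cabs_ge0 ?(ltW r0)//.
  by rewrite ler_pM2r// invr_gt0 exprn_gt0.
by rewrite ler_pdivrMr; lra.
Qed.

(** A nonzero power of the circle variable has a multiple of itself as primitive, which is
    periodic. *)
Lemma cI_circleX r k : 0 < r -> cI (fun t => 1 / circle r t ^+ k.+1) = 0.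
Proof.
move=> r0.
pose A : C R := ((- k.+1%:R)%:C)%C * 'i%C.
pose a : C R := A^-1 * (((r%:C)%C) ^+ k.+1)^-1.
have i0 : A != 0.
  by rewrite -cabs_gt0 cabsM cabs_real cabsi mulr1 normrN normr_gt0 pnatr_eq0.
rewrite (@cI_unique _ _ (fun t => a * polar (- k.+1%:R * t))).
- rewrite mulr0 mulNr -polarV -polarX polar2pi expr1n invr1.
  by rewrite polar0 subrr.
- exact: ccont_circleX (ccont_cst _).
- move=> x _; apply: cder_eq; first by apply: cderMl; exact: cder_polar.
  rewrite -/A /a circleE exprMn polarX mulNr -polarV div1r [RHS]invfM.
  by rewrite mulrACA mulVf// mul1r.
Qed.

(** This is the expansion for the constant function 1: all terms but the first vanish by
    [cI_circleX], and the remainder decays like 2^-n. *)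
Lemma cauchy_kernel_mean r z : 0 < r -> cabs z <= r / 2 ->
  cI (fun t => circle r t / (circle r t - z)) = ((2 * pi)%:C)%C.
Proof.
move=> r0 zr2; have zr : cabs z < r by lra.
have cu := @ccont_cst R 1.
apply/eqP; rewrite -subr_eq0 -cabs_eq0; apply/eqP/le_anti; rewrite cabs_ge0 andbT.
have p0 := @pi_gt0 R.
apply: (@le0_geometric _ (4 * pi * 2)); first by rewrite !mulr_ge0// ltW.
move=> n.
have := cauchy_kernel_expansion n.+1 zr cu.
have -> : (fun t => 1 * (circle r t / (circle r t - z))) =
    (fun t => circle r t / (circle r t - z)) by apply/funext => t; rewrite mul1r.
move=> ->; rewrite big_ord_recl/= big1; last first.
  by move=> i _; rewrite /bump/= add1n cI_circleX// mulr0.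
rewrite expr0 mul1r addr0.
have -> : (fun t => 1 / circle r t ^+ 0) = (fun=> 1 : C R).
  by apply/funext => t; rewrite expr0 divr1.
rewrite cI_cst mulr1 [X in X - _]addrC addrK cabsM cabsX.
apply: (@le_trans _ _ ((r / 2) ^+ n.+1 * (4 * pi * (1 / r ^+ n.+1 * 2)))).
  apply: ler_pM; rewrite ?exprn_ge0 ?cabs_ge0//.
    by rewrite lerXn2r// nnegrE ?cabs_ge0//; lra.
  by apply: cauchy_kernel_bound => // t; rewrite cabs1.
rewrite expr_div_n [leLHS](_ : _ = 4 * pi * 2 / 2 ^+ n.+1); last first.
  by field; rewrite ?pnatr_eq0//= !expf_neq0//= gt_eqF.
rewrite ler_pM2l ?mulr_gt0// lef_pV2 ?posrE ?exprn_gt0//.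
by rewrite ler_weXn2l// ler1n.
Qed.

Variables (f : C R -> C R) (rho r : R).
Hypothesis r0 : 0 < r.
Hypothesis r_rho : r < rho.
Hypothesis fD : forall w, cabs w < rho -> exists d, cdiff f w d.

Let u t := f (circle r t).

Let cabs_circ t : cabs (circle r t) = r.
Proof. by apply: (@cabs_circle _ _ 0); rewrite cabs0. Qed.

Lemma ccont_fcircle : ccont u.
Proof.
apply/ccontP => x e e0.
have [d fd] : exists d, cdiff f (circle r x) d by apply: fD; rewrite cabs_circ.
have [del del0 h] := cdiff_continuous fd e0.
have /ccontP /(_ x _ del0)[d2 d20 h2] : ccont (circle r).
  by exact: ccont_circle.
by exists d2 => // y /h2 /h.
Qed.

(** A maximum over one period is carried to all real [t] by periodicity; adding 1 makes the bound
    positive even when [f] vanishes on the circle. *)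
Lemma fcircle_bounded : exists2 M, 0 < M & forall t, cabs (u t) <= M.
Proof.
have [M hM] : exists M, forall t, t \in `[0, 2 * pi] -> cabs (u t) <= M.
  have p0 := @pi2_gt0 R; have [cr ci] := ccont_fcircle.
  have [c1 _ h1] := @EVT_max R _ _ _ (ltW p0) (continuous_subspaceT
    (fun t => @cvg_norm _ _ _ _ _ _ _ (cr t))).
  have [c2 _ h2] := @EVT_max R _ _ _ (ltW p0) (continuous_subspaceT
    (fun t => @cvg_norm _ _ _ _ _ _ _ (ci t))).
  exists (`|Re (u c1)| + `|Im (u c2)|) => t ht.
  apply: (le_trans (cabs_le_ReIm _)); apply: lerD; [exact: h1|exact: h2].
have M0 : 0 <= M.
  apply: le_trans (cabs_ge0 (u 0)) (hM 0 _).
  by rewrite in_itv/= lexx ltW// pi2_gt0.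
exists (M + 1); first by lra.
have per (n : nat) t : polar (t + n%:R * (2 * pi)) = polar t :> C R.
  by rewrite polarD -polarX polar2pi expr1n mulr1.
suff pos t : 0 <= t -> cabs (u t) <= M.
  move=> t; have [t0|t0] := leP 0 t; first by have := pos t t0; lra.
  pose n := Num.bound (- t / (2 * pi)).
  have : - t / (2 * pi) < n%:R by apply: archi_boundP; rewrite divr_ge0 ?oppr_ge0// ltW// pi2_gt0.
  rewrite ltr_pdivrMr ?pi2_gt0// => hn.
  have := pos (t + n%:R * (2 * pi)) ltac:(lra).
  by rewrite /u !circleE per; lra.
move=> t0.
have [n [n1 n2]] : exists n : nat, n%:R * (2 * pi) <= t /\ t < n.+1%:R * (2 * pi).
  have h : 0 <= t / (2 * pi) by rewrite divr_ge0// ltW// pi2_gt0.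
  exists (Num.truncn (t / (2 * pi))).
  rewrite -ler_pdivlMr ?pi2_gt0// -ltr_pdivrMr ?pi2_gt0//.
  have := truncn_itv h. by move=> /andP[].
have -> : u t = u (t - n%:R * (2 * pi)).
  by rewrite /u !circleE -[in RHS](per n) subrK.
apply: hM; rewrite in_itv/= subr_ge0 n1/= lerBlDl.
by rewrite -[X in _ + X]mul1r -mulrDl natr1 ltW.
Qed.

Lemma cauchy_formula z : cabs z <= r / 2 ->
  f z * ((2 * pi)%:C)%C = cI (fun t => u t * (circle r t / (circle r t - z))).
Proof.
move=> zr2; have zr : cabs z < r by move: r0; lra.
by rewrite (cauchy_formula_pre r_rho zr fD) cauchy_kernel_mean.
Qed.

Let pi2C : ((2 * pi)%:C)%C != 0 :> C R.
Proof. by rewrite -cabs_gt0 cabs_real normr_gt0 gt_eqF// pi2_gt0. Qed.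

(** The [a k] are 2 pi times the Taylor coefficients. If all vanish, the remainder
    [z ^+ n * rem n z] tends to 0 on the half disc; otherwise the first nonzero one dominates near
    0. *)
Lemma holomorphic_dichotomy :
  (exists2 del : R, 0 < del & forall z, cabs z < del -> f z = 0) \/
  exists m (c K del : R), [/\ 0 < c, 0 < K, 0 < del &
    forall z, cabs z < del ->
      c * cabs z ^+ m <= cabs (f z) /\ cabs (f z) <= K * cabs z ^+ m].
Proof.
have [M M0 uM] := fcircle_bounded.
have cu := ccont_fcircle.
pose a k := cI (fun t => u t / circle r t ^+ k).
pose rem n z := cI (fun t => u t / circle r t ^+ n *
  (circle r t / (circle r t - z))).
have p0 := @pi_gt0 R.
have fE n z : cabs z <= r / 2 ->
    f z * ((2 * pi)%:C)%C = \sum_(k < n) z ^+ k * a k + z ^+ n * rem n z.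
  move=> zr2; rewrite cauchy_formula// (cauchy_kernel_expansion n)//.
  by move: r0; lra.
have remB n z : cabs z <= r / 2 -> cabs (rem n z) <= 4 * pi * (M / r ^+ n * 2).
  by move=> zr2; apply: cauchy_kernel_bound.
have cabsf z : cabs (f z * ((2 * pi)%:C)%C) = cabs (f z) * (2 * pi).
  by rewrite cabsM cabs_real ger0_norm// ltW// pi2_gt0.
have [a0|/existsNP] := pselect (forall k, a k = 0).
  left; exists (r / 2); first by rewrite divr_gt0.
  move=> z /ltW zr2.
  apply/eqP; rewrite -cabs_eq0; apply/eqP/le_anti; rewrite cabs_ge0 andbT.
  rewrite -(@pmulr_lle0 _ (2 * pi)) ?pi2_gt0// -cabsf.
  apply: (@le0_geometric _ (4 * pi * (M * 2))).
    by rewrite !mulr_ge0// ltW.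
  move=> n; rewrite (fE n)// big1 => [|k _]; last by rewrite a0 mulr0.
  rewrite add0r cabsM cabsX.
  apply: (@le_trans _ _ ((r / 2) ^+ n * (4 * pi * (M / r ^+ n * 2)))).
    apply: ler_pM; rewrite ?exprn_ge0 ?cabs_ge0//; last exact: remB.
    by rewrite lerXn2r// nnegrE ?cabs_ge0//; move: r0; lra.
  rewrite expr_div_n le_eqVlt; apply/orP; left; apply/eqP.
  by field; rewrite ?pnatr_eq0//= !expf_neq0//= gt_eqF.
move=> ex; right.
have {}ex : exists k, a k != 0 by case: ex => k /eqP ak; exists k.
case: (ex_minnP ex) => m am mmin.
(* [B] bounds the remainder of order [m + 1]; the radius [cabs (a m) / (2 * B)] below keeps the tail
   at most half of the leading coefficient. *)
pose B := 4 * pi * (M / r ^+ m.+1 * 2).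
have B0 : 0 < B by rewrite /B !mulr_gt0// invr_gt0 exprn_gt0.
have A0 : 0 < cabs (a m) by rewrite cabs_gt0.
exists m, (cabs (a m) / 2 / (2 * pi)), (cabs (a m) * 2 / (2 * pi)),
  (Num.min (r / 2) (cabs (a m) / (2 * B))).
split.
- by rewrite divr_gt0 ?pi2_gt0// divr_gt0.
- by rewrite divr_gt0 ?pi2_gt0// mulr_gt0.
- by rewrite lt_min !divr_gt0// mulr_gt0.
move=> z; rewrite lt_min => /andP[/ltW zr2]; rewrite ltr_pdivlMr; last exact: mulr_gt0.
move=> zB.
have fz : f z * ((2 * pi)%:C)%C = z ^+ m * (a m + z * rem m.+1 z).
  rewrite (fE m.+1)// big_ord_recr/= big1 => [|k _]; last first.
    apply/eqP; rewrite mulf_eq0; apply/orP; right; apply/contraT => ak.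
    by have := mmin _ ak; rewrite leqNgt ltn_ord.
  by rewrite add0r exprSr; ring.
have rb : cabs (z * rem m.+1 z) <= cabs (a m) / 2.
  rewrite cabsM (@le_trans _ _ (cabs z * B))//; last by lra.
  by rewrite ler_wpM2l ?cabs_ge0// remB.
have := cabsf z; rewrite fz cabsM cabsX => E.
have h1 := cabsD (a m) (z * rem m.+1 z).
have h2 := cabsDB (a m) (z * rem m.+1 z).
have zm : 0 <= cabs z ^+ m by rewrite exprn_ge0// cabs_ge0.
split.
  rewrite mulrAC ler_pdivrMr ?pi2_gt0// -E mulrC ler_wpM2l//; lra.
rewrite mulrAC ler_pdivlMr ?pi2_gt0// -E [leRHS]mulrC ler_wpM2l//; lra.
Qed.

Lemma cdiff_quadratic (g : C R -> C R) z d (K del : R) : 0 < del -> 0 <= K ->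
  (forall h, cabs h < del ->
    cabs (g (z + h) - g z - d * h) <= K * cabs h ^+ 2) -> cdiff g z d.
Proof.
move=> del0 K0 hg e e0.
exists (Num.min del (e / (K + 1))); first by rewrite lt_min del0 divr_gt0//; lra.
move=> h; rewrite lt_min ltr_pdivlMr; last by lra.
move=> /andP[/hg hh he]; apply: (le_trans hh).
rewrite expr2 mulrA ler_wpM2r ?cabs_ge0//.
have := cabs_ge0 h; lra.
Qed.

(** Cauchy integrals: on the half disc [G 1] is 2 pi times [f], and the derivative of [G n] is n
    times [G n.+1]. *)
Let G n z := cI (fun t => u t * (circle r t / (circle r t - z) ^+ n)).

(** Two differentiations under the integral sign, of [G 1] and of [G 2]. In [rem_bound] the
    second-order remainder of the kernel w^-n becomes a quadratic bound in h; [P] is what remains in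
    its numerator, 1 for n = 1 and 3 w - 2 h for n = 2. *)
Lemma derivative_holomorphic : exists f1 : C R -> C R,
  forall z, cabs z < r / 2 -> cdiff f z (f1 z) /\ exists d, cdiff f1 z d.
Proof.
have [M M0 uM] := fcircle_bounded; have cu := ccont_fcircle.
have p0 := @pi_gt0 R.
have wge z t : cabs z < r / 2 -> r / 2 <= cabs (circle r t - z).
  by move=> zr2; have := @circle_sub_ge r z t; move: r0 => ?; lra.
have rem_bound z h n m a (P : C R -> C R) (B : R) :
    cabs z < r / 2 -> cabs (z + h) < r / 2 -> 0 <= B ->
    (forall t, cabs (P (circle r t - z)) <= B) ->
    (forall w, w != 0 -> w - h != 0 -> (w - h) ^- n - w ^- n - a * h * w ^- m =
      h ^+ 2 * P w / (w ^+ m * (w - h) ^+ n)) ->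
    cabs (G n (z + h) - G n z - a * G m z * h) <=
    4 * pi * (M * r * B * (2 / r) ^+ (m + n)) * cabs h ^+ 2.
  move=> zr2 zh B0 PB id.
  have zr : cabs z < r by move: r0; lra.
  have zhr : cabs (z + h) < r by move: r0; lra.
  rewrite mulrAC /G -cIM; last exact: ccont_pole.
  rewrite -cIB; [|exact: ccont_pole|exact: ccont_pole].
  rewrite -cIB; last 2 first.
  - rewrite (_ : (fun t => _ ) = (fun t =>
      (u t * (circle r t / (circle r t - (z + h)) ^+ n)) +
      (-1) * (u t * (circle r t / (circle r t - z) ^+ n)))); last first.
      by apply/funext => t; rewrite mulN1r.
    apply: ccontD; first exact: ccont_pole.
    by apply: ccontM; [exact: ccont_cst|exact: ccont_pole].
  - by apply: ccontM; [exact: ccont_cst|exact: ccont_pole].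
  rewrite -mulrA; apply: cI_bound.
    set U := (X in ccont X).
    rewrite (_ : U = (fun t => (u t * (circle r t / (circle r t - (z + h)) ^+ n) +
      (-1) * (u t * (circle r t / (circle r t - z) ^+ n))) +
      (- (a * h)) * (u t * (circle r t / (circle r t - z) ^+ m)))); last first.
      by apply/funext => t; rewrite /U mulN1r mulNr.
    apply: ccontD; first apply: ccontD; first exact: ccont_pole.
      by apply: ccontM; [exact: ccont_cst|exact: ccont_pole].
    by apply: ccontM; [exact: ccont_cst|exact: ccont_pole].
  move=> t _.
  have w1 := circle_sub_neq0 t zr; have w2 := circle_sub_neq0 t zhr.
  have wh : circle r t - (z + h) = circle r t - z - h by ring.
  rewrite (_ : _ - _ = u t * circle r t * (h ^+ 2 * P (circle r t - z) /
     ((circle r t - z) ^+ m * (circle r t - (z + h)) ^+ n))); last first.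
    by rewrite wh -id -?wh//; ring.
  have k1 := wge z t zr2; have k2 := wge _ t zh.
  have hr : 0 < r / 2 by rewrite divr_gt0.
  have := cabs_circ t; have := uM t; have := PB t.
  move: (u t) (circle r t) w1 w2 k1 k2 wh => v c w1 w2 k1 k2 wh Pc vM cr.
  rewrite !cabsM cabsV cabsM !cabsX cr.
  rewrite [leRHS](_ : _ = M * r * (cabs h ^+ 2 * B * (2 / r) ^+ (m + n)));
    last by ring.
  apply: ler_pM; rewrite ?mulr_ge0 ?invr_ge0 ?mulr_ge0 ?exprn_ge0 ?cabs_ge0//
     ?(ltW r0)//.
    by rewrite ler_pM2r.
  apply: ler_pM; rewrite ?mulr_ge0 ?invr_ge0 ?mulr_ge0 ?exprn_ge0 ?cabs_ge0//.
    by rewrite -expr2 ler_wpM2l ?exprn_ge0 ?cabs_ge0.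
  have c1 : 0 < cabs (c - z) by lra.
  have c2 : 0 < cabs (c - (z + h)) by lra.
  rewrite -[2 / r]invf_div exprVn lef_pV2 ?posrE ?mulr_gt0 ?exprn_gt0//.
  rewrite exprD; apply: ler_pM; rewrite ?exprn_ge0 ?(ltW hr)//.
    by rewrite lerXn2r// nnegrE ?cabs_ge0// ltW.
  by rewrite lerXn2r// nnegrE ?cabs_ge0// ltW.
have nneg B k : 0 <= B -> 0 <= 4 * pi * (M * r * B * (2 / r) ^+ k).
  move=> B0; apply: mulr_ge0; first by apply: mulr_ge0 => //; exact: ltW.
  apply: mulr_ge0; last by rewrite exprn_ge0// divr_ge0// ltW.
  by apply: mulr_ge0 => //; apply: mulr_ge0; exact: ltW.
have G1 z : cabs z < r / 2 -> cdiff (G 1) z (G 2 z).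
  move=> zr2; pose del := r / 2 - cabs z.
  apply: (@cdiff_quadratic _ _ _ (4 * pi * (M * r * 1 * (2 / r) ^+ (2 + 1))) del).
  - by rewrite subr_gt0.
  - exact: nneg.
  move=> h hdel; rewrite -[G 2 z]mul1r.
  apply: (@rem_bound z h 1%N 2%N 1 (fun=> 1) 1) => //.
  - by apply: (le_lt_trans (cabsD _ _)); rewrite /del in hdel; lra.
  - by move=> t; rewrite cabs1.
  - by move=> w w0 w1; field; rewrite w0 w1.
have G2 z : cabs z < r / 2 -> cdiff (G 2) z (2 * G 3 z).
  (* The second bound, [cabs h < r], keeps [3 * w - 2 * h] below [8 * r]. *)
  move=> zr2; pose del := Num.min (r / 2 - cabs z) r.
  apply: (@cdiff_quadratic _ _ _ (4 * pi * (M * r * (8 * r) * (2 / r) ^+ (3 + 2))) del).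
  - by rewrite lt_min r0 subr_gt0 zr2.
  - by apply: nneg; apply: mulr_ge0 => //; exact: ltW.
  move=> h; rewrite lt_min => /andP[h1 h2].
  apply: (@rem_bound z h 2%N 3%N 2 (fun w => 3 * w - 2 * h) (8 * r)) => //.
  - by apply: (le_lt_trans (cabsD _ _)); lra.
  - by rewrite mulr_ge0// ltW.
  - move=> t; apply: (le_trans (cabsB _ _)); rewrite !cabsM.
    have -> : cabs (3 : C R) = 3.
      by rewrite (_ : 3 = ((3 : R)%:C)%C) ?cabs_real ?ger0_norm// rmorph_nat.
    have -> : cabs (2 : C R) = 2.
      by rewrite (_ : 2 = ((2 : R)%:C)%C) ?cabs_real ?ger0_norm// rmorph_nat.
    have := cabsB (circle r t) z; rewrite cabs_circ; move: r0; lra.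
  - by move=> w w0 w1; field; rewrite w0 w1.
have cdiffM (g : C R -> C R) z (d c : C R) : cdiff g z d ->
    cdiff (fun z => g z * c) z (d * c).
  move=> gd e e0.
  have c1 : 0 < cabs c + 1 by have := cabs_ge0 c; lra.
  have [del del0 hdel] := gd (e / (cabs c + 1)) (divr_gt0 e0 c1).
  exists del => // h /hdel hh.
  rewrite (_ : _ - _ = (g (z + h) - g z - d * h) * c); last by ring.
  rewrite cabsM (@le_trans _ _ (e / (cabs c + 1) * cabs h * cabs c))//.
    by rewrite ler_wpM2r// cabs_ge0.
  rewrite mulrAC ler_wpM2r ?cabs_ge0// mulrAC ler_pdivrMr// ler_pM2l//.
  by lra.
exists (fun z => G 2 z / ((2 * pi)%:C)%C) => z zr2; split; last first.
  by exists (2 * G 3 z / ((2 * pi)%:C)%C); exact: (cdiffM _ _ _ _ (G2 z zr2)).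
have := @cdiffM _ _ _ (((2 * pi)%:C)%C)^-1 (G1 z zr2) => h e e0.
have [del del0 hdel] := h e e0.
exists (Num.min del (r / 2 - cabs z)); first by rewrite lt_min del0 subr_gt0.
move=> k; rewrite lt_min => /andP[/hdel + k2].
have fG w : cabs w < r / 2 -> f w = G 1 w / ((2 * pi)%:C)%C.
  by move=> /ltW /cauchy_formula E; apply: (canRL (mulfK pi2C)).
have zk : cabs (z + k) < r / 2 by apply: (le_lt_trans (cabsD _ _)); lra.
by rewrite (fG _ zr2) (fG _ zk).
Qed.

End CauchyConsequences.

(** * Complex differentiability on row vectors with one entry *)

Section Line.
Context {R : realType}.
Local Notation V := 'rV[C R]_1.
Implicit Types (x y v : V) (z : C R).

Definition emb z : V := const_mx z.
Definition crd x : C R := x 0 0.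

Lemma embK z : crd (emb z) = z.
Proof. by rewrite /crd mxE. Qed.

Lemma crdK x : emb (crd x) = x.
Proof. by apply/matrixP => i j; rewrite !ord1 mxE. Qed.

Lemma crdB x y : crd (x - y) = crd x - crd y.
Proof. by rewrite /crd !mxE. Qed.

Lemma crdD x y : crd (x + y) = crd x + crd y.
Proof. by rewrite /crd !mxE. Qed.

Lemma crdZ z x : crd (z *: x) = z * crd x.
Proof. by rewrite /crd !mxE. Qed.

Lemma crd0 : crd 0 = 0.
Proof. by rewrite /crd mxE. Qed.

Lemma ballE x (e : R) y : ball x ((e%:C)%C : C R) y <-> cabs (crd y - crd x) < e.
Proof.
rewrite -cabsN opprB.
split.
  by move=> [_ /(_ ord0 ord0)]; rewrite /ball/= normE ltcR.
move=> h; split; first by rewrite ltcR; exact: le_lt_trans (cabs_ge0 _) h.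
by move=> i j; rewrite !ord1 /ball/= normE ltcR.
Qed.

(** Radii over the base field [C R] are positive elements of it, hence real; from here on
    neighbourhoods are handled with radii in [R]. *)
Lemma nbhsV x (A : set V) : nbhs x A <->
  exists2 e : R, 0 < e & forall y, cabs (crd y - crd x) < e -> A y.
Proof.
split=> [/nbhs_ballP[e /= e0 h]|[e e0 h]].
  have ee : ((Re e)%:C)%C = e by rewrite RRe_real// gtr0_real.
  exists (Re e); first by rewrite -ltcR ee.
  by move=> y /ballE; rewrite ee => /h.
by apply/nbhs_ballP; exists ((e%:C)%C) => /=; [rewrite ltcR|move=> y /ballE /h].
Qed.

Lemma nbhsC z (A : set (C R)) : nbhs z A <->
  exists2 e : R, 0 < e & forall w, cabs (w - z) < e -> A w.
Proof.
split=> [/nbhs_ballP[e /= e0 h]|[e e0 h]].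
  have ee : ((Re e)%:C)%C = e by rewrite RRe_real// gtr0_real.
  exists (Re e); first by rewrite -ltcR ee.
  by move=> w wz; apply: h; rewrite /ball/= -ee normE ltcR -cabsN opprB.
apply/nbhs_ballP; exists ((e%:C)%C) => /=; first by rewrite ltcR.
by move=> w; rewrite /ball/= normE ltcR -cabsN opprB => /h.
Qed.

Lemma crd_continuous : continuous crd.
Proof.
move=> x A /nbhsC[e e0 h]; apply/nbhsV; exists e => //= y /h.
by [].
Qed.

Lemma cdiff_derivable (f : C R -> C R) z d : cdiff f z d <-> is_derive z 1 f d.
Proof.
split.
  move=> fd.
  suff h : h^-1 *: (f (h *: 1 + z) - f z) @[h --> (0 : C R)^'] --> d.
    by apply: DeriveDef; [apply/cvg_ex; exists d|exact: cvg_lim].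
  apply/cvgrPdist_le => e e0.
  have ee : ((Re e)%:C)%C = e by rewrite RRe_real// gtr0_real.
  have e0' : 0 < Re e by rewrite -ltcR ee.
  have [del del0 hdel] := fd _ e0'.
  apply/nbhsC; exists del => // h; rewrite subr0 => hd h0.
  rewrite -ee normE lecR -cabsN opprB.
  have h0' : 0 < cabs h by rewrite cabs_gt0.
  rewrite -(ler_pM2r h0') -cabsM mulrBl (mulrC (h^-1 *: _)) /GRing.scale/= mulrA.
  rewrite mulfV// mul1r mulr1 (addrC h).
  exact: hdel.
move=> [/cvg_ex[d' hd']]; rewrite /derive => dE e e0.
have {dE} dE : d' = d by rewrite -dE; apply/esym/cvg_lim.
move: hd'; rewrite dE => /cvgrPdist_le /(_ (e%:C)%C).
rewrite ltcR => /(_ e0) /nbhsC[del del0 hdel].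
exists del => // h hd.
have [->|h0] := eqVneq h 0.
  by rewrite addr0 mulr0 subr0 subrr cabs0 mulr0.
have := hdel h; rewrite subr0 => /(_ hd h0).
rewrite normE lecR -cabsN opprB.
have h0' : 0 < cabs h by rewrite cabs_gt0.
rewrite -(ler_pM2r h0') -cabsM mulrBl (mulrC (h^-1 *: _)) /GRing.scale/= mulrA.
by rewrite mulfV// mul1r mulr1 (addrC h).
Qed.

Lemma emb_differentiable z : differentiable emb z.
Proof.
have -> : emb = (fun w : C R => w *: (const_mx 1 : V)).
  by apply/funext => w; apply/matrixP => i j; rewrite !mxE mulr1.
exact: differentiableZl.
Qed.

Lemma crd_differentiable x : differentiable crd x.
Proof. exact: differentiable_coord. Qed.

Lemma differentiable_cdiff (f : V -> C R) x : differentiable f x ->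
  exists d, cdiff (f \o emb) (crd x) d.
Proof.
move=> fx; exists ('D_1 (f \o emb) (crd x)); apply/cdiff_derivable.
apply/derivableP/derivable1_diffP; apply: differentiable_comp.
  exact: emb_differentiable.
by rewrite crdK.
Qed.

Lemma cdiff_differentiable (f : V -> C R) x d : cdiff (f \o emb) (crd x) d ->
  differentiable f x.
Proof.
move=> /cdiff_derivable[fd _].
have -> : f = (f \o emb) \o crd by apply/funext => y; rewrite /= crdK.
apply: differentiable_comp; first exact: crd_differentiable.
exact/derivable1_diffP.
Qed.

End Line.

(** * Integrability and plurisubharmonicity of the potential *)

Section Integration.
Context {R : realType}.
Local Notation mu := (@lebesgue_measure R).
Local Open Scope ereal_scope.

(** Positive and negative parts are integrated as suprema over simple functions below them, and such
    suprema are monotone for arbitrary functions. Integrands cut off along images of charts can thus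
    be compared directly. *)
Lemma le_integral_pointwise d (T : measurableType d) (m : {measure set T -> \bar R})
  (D : set T) (f g : T -> \bar R) : (forall x, D x -> f x <= g x) ->
  \int[m]_(x in D) f x <= \int[m]_(x in D) g x.
Proof.
move=> fg; rewrite /integral.
have fgD x : (f \_ D) x <= (g \_ D) x.
  by rewrite !patchE; case: ifPn => // /set_mem /fg.
have fgD' : {in setT, forall x, (f \_ D) x <= (g \_ D) x} by move=> x _.
apply: leeB; apply: ereal_sup_le => _ [h hh <-]; exists h => //= x;
  apply: (le_trans (hh x)).
  by apply: (funepos_le fgD'); rewrite inE.
by apply: (funeneg_le fgD'); rewrite inE.
Qed.

Lemma cint1E (g : 'rV[C R]_1 -> \bar R) :
  cint g = \int[mu]_x \int[mu]_y g (emb (x +i* y)%C).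
Proof.
rewrite /=; apply: eq_integral => x _; apply: eq_integral => y _; congr g.
apply/matrixP => i j; rewrite !mxE; case: splitP => k //= _.
  by rewrite !mxE !ord1 mulr1n.
by case: k.
Qed.

Lemma integral_indicZ (A : set R) (k : R) : measurable A -> (0 <= k)%R ->
  \int[mu]_x (k * \1_A x)%:E = k%:E * mu A.
Proof.
move=> mA k0; under eq_integral do rewrite EFinM.
rewrite ge0_integralZl_EFin//; last first.
  by apply/measurable_EFinP; exact: measurable_indic.
by rewrite integral_indic// setIT.
Qed.

Lemma cint_rectangle (B : set 'rV[C R]_1) (g : 'rV[C R]_1 -> \bar R)
    (M a b c d : R) : (a <= b)%R -> (c <= d)%R -> (0 <= M)%R ->
  (forall z, 0 <= g z) ->
  (forall x y, (a <= x <= b)%R -> (c <= y <= d)%R ->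
    B (emb (x +i* y)%C) /\ M%:E <= g (emb (x +i* y)%C)) ->
  (M * ((b - a) * (d - c)))%:E <= cint_on B g.
Proof.
move=> ab cd M0 g0 h; rewrite /cint_on cint1E.
have mab : mu `[a, b] = (b - a)%:E.
  by rewrite lebesgue_measure_itv/= lte_fin; case: ltP => // ba;
     rewrite (le_anti (introT andP (conj ab ba))) subrr.
have mcd : mu `[c, d] = (d - c)%:E.
  by rewrite lebesgue_measure_itv/= lte_fin; case: ltP => // ba;
     rewrite (le_anti (introT andP (conj cd ba))) subrr.
have dc0 : (0 <= d - c)%R by rewrite subr_ge0.
apply: (@le_trans _ _ (\int[mu]_x \int[mu]_y
    ((M * \1_(`[a, b]%classic) x) * \1_(`[c, d]%classic) y)%:E)).
  under eq_integral => x _.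
    rewrite integral_indicZ//; last by rewrite mulr_ge0// indicE.
    rewrite mcd -EFinM mulrAC; over.
  rewrite integral_indicZ ?mulr_ge0// mab -EFinM lee_fin.
  by rewrite le_eqVlt; apply/orP; left; apply/eqP; ring.
apply: le_integral_pointwise => x _; apply: le_integral_pointwise => y _.
have p0 : 0 <= patch (fun=> 0) B g (emb (x +i* y)%C) by rewrite patchE; case: ifP.
rewrite !indicE.
have [xab|_] := boolP (x \in `[a, b]%classic); last by rewrite mulr0 mul0r.
have [ycd|_] := boolP (y \in `[c, d]%classic); last by rewrite mulr0.
have [Bxy Mg] := h x y ltac:(by move: xab; rewrite inE/= in_itv)
  ltac:(by move: ycd; rewrite inE/= in_itv).
by rewrite !mulr1 patchE mem_set.
Qed.

(** Separating the variables moves all measurability to the two one-variable factors; [h] enters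
    only through the pointwise bound. *)
Lemma cint_le_prod (h : 'rV[C R]_1 -> \bar R) (f g : measurableTypeR R -> \bar R) :
  (forall x, 0 <= f x) -> (forall y, 0 <= g y) ->
  measurable_fun setT f -> measurable_fun setT g ->
  (forall x y, h (emb (x +i* y)%C) <= f x * g y) ->
  cint h <= (\int[mu]_x f x) * \int[mu]_y g y.
Proof.
move=> f0 g0 mf mg hfg; rewrite cint1E.
have I0 : 0 <= \int[mu]_y g y by apply: integral_ge0.
apply: (@le_trans _ _ (\int[mu]_x \int[mu]_y (f x * g y))).
  by apply: le_integral_pointwise => x _; apply: le_integral_pointwise.
under eq_integral do rewrite ge0_integralZl//.
under eq_integral do rewrite muleC.
by rewrite ge0_integralZl// muleC.
Qed.

Section PowerSingularity.
Variable a : R.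
Hypotheses (a0 : (0 <= a)%R) (a1 : (a < 1)%R).

(* Dyadic majorant of [|x|^(- a)] on [-1, 1], infinite at 0. *)
Definition dyadic_majorant (x : measurableTypeR R) : \bar R :=
  \sum_(0 <= n <oo) ((2 : R) `^ (a * n.+1%:R) * \1_(`[- (2 ^- n), 2 ^- n]%classic) x)%:E.

Let term_ge0 n (x : measurableTypeR R) :
  0 <= ((2 : R) `^ (a * n.+1%:R) * \1_(`[- (2 ^- n), 2 ^- n]%classic) x)%:E.
Proof. by rewrite lee_fin mulr_ge0// ?powR_ge0// indicE. Qed.

Lemma dyadic_majorant_ge0 (x : R) : 0 <= dyadic_majorant x.
Proof. by apply: nneseries_ge0 => n _ _; exact: term_ge0. Qed.

Let mterm n : measurable_fun setT
  (fun x : measurableTypeR R => ((2 : R) `^ (a * n.+1%:R) * \1_(`[- (2 ^- n), 2 ^- n]%classic) x)%:E).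
Proof.
by apply/measurable_EFinP; apply: measurable_funM.
Qed.

Lemma measurable_dyadic_majorant : measurable_fun setT dyadic_majorant.
Proof.
by apply: ge0_emeasurable_sum => // n x _ _; exact: term_ge0.
Qed.

(** If 2^-(n+1) < |x| <= 2^-n, the n-th term alone is at least |x|^-a. *)
Lemma dyadic_majorant_bound (x : R) : (`|x| <= 1)%R -> x != 0%R ->
  (expR (- (a * ln `|x|)))%:E <= dyadic_majorant x.
Proof.
move=> x1 x0; have x0' : (0 < `|x|)%R by rewrite normr_gt0.
pose P n := (`|x| <= 2 ^- n)%R.
have [n [Pn nPn]] : exists n, P n /\ ~~ P n.+1.
  apply: contrapT => h.
  have Pall n : P n.
    elim: n => [|n IH]; first by rewrite /P expr0 invr1.
    by apply: contrapT => /negP nP; apply: h; exists n.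
  have : (`|x| <= 0)%R.
    by apply: (@le0_geometric _ _ 1) => // n; rewrite div1r; exact: Pall.
  by rewrite leNgt x0'.
apply: (@le_trans _ _ ((2 : R) `^ (a * n.+1%:R) * \1_(`[- (2 ^- n), 2 ^- n]%classic) x)%:E).
  rewrite indicE mem_set ?mulr1/=; last by rewrite in_itv/= -ler_norml.
  rewrite lee_fin /powR ifF ?gt_eqF// ler_expR.
  rewrite -mulrN -mulrA ler_wpM2l//.
  rewrite lerNl -mulrN -lnV ?posrE// mulrC mulr_natr.
  rewrite -lnXn ?invr_gt0// exprVn ler_ln ?posrE ?invr_gt0 ?exprn_gt0//.
  by move: nPn; rewrite /P -ltNge => /ltW.
rewrite /dyadic_majorant.
apply: (le_trans _ (nneseries_lim_ge n.+1 _)); last first.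
  by move=> k _ _; exact: term_ge0.
rewrite big_nat_recr//=; apply: leeDr.
by apply: sume_ge0 => k _; exact: term_ge0.
Qed.

(** The n-th term integrates to a constant times [q ^+ n] with [q] equal to 2 to the power [a - 1]:
    a convergent geometric series because [a < 1]. *)
Lemma integral_dyadic_majorant : \int[mu]_x dyadic_majorant x < +oo.
Proof.
rewrite /dyadic_majorant integral_nneseries//.
pose q : R := ((2 : R) `^ (a - 1))%R.
have q0 : (0 < q)%R by rewrite powR_gt0.
have q1 : (q < 1)%R.
  rewrite /q /powR ifF ?gt_eqF// -[ltRHS]expR0 ltr_expR.
  by rewrite pmulr_llt0 ?subr_lt0 ?ln_gt0 ?ltr1n.
have tE n : \int[mu]_x ((2 : R) `^ (a * n.+1%:R) * \1_(`[- (2 ^- n), 2 ^- n]%classic) x)%:E =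
    (2 * (2 : R) `^ a * q ^+ n)%:E.
  rewrite integral_indicZ ?powR_ge0// lebesgue_measure_itv/= lte_fin.
  have p2 : (0 < 2 ^- n :> R)%R by rewrite invr_gt0 exprn_gt0.
  rewrite ifT; last by rewrite (lt_trans _ p2)// oppr_lt0.
  rewrite -EFinD -EFinM; congr EFin.
  rewrite opprK -mulr2n -[(2 ^- n *+ 2)%R]mulr_natl.
  rewrite /q -powR_mulrn ?powR_ge0// -powRrM mulrBl mul1r powRD; last first.
    by rewrite pnatr_eq0 implybT.
  rewrite powRN powR_mulrn// -[n.+1%:R%R]natr1 mulrDr mulr1 powRD ?pnatr_eq0 ?implybT//.
  ring.
rewrite (eq_eseriesr (fun n _ => tE n)).
apply: (@le_lt_trans _ _ (2 * (2 : R) `^ a / (1 - q))%:E); last exact: ltry.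
have k0 : (0 <= 2 * (2 : R) `^ a)%R by rewrite mulr_ge0// powR_ge0.
apply: lime_le.
  apply: is_cvg_nneseries => n _ _; rewrite lee_fin mulr_ge0// exprn_ge0//.
  exact: ltW.
apply: nearW => n; rewrite sumEFin lee_fin.
have /(congr1 (@^~ n)) := @geometric_seriesE R (2 * (2 : R) `^ a) q (negbT (lt_eqF q1)).
rewrite /series/= /geometric/= => ->.
rewrite ler_pM2r ?invr_gt0 ?subr_gt0// ler_piMr// gerBl exprn_ge0//.
exact: ltW.
Qed.

End PowerSingularity.
End Integration.

(** * Circle means of log |1 + k zeta|^2 *)

Section LogMean.
Context {R : realType}.
Local Notation mu := (@lebesgue_measure R).
Implicit Types (z w : C R) (x t : R).

Lemma cder_sum n (U d : nat -> R -> C R) x :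
  (forall k, cder (U k) x (d k x)) ->
  cder (fun t => \sum_(k < n) U k t) x (\sum_(k < n) d k x).
Proof.
move=> h; elim: n => [|n IH].
  rewrite big_ord0; under [X in cder X]eq_fun do rewrite big_ord0.
  exact: cder_cst.
under [X in cder X]eq_fun do rewrite big_ord_recr/=.
by rewrite big_ord_recr/=; exact: cderD.
Qed.

(** Taylor polynomial of log (1 + z) at 0. *)
Definition log_poly (n : nat) z : C R :=
  \sum_(k < n) ((- 1) ^+ k / k.+1%:R) * z ^+ k.+1.

Lemma geometric_sumN n z : 1 + z != 0 ->
  (1 + z)^-1 - \sum_(k < n) (- z) ^+ k = (- z) ^+ n / (1 + z).
Proof.
move=> z0; apply: (mulIf z0); rewrite mulrBl mulVf// divfK//.
rewrite -[RHS](subrK 1) subrX1; ring.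
Qed.

Lemma is_derive_ln_cabs_sqr z x : 1 + (x%:C)%C * z != 0 ->
  is_derive x 1 (fun t : R => ln (cabs (1 + (t%:C)%C * z) ^+ 2))
    (2 * Re (z / (1 + (x%:C)%C * z))).
Proof.
move=> w0.
pose a := Re z; pose b := Im z.
have E t : cabs (1 + (t%:C)%C * z) ^+ 2 = (1 + t * a) ^+ 2 + (t * b) ^+ 2.
  by rewrite cabs_sqr !(ReD, ImD, ReM, ImM)/= !mul0r subr0 add0r addr0.
under [X in is_derive _ _ X]eq_fun do rewrite E.
have p : 0 < (1 + x * a) ^+ 2 + (x * b) ^+ 2 by rewrite -E exprn_gt0// cabs_gt0.
have d1 : is_derive x 1 (fun t : R => (1 + t * a) ^+ 2 + (t * b) ^+ 2)
    (2 * (1 + x * a) * a + 2 * (x * b) * b).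
  apply: is_derive_eq.
  rewrite /GRing.scale/=; ring.
have := @is_derive1_comp _ (@ln R) (fun t => (1 + t * a) ^+ 2 + (t * b) ^+ 2) x
   _ _ (is_derive1_ln p) d1.
move=> /is_derive_eq; apply.
have -> : z / (1 + (x%:C)%C * z) =
    (((cabs (1 + (x%:C)%C * z) ^+ 2)^-1)%:C)%C * (z * (1 + (x%:C)%C * z)^*%C).
  rewrite invc_norm normE mulrC -mulrA [in RHS]mulrC -mulrA.
  rewrite -rmorphXn/= -fmorphV/=; ring.
rewrite ReM/= mul0r subr0 E ReM.
have -> : Re (1 + (x%:C)%C * z)^*%C = 1 + x * a.
  by rewrite /a; case: z {w0 a b E p d1} => zr zi /=; rewrite mul0r subr0.
have -> : Im (1 + (x%:C)%C * z)^*%C = - (x * b).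
  by rewrite /b; case: z {w0 a b E p d1} => zr zi /=; rewrite mul0r addr0 add0r.
by rewrite -/a -/b; field; rewrite gt_eqF.
Qed.

(** Along the segment from 0 to [z], the logarithm minus twice the real part of its Taylor
    polynomial has as derivative the tail of a geometric series, of size at most
    [2 * (k ^+ n.+1 / (1 - k))]; the mean value theorem concludes. *)
Lemma ln_cabs_sqr_ge n z (k : R) : cabs z <= k -> k < 1 ->
  2 * Re (log_poly n z) - 2 * (k ^+ n.+1 / (1 - k)) <= ln (cabs (1 + z) ^+ 2).
Proof.
move=> zk k1; have k0 : 0 <= k := le_trans (cabs_ge0 z) zk.
have low (x : R) : 0 <= x <= 1 -> 1 - k <= cabs (1 + (x%:C)%C * z).
  move=> /andP[x0 x1]; have := cabsDB 1 ((x%:C)%C * z).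
  rewrite cabs1 cabsM cabs_real ger0_norm//.
  have : x * cabs z <= 1 * k by apply: ler_pM => //; exact: cabs_ge0.
  lra.
have nz (x : R) : 0 <= x <= 1 -> 1 + (x%:C)%C * z != 0.
  by move=> /low h; rewrite -cabs_gt0; lra.
pose F (t : R) := ln (cabs (1 + (t%:C)%C * z) ^+ 2) -
  2 * Re (log_poly n ((t%:C)%C * z)).
pose dF (t : R) := 2 * Re (z * ((- ((t%:C)%C * z)) ^+ n / (1 + (t%:C)%C * z))).
have dlog (x : R) : cder (fun t => log_poly n ((t%:C)%C * z)) x
    (\sum_(i < n) z * (- ((x%:C)%C * z)) ^+ i).
  rewrite /log_poly; apply: (@cder_sum _
    (fun i t => (-1) ^+ i / i.+1%:R * ((t%:C)%C * z) ^+ i.+1)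
    (fun i t => z * (- ((t%:C)%C * z)) ^+ i)) => i.
  have dt : cder (fun t => (t%:C)%C) x 1.
    by split=> /=; [exact: is_derive_id|exact: is_derive_cst].
  have dX m : cder (fun t => ((t%:C)%C * z) ^+ m.+1) x
      (m.+1%:R * z * ((x%:C)%C * z) ^+ m).
    elim: m => [|m IH].
      rewrite expr0 mulr1 mul1r -[X in cder _ _ X]mul1r.
      by under [X in cder X]eq_fun do rewrite expr1; exact: cderMr.
    under [X in cder X]eq_fun do rewrite exprS.
    apply: cder_eq; first by apply: cderM IH; exact: cderMr dt.
    by rewrite mul1r -[m.+2%:R]natr1 exprS; ring.
  apply: cder_eq; first by apply: cderMl; exact: dX.
  rewrite [in RHS]exprNn.
  by field; rewrite addrC natr1 pnatr_eq0.
have dFP (x : R) : 0 <= x <= 1 -> is_derive x 1 F (dF x).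
  move=> x01; have d1 := is_derive_ln_cabs_sqr (nz x x01).
  have [d2 _] := dlog x.
  have -> : dF x = 2 * Re (z / (1 + (x%:C)%C * z)) -
      2 * Re (\sum_(i < n) z * (- ((x%:C)%C * z)) ^+ i).
    rewrite /dF -geometric_sumN ?nz// mulrBr -mulr_sumr ReD ReN.
    by rewrite mulrBr.
  exact: is_deriveB.
have [c c01 FE] : exists2 c, c \in `[0, 1]%R & F 1 - F 0 = dF c * (1 - 0).
  apply: MVT_segment => // [x|]; first by
    rewrite in_itv/= => /andP[x0 x1]; apply: dFP; rewrite !ltW.
  apply: derivable_within_continuous => x; rewrite in_itv/= => /dFP h.
  by case: h.
have F0 : F 0 = 0.
  rewrite /F mul0r addr0 cabs1 expr1n ln1 /log_poly big1; last first.
    by move=> i _; rewrite expr0n/= mulr0.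
  by rewrite mulr0 subr0.
have dFb : - (2 * (k ^+ n.+1 / (1 - k))) <= dF c.
  have c01' : 0 <= c <= 1 by move: c01; rewrite in_itv.
  rewrite lerNl -mulrN ler_pM2l//.
  apply: (le_trans (ler_norm _)); rewrite normrN.
  apply: (le_trans (Re_le_cabs _)); rewrite !cabsM cabsV cabsX cabsN cabsM cabs_real.
  rewrite exprS -mulrA; apply: ler_pM; rewrite ?cabs_ge0//.
    by rewrite mulr_ge0 ?exprn_ge0 ?invr_ge0 ?mulr_ge0 ?cabs_ge0.
  move/andP: (c01') => [c0 c1].
  apply: ler_pM; rewrite ?invr_ge0 ?exprn_ge0 ?mulr_ge0 ?cabs_ge0//.
    rewrite lerXn2r ?nnegrE ?mulr_ge0 ?cabs_ge0// ger0_norm//.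
    by rewrite -[k]mul1r ler_pM// cabs_ge0.
  by rewrite lef_pV2 ?posrE ?cabs_gt0 ?nz ?subr_gt0// low.
move: FE; rewrite F0 !subr0 mulr1 /F mul1r => FE.
by move: dFb; rewrite -FE; lra.
Qed.

(** All terms of [log_poly] have positive degree, hence periodic primitives and integral 0 over the
    circle; only [e] remains. *)
Lemma log_poly_circle_mean n (k : C R) (s e : R) :
  (\int[mu]_(t in `[0%R, (2 * pi)%R]) (s * Re (log_poly n (k * polar t)) - e)%:E =
   (- (e * (2 * pi)))%:E)%E.
Proof.
pose f (t : R) := s * Re (log_poly n (k * polar t)) - e.
pose g (t : R) := log_poly n (k * polar t).
pose G (t : R) := \sum_(i < n) ((- 1) ^+ i / i.+1%:R * k ^+ i.+1 / (i.+1%:R * 'i%C)) *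
   polar (i.+1%:R * t) : C R.
have natC m : (m%:R%:C)%C = m%:R :> C R by rewrite rmorph_nat.
have dG x : cder G x (g x).
  rewrite /G /g /log_poly; apply: (@cder_sum _
    (fun i t => ((- 1) ^+ i / i.+1%:R * k ^+ i.+1 / (i.+1%:R * 'i%C)) *
       polar (i.+1%:R * t))
    (fun i t => (-1) ^+ i / i.+1%:R * (k * polar t) ^+ i.+1)) => i.
  apply: cder_eq; first by apply: cderMl; exact: cder_polar.
  rewrite natC exprMn polarX mulrA divfK ?mulrA//.
  by rewrite mulf_neq0// ?pnatr_eq0// -cabs_gt0 cabsi.
have dg x : cder g x (\sum_(i < n) (-1) ^+ i / i.+1%:R * k ^+ i.+1 *
    ((i.+1%:R%:C)%C * 'i%C * polar (i.+1%:R * x))).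
  rewrite /g /log_poly; apply: (@cder_sum _
    (fun i t => (-1) ^+ i / i.+1%:R * (k * polar t) ^+ i.+1)
    (fun i t => (-1) ^+ i / i.+1%:R * k ^+ i.+1 *
     ((i.+1%:R%:C)%C * 'i%C * polar (i.+1%:R * t)))) => i.
  under [X in cder X]eq_fun do rewrite exprMn polarX mulrA.
  by apply: cderMl; exact: cder_polar.
have cf : continuous f.
  have [cg _] := ccont_cder dg; move=> x; rewrite /f.
  apply: cvgB; last exact: cvg_cst.
  by apply: cvgM; [exact: cvg_cst|exact: cg].
pose F (t : R) := s * Re (G t) - e * t.
have dF x : is_derive x 1 F (f x).
  have [d1 _] := dG x; rewrite /F /f; apply: is_derive_eq.
  by rewrite /GRing.scale/= mulr1.
rewrite (@continuous_FTC2 _ _ F); first last.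
- by move=> x _; rewrite derive1E; case: (dF x).
- split.
  + by move=> x _; case: (dF x).
  + apply: cvg_at_right_filter; apply: differentiable_continuous.
    by apply/derivable1_diffP; case: (dF 0).
  + apply: cvg_at_left_filter; apply: differentiable_continuous.
    by apply/derivable1_diffP; case: (dF (2 * pi)).
- exact: continuous_subspaceT.
- exact: pi2_gt0.
rewrite -EFinB; congr EFin; rewrite /F.
have -> : G (2 * pi) = G 0.
  apply: eq_bigr => i _; congr (_ * _).
  by rewrite mulr0 -polarX polar2pi expr1n polar0.
by rewrite mulr0; ring.
Qed.

(** Replacing the logarithm by its Taylor polynomial costs an error that tends to 0 with the degree,
    and the polynomial has mean 0. In other words, log |1 + k zeta|^2 has nonnegative mean on the
    unit circle. *)
Lemma log_circle_mean (k : C R) (K s : R) : cabs k < 1 -> 0 < s ->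
  (\int[mu]_(t in `[0%R, (2 * pi)%R])
     (K - s * ln (cabs (1 + k * polar t) ^+ 2))%:E <= (K * (2 * pi))%:E)%E.
Proof.
move=> k1 s0.
set I := (X in (X <= _)%E).
have h n : (I <= (- (- (K + s * (2 * (cabs k ^+ n.+1 / (1 - cabs k)))) *
    (2 * pi)))%:E)%E.
  rewrite -(log_poly_circle_mean n k (- (s * 2))).
  apply: le_integral_pointwise => t _; rewrite lee_fin.
  have kt : cabs (k * polar t) <= cabs k by rewrite cabsM cabs_polar mulr1.
  have := ln_cabs_sqr_ge n kt k1.
  move: (Re _) (ln _) (_ / _) => r l g h.
  have := ler_wpM2l (ltW s0) h; rewrite mulrBr; lra.
apply/lee_addgt0Pr => e e0.
have q0 : 0 < 1 - cabs k by rewrite subr_gt0.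
have p0 := @pi2_gt0 R.
have c0 : 0 < s * (2 * (2 * pi)) by rewrite !mulr_gt0 ?pi_gt0.
have [n hn] : exists n, cabs k ^+ n.+1 < e * (1 - cabs k) / (s * (2 * (2 * pi))).
  have pos : 0 < e * (1 - cabs k) / (s * (2 * (2 * pi))).
    by rewrite divr_gt0//; apply: mulr_gt0.
  have kn : `|cabs k| < 1 by rewrite ger0_norm ?cabs_ge0.
  have /cvgrPdist_lt /(_ _ pos)[n _ /(_ n.+1 (leqnSn n))] := cvg_expr kn.
  by rewrite sub0r normrN ger0_norm ?exprn_ge0 ?cabs_ge0//; exists n.
apply: (le_trans (h n)); rewrite -EFinD lee_fin.
move/ltW: hn; rewrite ler_pdivlMr// => hn.
rewrite [leLHS](_ : _ = K * (2 * pi) +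
  cabs k ^+ n.+1 * (s * (2 * (2 * pi))) / (1 - cabs k)); last by ring.
by rewrite lerD2l ler_pdivrMr.
Qed.

End LogMean.

(** * The radial potential and its sub-mean inequality *)

Section Potential.
Context {R : realType}.
Local Notation mu := (@lebesgue_measure R).
Implicit Types (z w : C R) (s t : R).

(* The convex function [s - log (- s)], prolonged linearly beyond [s = - 1]. *)
Definition profile s : R := if s <= -1 then s - ln (- s) else 2 * s + 1.

Lemma ln_le_sub1 s : 0 < s -> ln s <= s - 1.
Proof.
move=> s0; rewrite -{1}(subrK 1 s) addrC; apply: le_ln1Dx; lra.
Qed.

(* [profile] is the upper envelope of these increasing affine functions, so the
   sub-mean value property of [psi] reduces to that of [log |z|^2]. *)
Lemma profile_ge_tangent (tau s : R) : 1 <= tau ->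
  (1 + tau^-1) * s + (1 - ln tau) <= profile s.
Proof.
move=> t1; have t0 : 0 < tau by lra.
have ti : tau^-1 <= 1 by rewrite invf_le1.
have ti0 : 0 < tau^-1 by rewrite invr_gt0.
rewrite /profile; case: (leP s (-1)) => s1.
  have : ln (- s / tau) <= - s / tau - 1.
    by apply: ln_le_sub1; rewrite divr_gt0//; lra.
  rewrite ln_div ?posrE//; last by lra.
  rewrite mulrDl mul1r (mulrC tau^-1); lra.
have : ln tau^-1 <= tau^-1 - 1 by exact: ln_le_sub1.
rewrite lnV ?posrE// => h.
have : (1 - tau^-1) * (-1) <= (1 - tau^-1) * s by rewrite ler_wpM2l ?subr_ge0// ltW.
lra.
Qed.

(** [tau = - s] is the tangent at [s]; the linear prolongation is itself the member [tau = 1] of the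
    family. *)
Lemma profile_tangent s : exists2 tau, 1 <= tau &
  profile s = (1 + tau^-1) * s + (1 - ln tau).
Proof.
rewrite /profile; case: (leP s (-1)) => s1.
  exists (- s); first by lra.
  by field; lra.
by exists 1 => //; rewrite invr1 ln1 subr0; ring.
Qed.

(** The slopes [1 + tau^-1] all lie between 1 and 2; each estimate uses the tangent at one
    endpoint. *)
Lemma profile_slope s t : t <= s ->
  s - t <= profile s - profile t <= 2 * (s - t).
Proof.
move=> ts; apply/andP; split.
  have [tau t1 ->] := profile_tangent t.
  have := profile_ge_tangent s t1.
  have : 0 <= tau^-1 * (s - t) by rewrite mulr_ge0 ?invr_ge0; lra.
  lra.
have [tau t1 ->] := profile_tangent s.
have := profile_ge_tangent t t1.
have : tau^-1 * (s - t) <= 1 * (s - t) by rewrite ler_wpM2r ?invf_le1; lra.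
lra.
Qed.

Lemma profile_le s : s <= -1 -> profile s <= s.
Proof. by move=> s1; rewrite /profile s1 gerBl ln_ge0//; lra. Qed.

Lemma profile_ge s : 2 * s + 1 <= profile s.
Proof. by have := @profile_ge_tangent 1 s (lexx 1); rewrite invr1 ln1 subr0; lra. Qed.

Definition lnsq z : R := ln (cabs z ^+ 2).

Lemma cabs_lnsq z : z != 0 -> cabs z = expR (lnsq z / 2).
Proof.
move=> z0; have c0 : 0 < cabs z by rewrite cabs_gt0.
by rewrite /lnsq lnXn// -[_ *+ 2]mulr_natr mulfK// lnK.
Qed.

Lemma lnsq_lt z s : z != 0 -> (cabs z < expR (s / 2)) = (lnsq z < s).
Proof. by move=> z0; rewrite (cabs_lnsq z0) ltr_expR ltr_pM2r. Qed.

Definition psi z : \bar R := if z == 0 then -oo%E else (profile (lnsq z))%:E.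

Lemma psi_lty z : (psi z < +oo)%E.
Proof. by rewrite /psi; case: ifP => // _; exact: ltry. Qed.

(** [psi] is radial and increasing in the modulus, so the neighbourhood can be a disc centred at the
    origin even when [z] is elsewhere. *)
Lemma psi_usc z (a : R) : (psi z < a%:E)%E ->
  exists2 rho, cabs z < rho & forall w, cabs w < rho -> (psi w < a%:E)%E.
Proof.
have key (s : R) w : profile s < a -> cabs w < expR (s / 2) -> (psi w < a%:E)%E.
  move=> sa; rewrite /psi; have [->|w0] := eqVneq w 0; first by rewrite ltNyr.
  rewrite lnsq_lt// lte_fin => /ltW ws; apply: le_lt_trans sa.
  by have /andP[] := profile_slope ws; lra.
rewrite {1}/psi; have [->{z}|z0] := eqVneq z 0.
  move=> _; exists (expR (Num.min (-1) (a - 1) / 2)).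
    by rewrite cabs0 expR_gt0.
  move=> w; apply: key; apply: (@le_lt_trans _ _ (Num.min (-1) (a - 1))).
    by rewrite profile_le// ge_min lexx.
  by rewrite gt_min; apply/orP; right; lra.
rewrite lte_fin => za.
pose s := lnsq z + (a - profile (lnsq z)) / 4.
exists (expR (s / 2)); first by rewrite lnsq_lt// /s; lra.
move=> w; apply: key.
have /profile_slope/andP[_] : lnsq z <= s by rewrite /s; lra.
by rewrite /s; lra.
Qed.

Lemma cabs_sqrD z w :
  cabs (z + w) ^+ 2 = cabs z ^+ 2 + cabs w ^+ 2 + 2 * Re (z^*%C * w).
Proof.
rewrite !cabs_sqr ReD ImD ReM.
have -> : Re z^*%C = Re z by case: z.
have -> : Im z^*%C = - Im z by case: z.
ring.
Qed.

Lemma cabs_conj z : cabs (z^*%C) = cabs z.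
Proof. by rewrite /cabs normcJ. Qed.

(** For [lam] above |a|^2 and |b|^2 the added constant is positive and the coefficient of [zeta] on
    the right has modulus below 1, so [log_circle_mean] applies to |a + zeta b|^2 plus a small
    constant, wherever the circle passes with respect to the origin. *)
Lemma regularized_modulus (a b zeta : C R) (lam : R) : cabs zeta = 1 -> 0 < lam ->
  cabs (a + zeta * b) ^+ 2 + (lam - cabs a ^+ 2) * (lam - cabs b ^+ 2) / lam =
  lam * cabs (1 + (lam^-1%:C)%C * (a^*%C * b) * zeta) ^+ 2.
Proof.
move=> z1 l0; rewrite !cabs_sqrD !cabsM z1 cabs1 cabs_real cabs_conj.
have -> : 1^*%C = 1 :> C R by rewrite conjc1.
rewrite !mul1r -[_ * _ * zeta]mulrA [Re (_%:C%C * _)]ReM/= mul0r subr0.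
have -> : a^*%C * (zeta * b) = a^*%C * b * zeta by ring.
rewrite ger0_norm ?invr_ge0 ?ltW//.
by field; rewrite gt_eqF.
Qed.

(** The tangent of [profile] at [lnsq a] is exact at [a] and a lower bound elsewhere, so only log
    |w|^2 matters. The circle may meet the origin; log (|w|^2 + [del n]) decreases to log |w|^2 and
    monotone convergence passes to the limit. *)
Lemma psi_submean (a b : C R) : (psi a <= ((2 * pi)^-1)%:E *
  \int[mu]_(t in `[0%R, (2 * pi)%R]) psi (a + polar t * b))%E.
Proof.
have p0 := @pi2_gt0 R.
have [->|a0] := eqVneq a 0; first by rewrite {1}/psi eqxx leNye.
have [tau t1 tangE] := profile_tangent (lnsq a).
pose k := 1 + tau^-1; pose c := 1 - ln tau.
have k0 : 0 < k by rewrite /k ltr_wpDr ?invr_ge0//; lra.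
pose A := cabs a ^+ 2; pose B := cabs b ^+ 2.
have A0 : 0 < A by rewrite exprn_gt0// cabs_gt0.
have B0 : 0 <= B by rewrite sqr_ge0.
pose m := Num.max A B.
have m0 : 0 < m by rewrite lt_max A0.
(* Decreases to the larger of |a|^2 and |b|^2, where the added constant [del n] vanishes. *)
pose lam (n : nat) := m + n.+1%:R^-1.
have n0 (n : nat) : 0 < n.+1%:R^-1 :> R by rewrite invr_gt0.
have lam0 n : 0 < lam n by rewrite addr_gt0.
have lamm n : m < lam n by rewrite ltrDl.
have lamA n : A < lam n by rewrite (le_lt_trans _ (lamm n))// le_max lexx.
have lamB n : B < lam n by rewrite (le_lt_trans _ (lamm n))// le_max lexx orbT.
pose del n := (lam n - A) * (lam n - B) / lam n.
have del0 n : 0 < del n by rewrite divr_gt0// mulr_gt0// subr_gt0.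
have delE n : del n = lam n + A * B / lam n - A - B.
  by rewrite /del; field; rewrite gt_eqF.
have del_dec n n' : (n <= n')%N -> del n' <= del n.
  move=> nn; have ll : lam n' <= lam n.
    by rewrite lerD2l lef_pV2 ?posrE// ler_nat.
  rewrite -subr_ge0 (_ : _ - _ = (lam n - lam n') * (1 - A * B / (lam n * lam n'))).
    rewrite mulr_ge0 ?subr_ge0// ler_pdivrMr ?mulr_gt0// mul1r.
    by apply: ler_pM => //; apply: ltW.
  by rewrite !delE; field; rewrite !gt_eqF.
have del_le n : del n <= n.+1%:R^-1.
  have [AB|BA] := leP A B.
    have e : lam n - B = n.+1%:R^-1 by rewrite /lam /m max_r// addrAC subrr add0r.
    rewrite /del e mulrAC; apply: ler_piMl; first exact: ltW.
    by rewrite ler_pdivrMr// mul1r gerBl ltW.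
  have e : lam n - A = n.+1%:R^-1.
    by rewrite /lam /m max_l ?(ltW BA)// addrAC subrr add0r.
  rewrite /del e -mulrA; apply: ler_piMr; first exact: ltW.
  by rewrite ler_pdivrMr// mul1r gerBl.
pose w t := a + polar t * b.
pose X t := cabs (w t) ^+ 2.
have X0 t : 0 <= X t by rewrite sqr_ge0.
(* [M] dominates |w t|^2 + [del n] for all [t] and [n], which makes the functions [q n]
   nonnegative. *)
pose M := (cabs a + cabs b) ^+ 2 + 1.
have XM t n : X t + del n <= M.
  rewrite lerD//; last by rewrite (le_trans (del_le n))// invf_le1// ler1n.
  rewrite lerXn2r ?nnegrE ?addr_ge0 ?cabs_ge0//.
  by apply: (le_trans (cabsD _ _)); rewrite cabsM cabs_polar mul1r.
pose q (n : nat) (t : measurableTypeR R) : \bar R :=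
  (k * ln M - k * ln (X t + del n))%:E.
have q_ge0 n t : (0 <= q n t)%E.
  rewrite lee_fin subr_ge0 ler_pM2l// ler_ln ?posrE//.
    by rewrite ltr_wpDl.
  by rewrite (lt_le_trans _ (XM t n))// ltr_wpDl.
have q_nd t : nondecreasing_seq (q^~ t).
  move=> n n' nn; rewrite lee_fin lerD2l lerN2 ler_pM2l// ler_ln ?posrE ?ltr_wpDl//.
  by rewrite lerD2l del_dec.
have cX : continuous X.
  have [cr ci] : ccont w.
    apply: ccontD; first exact: ccont_cst.
    apply: ccontM; last exact: ccont_cst.
    exact: ccont_cder (@cder_polar1 R).
  have -> : X = fun t => Re (w t) * Re (w t) + Im (w t) * Im (w t).
    by apply/funext => t; rewrite /X cabs_sqr !expr2.
  by move=> t; apply: cvgD; apply: cvgM; [exact: cr|exact: cr|exact: ci|exact: ci].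
have cq n : continuous (fun t => k * ln M - k * ln (X t + del n)).
  move=> t; apply: cvgB; first exact: cvg_cst.
  apply: cvgM; first exact: cvg_cst.
  apply: (@continuous_comp _ _ _ (fun t => X t + del n) (@ln R)).
    by apply: cvgD; [exact: cX|exact: cvg_cst].
  by apply: continuous_ln; rewrite ltr_wpDl.
have mD : measurable (`[0%R, (2 * pi)%R]%classic : set (measurableTypeR R)).
  exact: measurable_itv.
have mq n : measurable_fun (`[0%R, (2 * pi)%R]%classic : set (measurableTypeR R)) (q n).
  apply/measurable_EFinP; apply: measurable_funTS.
  exact: continuous_measurable_fun (cq n).
have kap1 n : cabs (((lam n)^-1%:C)%C * (a^*%C * b)) < 1.
  rewrite cabsM cabs_real cabsM cabs_conj ger0_norm ?invr_ge0 ?(ltW (lam0 n))//.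
  rewrite mulrC ltr_pdivrMr// mul1r (le_lt_trans _ (lamm n))//.
  rewrite /m le_max /A /B !expr2; have [ab|ba] := leP (cabs a) (cabs b).
    by apply/orP; right; rewrite ler_pM// ?cabs_ge0.
  by apply/orP; left; rewrite ler_pM ?cabs_ge0// ltW.
have iq n : (\int[mu]_(t in `[0%R, (2 * pi)%R]) q n t <=
    ((k * ln M - k * ln A) * (2 * pi))%:E)%E.
  have qE t : q n t = (k * ln M - k * ln (lam n) - k * ln (cabs
      (1 + ((lam n)^-1%:C)%C * (a^*%C * b) * polar t) ^+ 2))%:E.
    congr EFin.
    rewrite /del regularized_modulus ?cabs_polar// lnM ?posrE//.
      by ring.
    rewrite exprn_gt0// cabs_gt0; apply/eqP => h0.
    have := regularized_modulus a b (cabs_polar t) (lam0 n).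
    rewrite h0 cabs0 expr0n mulr0 -/A -/B -/(del n) -/(w t) -/(X t) => /eqP.
    by rewrite gt_eqF// ltr_wpDl.
  under eq_integral do rewrite qE.
  apply: (le_trans (log_circle_mean _ (kap1 n) k0)).
  rewrite lee_fin ler_pM2r// lerD2l lerN2 ler_pM2l// ler_ln ?posrE//.
  exact: ltW.
pose Q t := limn (q^~ t).
have cvgQ t : q^~ t @ \oo --> Q t by apply: ereal_nondecreasing_is_cvgn.
have qQ n t : (q n t <= Q t)%E.
  rewrite /Q (cvg_lim _ (ereal_nondecreasing_cvgn (q_nd t)))//.
  by apply: ereal_sup_ubound; exists n.
have Q0 t : (0 <= Q t)%E by apply: le_trans (qQ 0%N t).
have mQ : measurable_fun (`[0%R, (2 * pi)%R]%classic : set (measurableTypeR R)) Q.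
  by apply: (emeasurable_fun_cvg q) => // t _; exact: cvgQ.
have iQ : (\int[mu]_(t in `[0%R, (2 * pi)%R]) Q t <=
    ((k * ln M - k * ln A) * (2 * pi))%:E)%E.
  rewrite /Q monotone_convergence//.
  apply: lime_le; last exact: nearW.
  apply: ereal_nondecreasing_is_cvgn => n n' nn.
  by apply: le_integral_pointwise => t _; exact: q_nd.
have psiQ t : ((k * ln M + c)%:E - Q t <= psi (w t))%E.
  (* Where the circle meets the origin [psi] is -oo, and the bound holds only because [Q] is
     infinite there. *)
  rewrite /psi; have [wt0|wt0] := eqVneq (w t) 0.
    suff -> : Q t = +oo%E by [].
    apply/eqyP => r r0; apply: le_trans (qQ (Num.bound (expR ((r - k * ln M) / k))) t).
    have Xt : X t = 0 by rewrite /X wt0 cabs0 expr0n.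
    rewrite lee_fin Xt add0r -mulrN.
    set n := Num.bound _.
    have hn : expR ((r - k * ln M) / k) < n.+1%:R.
      by apply: (lt_trans (archi_boundP (expR_ge0 _))); rewrite ltr_nat.
    have : (r - k * ln M) / k <= - ln (del n).
      rewrite -lnV ?posrE// -ler_expR lnK ?posrE ?invr_gt0// (le_trans (ltW hn))//.
      by rewrite -[leLHS]invrK lef_pV2 ?posrE.
    by rewrite ler_pdivrMr//; lra.
  have Xt : 0 < X t by rewrite exprn_gt0// cabs_gt0.
  apply: (@le_trans _ _ (k * lnsq (w t) + c)%:E); last first.
    by rewrite lee_fin profile_ge_tangent.
  suff : ((k * ln M - k * lnsq (w t))%:E <= Q t)%E.
    have := Q0 t; case: (Q t) => [y|_ _|//]; last by rewrite addeNy leNye.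
    by rewrite -EFinB !lee_fin; lra.
  apply/lee_addgt0Pr => e e0.
  pose n := Num.bound (k / (e * X t)).
  have hn : k / (e * X t) < n.+1%:R.
    apply: (lt_trans (archi_boundP _)); last by rewrite ltr_nat.
    by apply: divr_ge0; [exact: ltW|apply: mulr_ge0 => //; exact: ltW].
  apply: (@le_trans _ _ (q n t + e%:E)%E); last by rewrite leeD2r.
  rewrite -EFinD lee_fin /lnsq -/(X t).
  have : ln (X t + del n) <= ln (X t) + del n / X t.
    have -> : X t + del n = X t * (1 + del n / X t) by field; rewrite gt_eqF.
    have d0 : 0 < del n / X t by rewrite divr_gt0.
    rewrite lnM ?posrE//; last by rewrite addr_gt0.
    by rewrite lerD2l le_ln1Dx// (lt_trans _ d0).
  move=> /(ler_wpM2l (ltW k0)); rewrite mulrDr => hl.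
  have : k * (del n / X t) <= e.
    rewrite mulrA ler_pdivrMr//; apply: (@le_trans _ _ (k * n.+1%:R^-1)).
      by rewrite ler_pM2l//; exact: del_le.
    move: hn; rewrite ltr_pdivrMr; last exact: mulr_gt0.
    by move=> /ltW hn; rewrite ler_pdivrMr// [leRHS]mulrC.
  lra.
have QfinI : mu.-integrable `[0%R, (2 * pi)%R] Q.
  apply/integrableP; split => //.
  under eq_integral do rewrite gee0_abs//.
  exact: le_lt_trans iQ (ltry _).
have muD : mu `[0%R, (2 * pi)%R] = (2 * pi)%:E.
  by rewrite lebesgue_measure_itv/= lte_fin p0 -EFinB subr0.
have cstI : mu.-integrable `[0%R, (2 * pi)%R] (cst (k * ln M + c)%:E).
  apply: (@continuous_compact_integrable R (fun=> k * ln M + c) _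
    (@segment_compact R 0 (2 * pi))).
  by apply: continuous_subspaceT => x; exact: cst_continuous.
have low : (((k * lnsq a + c) * (2 * pi))%:E <=
    \int[mu]_(t in `[0%R, (2 * pi)%R]) psi (w t))%E.
  apply: (@le_trans _ _ (\int[mu]_(t in `[0%R, (2 * pi)%R])
    ((cst (k * ln M + c)%:E \- Q) t))%E); last first.
    by apply: le_integral_pointwise => t _; exact: psiQ.
  have ic : (\int[mu]_(t in `[0%R, (2 * pi)%R]) cst (k * ln M + c)%:E t =
      (k * ln M + c)%:E * (2 * pi)%:E)%E by rewrite -muD; exact: integral_cst.
  rewrite integralB// ic.
  apply: (@le_trans _ _ ((k * ln M + c)%:E * (2 * pi)%:E -
    ((k * ln M - k * ln A) * (2 * pi))%:E)%E); last by apply: leeB.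
  by rewrite -EFinM -EFinB lee_fin /lnsq -/A; lra.
rewrite {1}/psi (negbTE a0) tangE -/k -/c.
apply: (@le_trans _ _ (((2 * pi)^-1)%:E * ((k * lnsq a + c) * (2 * pi))%:E)%E).
  by rewrite -EFinM lee_fin [leRHS]mulrC mulfK// gt_eqF.
by apply: lee_wpmul2l => //; rewrite lee_fin invr_ge0 ltW.
Qed.

End Potential.

(** * The complex line and log canonicity of the potential *)

Section Model.
Context {R : realType}.
Local Notation V := 'rV[C R]_1.

Let ratC (q : rat * rat) : C R := (ratr q.1 +i* ratr q.2)%C.

Lemma rV1_second_countable : @second_countable V.
Proof.
pose U (q : rat * rat * nat) : set V :=
  [set y | cabs (crd y - ratC q.1) < q.2.+1%:R^-1].
exists (range U); first exact: sub_countable (card_image_le U setT) (countableP _).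
split.
  move=> _ [q _ <-]; rewrite openE => y Uy; apply/nbhsV.
  exists (q.2.+1%:R^-1 - cabs (crd y - ratC q.1)).
    by rewrite subr_gt0.
  move=> z zy; rewrite /U/=.
  have := cabsD (crd z - crd y) (crd y - ratC q.1); rewrite addrA subrK.
  by move=> /le_lt_trans; apply; rewrite -ltrBrDr.
move=> x A /nbhsV[e e0 xA].
pose n := Num.bound (2 / e).
have hn : 2 / e < n.+1%:R.
  apply: (lt_trans (archi_boundP _)); first by rewrite divr_ge0// ltW.
  by rewrite ltr_nat.
have n0 : 0 < n.+1%:R^-1 :> R by rewrite invr_gt0.
have ne : n.+1%:R^-1 * 2 < e.
  by rewrite mulrC ltr_pdivrMr// -ltr_pdivrMl// mulrC.
have [u uE] : exists u : R, u = n.+1%:R^-1 by exists n.+1%:R^-1.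
rewrite -uE in n0 ne.
have near_rat (a : R) : exists q : rat, `|a - ratr q| < u / 2.
  have lt : a - u / 2 < a + u / 2 by lra.
  have [q] := rat_in_itvoo lt.
  by rewrite in_itv/= => /andP[q1 q2]; exists q; rewrite ltr_norml; lra.
have [q1 h1] := near_rat (Re (crd x)); have [q2 h2] := near_rat (Im (crd x)).
have xU : cabs (crd x - ratC (q1, q2)) < u.
  apply: (le_lt_trans (cabs_le_ReIm _)); rewrite ReD ImD ReN ImN/=; lra.
exists (U (q1, q2, n)).
  by split; [exists (q1, q2, n)|rewrite /U/= -uE].
move=> y; rewrite /U/= -uE => Uy; apply: xA.
have := cabsB (crd y - ratC (q1, q2)) (crd x - ratC (q1, q2)).
rewrite opprB addrA subrK => /le_lt_trans; apply.
by apply: le_lt_trans ne; rewrite mulr_natr mulr2n; apply: ltW; apply: ltrD.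
Qed.

Lemma id_open_image : open (id @` [set: V]).
Proof. by rewrite image_id; exact: openT. Qed.

Definition idchart : chart R 1 V := @Chart R 1 V setT id id openT id_open_image
  (fun x _ => erefl) (fun x _ => @cvg_id _ _) (fun x _ => @cvg_id _ _).

Lemma idchart_cover (x : V) : exists2 c, [set idchart] c & cdom c x.
Proof. by exists idchart. Qed.

Lemma idchart_compat (c c' : chart R 1 V) :
  [set idchart] c -> [set idchart] c' -> holo_transition c c'.
Proof.
move=> -> -> x _ _; change (differentiable (@id V) (x : V)).
exact: ex_diff.
Qed.

Definition line : cmanifold R 1 := @CManifold R 1 V [set idchart]
  idchart_cover idchart_compat (@norm_hausdorff _ V) rV1_second_countable.

Lemma hchart_id : @hchart R 1 line idchart.
Proof. by move=> c' ->; split; exact: idchart_compat. Qed.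

Definition potential (x : line) : \bar R := psi (crd x).

Lemma emb_real_continuous : continuous (fun t : R => emb ((t%:C)%C : C R)).
Proof.
move=> t A /nbhsV[e e0 h]; apply/nbhs_ballP; exists e => //= u tu; apply: h.
rewrite !embK -rmorphB/= cabs_real distrC.
exact: tu.
Qed.

Lemma potential_psh : psh (id @` [set: V]) potential.
Proof.
rewrite image_id; split.
- by move=> z _; exact: psi_lty.
- move=> z _ a /psi_usc[rho zrho h]; apply/nbhsV.
  exists (rho - cabs (crd z)); first by rewrite subr_gt0.
  move=> y yz; apply: h.
  by have := cabsD (crd y - crd z) (crd z); rewrite subrK; lra.
(* The origin is the only point of value -oo, and a real segment joins it to 1. *)
- move=> z _; have [z0|z0] := eqVneq (crd z) 0; last first.
    exists z; first exact: connected_component_refl.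
    by rewrite /potential /psi (negbTE z0).
  exists (emb 1); last by rewrite /potential embK /psi oner_eq0.
  have -> : z = emb ((0%:C)%C) by rewrite -[LHS]crdK z0.
  apply: (@connected_component_max _ setT ((fun t : R => emb ((t%:C)%C : C R)) @` `[0, 1])).
  + by exists 0 => //=; rewrite in_itv/= lexx ler01.
  + by [].
  + apply: connected_continuous_connected; first exact: segment_connected.
    exact: continuous_subspaceT emb_real_continuous.
  + by exists 1 => //=; rewrite in_itv/= lexx ler01.
- move=> a b _; rewrite /potential.
  under eq_integral do rewrite crdD crdZ.
  exact: psi_submean.
Qed.

Lemma potential_quasi_psh : quasi_psh potential.
Proof.
move=> x; exists idchart, setT, potential, (fun=> 0); split.
- exact: hchart_id.
- by split => //; exact: openT.
- exact: potential_psh.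
- by move=> k; exact: Ck_cst.
- by move=> y _ /=; rewrite adde0.
Qed.

Lemma ball_open (z : C R) (rho : R) : open [set y : V | cabs (crd y - z) < rho].
Proof.
rewrite openE => y /= yz; apply/nbhsV; exists (rho - cabs (crd y - z)).
  by rewrite subr_gt0.
move=> w wy /=; have := cabsD (crd w - crd y) (crd y - z).
by rewrite addrA subrK; lra.
Qed.

(** Through [profile_ge], [psi] is bounded below on the disc of half the modulus, and a bounded
    function on a square has finite integral. *)
Lemma integrable_away (x : line) : crd x != 0 -> exp_integrable_near potential 1 x.
Proof.
move=> x0; set z := crd x in x0; have z0 : 0 < cabs z by rewrite cabs_gt0.
pose N : set V := [set y : V | cabs (crd y - z) < cabs z / 2].
exists idchart, N; split.
- exact: hchart_id.
- split=> //; first exact: ball_open.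
  by rewrite /N/= subrr cabs0 divr_gt0.
pose M := expR (- (2 * ln ((cabs z / 2) ^+ 2) + 1)).
pose I (a : R) := `[a - cabs z / 2, a + cabs z / 2]%classic.
have mI a : measurable (I a : set (measurableTypeR R)) by exact: measurable_itv.
have muI a : (lebesgue_measure (I a) < +oo)%E.
  by rewrite lebesgue_measure_itv/= lte_fin; case: ifP => _; rewrite ltry.
rewrite /cint_on; apply: le_lt_trans.
  apply: (@cint_le_prod R _ (fun x : measurableTypeR R => (M * \1_(I (Re z)) x)%:E)
    (fun y : measurableTypeR R => (1 * \1_(I (Im z)) y)%:E)).
  - by move=> u; rewrite lee_fin mulr_ge0 ?expR_ge0// indicE.
  - by move=> u; rewrite lee_fin mulr_ge0// indicE.
  - by apply/measurable_EFinP; apply: measurable_funM.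
  - by apply/measurable_EFinP; apply: measurable_funM.
  move=> u v; rewrite image_id patchE; case: ifPn => [/set_mem|_]; last first.
    by rewrite lee_fin !mulr_ge0 ?expR_ge0// indicE.
  rewrite /N/= embK => Nuv.
  have h1 := Re_le_cabs ((u +i* v)%C - z); have h2 := Im_le_cabs ((u +i* v)%C - z).
  rewrite ReD ReN/= in h1; rewrite ImD ImN/= in h2.
  have {h1} h1 := le_lt_trans h1 Nuv; have {h2} h2 := le_lt_trans h2 Nuv.
  rewrite !indicE !mem_set; last 2 first.
  - by rewrite /I/= in_itv/=; move: h1 h2; rewrite !ltr_norml; lra.
  - by rewrite /I/= in_itv/=; move: h1 h2; rewrite !ltr_norml; lra.
  rewrite !mulr1 mule1 mul1e /potential embK.
  have low : cabs z / 2 <= cabs (u +i* v)%C.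
    have := cabsB (u +i* v)%C ((u +i* v)%C - z); rewrite opprB addrC subrK.
    lra.
  have uv0 : (u +i* v)%C != 0 :> C R by rewrite -cabs_gt0; lra.
  rewrite /psi (negbTE uv0) /= lee_fin ler_expR lerN2.
  apply: le_trans (profile_ge _); rewrite lerD2r ler_pM2l// ler_ln ?posrE ?exprn_gt0//.
  - by rewrite lerXn2r// nnegrE ?cabs_ge0//; lra.
  - by rewrite divr_gt0.
  - by rewrite cabs_gt0.
rewrite !integral_indicZ ?expR_ge0//.
have fI a : lebesgue_measure (I a) \is a fin_num.
  by rewrite ge0_fin_numE.
by rewrite -(fineK (fI (Re z))) -(fineK (fI (Im z))) -!EFinM ltry.
all: exact: mI.
Qed.

(** The inequality |u| |v| <= |z|^2 says nothing on the coordinate axes; the infinite value of the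
    majorant makes the estimate trivial there. *)
Lemma dyadic_majorant0 (a : R) : 0 <= a -> dyadic_majorant a 0 = +oo%E.
Proof.
move=> a0; apply/eqyP => r r0.
have nn k : (0 <= ((2 : R) `^ (a * k.+1%:R) *
    \1_(`[- (2 ^- k), 2 ^- k]%classic) (0 : R))%:E)%E.
  by rewrite lee_fin mulr_ge0 ?powR_ge0// indicE.
apply: (le_trans _ (nneseries_lim_ge (Num.bound r) _)); last by move=> k _ _.
apply: (@le_trans _ _ (\sum_(0 <= k < Num.bound r) 1%:E)%E).
  rewrite sumEFin lee_fin big_const_nat subn0 iter_addr_0.
  by rewrite (le_trans (ltW (archi_boundP (ltW r0)))).
apply: lee_sum => k _; rewrite lee_fin indicE mem_set; last first.
  by rewrite /= in_itv/= oppr_le0 invr_ge0 exprn_ge0.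
by rewrite mulr1 -[leLHS](powRr0 2) ler_powR ?ler1n// mulr_ge0.
Qed.

Lemma dyadic_majorant_gt0 (a x : R) : 0 <= a -> `|x| <= 1 ->
  (0 < dyadic_majorant a x)%E.
Proof.
move=> a0 x1; have [->|x0] := eqVneq x 0; first by rewrite dyadic_majorant0// ltry.
by apply: lt_le_trans (dyadic_majorant_bound a0 x1 x0); rewrite lte_fin expR_gt0.
Qed.

(** The factor (-s)^a is below a constant times e^(- a eta s), which only raises the exponent [a] to
    some [a' < 1]; then |u| |v| <= |z|^2 bounds the integrand by a product of two integrable
    one-variable powers. *)
Lemma integrable_below_one (a : R) : 0 < a -> a < 1 ->
  exp_integrable_near potential a (0 : line).
Proof.
move=> a0 a1.
pose N : set V := [set y : V | cabs (crd y - 0) < expR (-1)].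
exists idchart, N; split.
- exact: hchart_id.
- split=> //; first exact: ball_open.
  by rewrite /N/= subr0 crd0 cabs0 expR_gt0.
(* Chosen so that [a * (1 + eta)] is the midpoint of [a] and 1. The constant [K] below comes from
   [ln (- s) <= eta * (- s) - 1 - ln eta]. *)
pose eta := (1 - a) / (2 * a).
pose a' := a * (1 + eta).
have eta0 : 0 < eta by rewrite divr_gt0 ?subr_gt0// mulr_gt0.
have a'E : a' = (1 + a) / 2 by rewrite /a' /eta; field; rewrite gt_eqF.
have a'0 : 0 <= a' by rewrite a'E; lra.
have a'1 : a' < 1 by rewrite a'E; lra.
pose K := expR (a * (- 1 - ln eta)).
pose D := dyadic_majorant a'.
rewrite /cint_on; apply: le_lt_trans.
  apply: (@cint_le_prod R _ (fun x => (K%:E * D x)%E) D).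
  - by move=> u; rewrite mule_ge0 ?lee_fin ?expR_ge0// dyadic_majorant_ge0.
  - by move=> u; exact: dyadic_majorant_ge0.
  - by apply: measurable_funeM; exact: measurable_dyadic_majorant.
  - exact: measurable_dyadic_majorant.
  move=> u v; rewrite image_id patchE; case: ifPn => [/set_mem|_]; last first.
    by rewrite !mule_ge0 ?lee_fin ?expR_ge0// dyadic_majorant_ge0.
  rewrite /N/= embK subr0 => Nuv.
  have e1 : expR (-1) <= 1 :> R by rewrite -[leRHS]expR0 ler_expR; lra.
  have u1 : `|u| <= 1 by have := Re_le_cabs (u +i* v)%C; rewrite /=; lra.
  have v1 : `|v| <= 1 by have := Im_le_cabs (u +i* v)%C; rewrite /=; lra.
  have Du := dyadic_majorant_gt0 a'0 u1; have Dv := dyadic_majorant_gt0 a'0 v1.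
  have K0 : 0 < K by rewrite expR_gt0.
  have [u0|u0] := eqVneq u 0.
    by rewrite [D u](_ : _ = +oo%E) ?u0 /D ?dyadic_majorant0// gt0_muley ?lte_fin// gt0_mulye ?leey.
  have [v0|v0] := eqVneq v 0.
    rewrite [D v](_ : _ = +oo%E) ?v0 /D ?dyadic_majorant0// gt0_muley ?leey//.
    by rewrite mule_gt0// lte_fin.
  have uv0 : (u +i* v)%C != 0 :> C R.
    by apply: contraNN u0 => /eqP[->].
  rewrite /potential embK /psi (negbTE uv0) -EFinM /=.
  set s := lnsq _.
  have s1 : s < -2.
    by rewrite -lnsq_lt// (_ : -2 / 2 = -1)//; lra.
  apply: (@le_trans _ _ (K%:E * (expR (- (a' * ln `|u|)))%:E *
     (expR (- (a' * ln `|v|)))%:E)%E); last first.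
    apply: lee_pmul; rewrite ?mule_ge0 ?lee_fin ?expR_ge0//.
      by apply: lee_wpmul2l; [rewrite lee_fin expR_ge0|exact: dyadic_majorant_bound].
    exact: dyadic_majorant_bound.
  rewrite -!EFinM -!expRD lee_fin ler_expR.
  have sl : ln `|u| + ln `|v| <= s.
    rewrite -lnM ?posrE ?normr_gt0// ler_ln ?posrE ?mulr_gt0 ?normr_gt0 ?exprn_gt0 ?cabs_gt0//.
      rewrite cabs_sqr/= -(real_normK (num_real u)) -(real_normK (num_real v)).
      have := sqr_ge0 (`|u| - `|v|); have := sqr_ge0 (`|u| + `|v|).
      rewrite !expr2; lra.
  rewrite /profile ifT; last by lra.
  have h : ln (- s) <= eta * (- s) - 1 - ln eta.
    have : ln (eta * (- s)) <= eta * (- s) - 1.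
      by apply: ln_le_sub1; rewrite mulr_gt0//; lra.
    by rewrite lnM ?posrE//; lra.
  have := ler_wpM2l (ltW a0) h.
  have := ler_wpM2l a'0 sl.
  have : a' * s = a * s + a * (eta * s) by rewrite /a'; ring.
  clearbody a'; lra.
rewrite ge0_integralZl_EFin ?expR_ge0//; last 2 first.
- by move=> x _; exact: dyadic_majorant_ge0.
- exact: measurable_dyadic_majorant.
have DI := integral_dyadic_majorant a'1.
have DI0 : (0 <= \int[lebesgue_measure]_x D x)%E.
  by apply: integral_ge0 => x _; exact: dyadic_majorant_ge0.
have fD : (\int[lebesgue_measure]_x D x)%E \is a fin_num.
  by rewrite ge0_fin_numE.
by rewrite -(fineK fD) -!EFinM ltry.
Qed.

Lemma potential_log_canonical : log_canonical potential.
Proof.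
move=> x; have [x0|x0] := eqVneq (crd x) 0; last first.
  by apply: ereal_sup_ubound; exists 1 => //; split=> //; exact: integrable_away.
have -> : x = 0 by rewrite -[LHS]crdK x0; apply/matrixP => i j; rewrite !mxE.
apply/lee_addgt0Pr => e e0.
(* The exponent 1 itself fails at the origin and is approached from below; the [1 / 2] keeps [a]
   positive when [e] is large. *)
pose a := Num.max (1 - e) (1 / 2).
have a0 : 0 < a by rewrite lt_max; apply/orP; right; lra.
have a1 : a < 1 by rewrite gt_max; apply/andP; split; lra.
apply: (@le_trans _ _ (a%:E + e%:E)%E).
  by rewrite -EFinD lee_fin -lerBlDr le_max lexx.
rewrite leeD2r//; apply: ereal_sup_ubound; exists a => //; split; first exact: ltW.
exact: integrable_below_one.
Qed.

End Model.

(** * Charts of the line and divergence of the integral at the origin *)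

Section Charts.
Context {R : realType}.
Local Notation V := 'rV[C R]_1.
Implicit Types (f g : C R -> C R) (z w : C R).

Lemma cdiff_unique f z d e : cdiff f z d -> cdiff f z e -> d = e.
Proof.
by move=> /cdiff_derivable[_ <-] /cdiff_derivable[_ <-].
Qed.

Lemma cdiff_id z : cdiff id z 1.
Proof.
move=> e e0; exists 1 => // h _.
by rewrite mul1r (addrC z) addrK subrr cabs0 mulr_ge0 ?cabs_ge0// ltW.
Qed.

Lemma cdiff_near f g z d (r : R) : 0 < r ->
  (forall w, cabs (w - z) < r -> f w = g w) -> cdiff f z d -> cdiff g z d.
Proof.
move=> r0 fg fd e e0; have [del del0 h] := fd e e0.
exists (Num.min del r); first by rewrite lt_min del0.
move=> k; rewrite lt_min => /andP[/h + kr].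
rewrite !fg//; first by rewrite subrr cabs0.
by rewrite addrAC subrr add0r.
Qed.

Lemma cdiff_comp f g z d e : cdiff f z d -> cdiff g (f z) e ->
  cdiff (g \o f) z (e * d).
Proof.
move=> fd gd eps eps0.
have cd := cabs_ge0 d; have ce := cabs_ge0 e.
pose e1 := eps / (2 * (cabs d + 1)); pose e2 := Num.min 1 (eps / (2 * (cabs e + 1))).
have e10 : 0 < e1 by rewrite divr_gt0// mulr_gt0//; lra.
have e20 : 0 < e2 by rewrite lt_min ltr01 divr_gt0// mulr_gt0//; lra.
have [d1 d10 h1] := gd e1 e10; have [d2 d20 h2] := fd e2 e20.
exists (Num.min d2 (d1 / (cabs d + 1))).
  by rewrite lt_min d20 divr_gt0//; lra.
move=> h; rewrite lt_min => /andP[/h2 hf].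
rewrite ltr_pdivlMr; last by lra.
move=> hd; have ch := cabs_ge0 h.
pose k := f (z + h) - f z.
have kE : f (z + h) = f z + k by rewrite /k addrCA subrr addr0.
have e2le : e2 * cabs h <= cabs h.
  by rewrite ler_piMl// ge_min lexx.
have kb : cabs k <= (cabs d + 1) * cabs h.
  have := cabsD (k - d * h) (d * h); rewrite subrK cabsM.
  rewrite -/k in hf; lra.
have kd : cabs k < d1 by apply: (le_lt_trans kb); rewrite mulrC.
have hg := h1 k kd.
rewrite /= kE (_ : _ - _ - _ = (g (f z + k) - g (f z) - e * k) + e * (k - d * h));
  last by ring.
apply: (le_trans (cabsD _ _)); rewrite cabsM.
have t1 : e1 * cabs k <= eps / 2 * cabs h.
  apply: (@le_trans _ _ (e1 * ((cabs d + 1) * cabs h))).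
    by rewrite ler_wpM2l// ltW.
  rewrite mulrA /e1 le_eqVlt; apply/orP; left; apply/eqP; congr (_ * _).
  by field; rewrite gt_eqF//; lra.
have t2 : cabs e * cabs (k - d * h) <= eps / 2 * cabs h.
  apply: (@le_trans _ _ ((cabs e + 1) * (eps / (2 * (cabs e + 1)) * cabs h))).
    apply: ler_pM; rewrite ?cabs_ge0//; first by lra.
    apply: (le_trans hf); rewrite ler_wpM2r// ge_min lexx.
    by rewrite orbT.
  rewrite mulrA le_eqVlt; apply/orP; left; apply/eqP; congr (_ * _).
  by field; rewrite gt_eqF//; lra.
lra.
Qed.

Lemma open_nbhsV (A : set V) (x : V) : open A -> A x ->
  exists2 e : R, 0 < e & forall y, cabs (crd y - crd x) < e -> A y.
Proof. by move=> oA Ax; apply/nbhsV; rewrite nbhsE/=; exists A. Qed.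

(** Chain rule for the chart followed by its inverse, which is the identity near [x]. In particular
    both derivatives are nonzero. *)
Lemma chart_cdiff (c : chart R 1 (@line R)) (x : @line R) : hchart c -> cdom c x ->
  exists d e, [/\ cdiff (crd \o cinv c \o emb) (crd (cfun c x)) d,
    cdiff (crd \o cfun c \o emb) (crd x) e & d * e = 1].
Proof.
move=> hc cx; have [h1 h2] := hc idchart erefl.
have [d hd] : exists d, cdiff (crd \o cinv c \o emb) (crd (cfun c x)) d.
  apply: differentiable_cdiff; apply: differentiable_comp.
    exact: h1 x cx I.
  exact: crd_differentiable.
have [e he] : exists e, cdiff (crd \o cfun c \o emb) (crd x) e.
  apply: differentiable_cdiff; apply: differentiable_comp.
    exact: h2 x I cx.
  exact: crd_differentiable.
exists d, e; split=> //.
have hde := cdiff_comp he; rewrite /= crdK in hde.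
have {}hde := hde _ _ hd.
have [r r0 hr] := open_nbhsV (@cdom_open _ _ _ c) cx.
apply: (cdiff_unique hde); apply: (cdiff_near r0 _ (cdiff_id _)) => w wx /=.
by rewrite crdK cfunK ?embK//; apply: hr; rewrite embK.
Qed.

(** The constants fit the rectangle of [annulus_integral]: its points have modulus between 1 and
    33/32 times the scale, up to a relative error of 1/64, and 33/32 times 65/64 is below 21/20. *)
Lemma lnsq_scale_bound (z : C R) (s : R) :
  63 / 64 * expR (s / 2) <= cabs z -> cabs z <= 21 / 20 * expR (s / 2) ->
  z != 0 /\ `|lnsq z - s| < 1 / 4.
Proof.
have e0 := expR_gt0 (s / 2); move=> z1 z2.
have z0 : z != 0 by rewrite -cabs_gt0; lra.
split=> //.
have c0 : 0 < cabs z by rewrite cabs_gt0.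
pose q := cabs z / expR (s / 2).
have q0 : 0 < q by rewrite divr_gt0.
have q1 : 63 / 64 <= q by rewrite ler_pdivlMr.
have q2 : q <= 21 / 20 by rewrite ler_pdivrMr.
have E : lnsq z - s = 2 * ln q.
  by rewrite /lnsq lnXn// /q ln_div ?posrE// expRK; lra.
have l1 := ln_le_sub1 q0.
have l2 : ln q^-1 <= q^-1 - 1 by apply: ln_le_sub1; rewrite invr_gt0.
have q3 : q^-1 <= 64 / 63.
  by rewrite -[leRHS]invf_div lef_pV2 ?posrE//; lra.
rewrite lnV ?posrE// in l2.
by rewrite E ltr_norml; lra.
Qed.

(* In any coordinate the shell [|log |z|^2 - s| < 1/4] contains a rectangle of
   sides proportional to [exp (s / 2)]. *)
Lemma annulus_integral (c : chart R 1 (@line R)) (N : set V) : hchart c ->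
  cdom c (0 : V) -> nbhs (0 : V) N ->
  exists2 kappa : R, 0 < kappa & exists sigma : R, forall s, s < sigma ->
  forall (B : set V) (g : V -> \bar R) (m : R), 0 <= m ->
    (forall y, (0 <= g y)%E) ->
    (forall p : V, cdom c p -> N p -> crd p != 0 -> `|lnsq (crd p) - s| < 1 / 4 ->
      B (cfun c p) /\ (m%:E <= g (cfun c p))%E) ->
    ((m * (kappa * expR s))%:E <= cint_on B g)%E.
Proof.
move=> hc c0 N0.
have [d [e [dP eP de]]] := chart_cdiff hc c0.
have d0 : d != 0.
  by apply: contra_eq_neq de => ->; rewrite mul0r eq_sym oner_eq0.
have cd0 : 0 < cabs d by rewrite cabs_gt0.
pose z0 := crd (cfun c (0 : V)).
pose f := crd \o cinv c \o emb.
have f0 : f z0 = 0 by rewrite /f /z0/= crdK cfunK// crd0.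
have [d1 d10 h1] := dP (cabs d / 64) ltac:(by rewrite divr_gt0).
have [r2 r20 h2] : exists2 r, 0 < r & forall y, cabs (crd y - z0) < r ->
    (cfun c @` cdom c) y.
  by apply: open_nbhsV; [exact: cimg_open|exists (0 : V)].
have [r3 r30 h3] : exists2 r, 0 < r & forall p : V, cabs (crd p - 0) < r -> N p.
  by have /nbhsV[r r0 h] := N0; exists r => // p; rewrite -crd0; exact: h.
have [r4 r40 h4] := cdiff_continuous dP r30.
pose r := Num.min (Num.min d1 r2) r4.
have r0 : 0 < r by rewrite !lt_min d10 r20 r40.
exists ((1 / 64) ^+ 2 / cabs d ^+ 2).
  by rewrite divr_gt0 ?exprn_gt0.
exists (2 * ln (r * cabs d / 2)) => s ssig B g m m0 g0 hB.
(* Radius of the shell read in the chart, whose inverse stretches lengths by about [cabs d]. The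
   rectangle starts at distance [q] from the centre and has sides [q / 64], whence the constant
   [kappa]. *)
pose q := expR (s / 2) / cabs d.
have q0 : 0 < q by rewrite divr_gt0 ?expR_gt0.
have qr : 2 * q < r.
  have : expR (s / 2) < r * cabs d / 2.
    by rewrite -ltr_ln ?posrE ?expR_gt0 ?divr_gt0 ?mulr_gt0// expRK; lra.
  rewrite /q mulrA ltr_pdivrMr//; lra.
have qE : q * cabs d = expR (s / 2) by rewrite /q divfK// gt_eqF.
have areaE : (1 / 64) ^+ 2 / cabs d ^+ 2 * expR s = (q / 64) * (q / 64).
  have -> : expR s = expR (s / 2) * expR (s / 2) by rewrite -expRD; congr expR; lra.
  by rewrite -qE; field; rewrite gt_eqF.
rewrite areaE.
have := @cint_rectangle R B g m (Re z0 + q) (Re z0 + q + q / 64)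
  (Im z0) (Im z0 + q / 64).
rewrite [X in (m * X)%:E](_ : _ = q / 64 * (q / 64)); last by ring.
apply=> //; [lra|lra|].
move=> x y /andP[x1 x2] /andP[y1 y2].
set w : C R := (x +i* y)%C.
pose h := w - z0.
have wE : w = z0 + h by rewrite /h addrC subrK.
have hre : q <= Re h <= q + q / 64 by rewrite /h ReD ReN/=; lra.
have him : 0 <= Im h <= q / 64 by rewrite /h ImD ImN/=; lra.
have hle : cabs h <= q * (33 / 32).
  apply: (le_trans (cabs_le_ReIm _)); clear -q0 hre him.
  by rewrite !ger0_norm; lra.
have hge : q <= cabs h.
  by have := Re_le_cabs h; clear -q0 hre; rewrite ger0_norm; lra.
have hr : cabs h < r by lra.
move: (hr); rewrite !lt_min => /andP[/andP[hd1 hr2] hr4].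
have fh := h1 h hd1; rewrite -/z0 -/f -wE f0 subr0 in fh.
have [p cp pE] : (cfun c @` cdom c) (emb w).
  by apply: h2; rewrite embK wE addrAC subrr add0r.
have fw : f w = crd p by rewrite /f/= -pE cfunK.
have [p0 ps] : crd p != 0 /\ `|lnsq (crd p) - s| < 1 / 4.
  rewrite -fw; have t1 : q * cabs d <= cabs d * cabs h.
    by rewrite mulrC ler_pM2l.
  have t2 : cabs d * cabs h <= q * cabs d * (33 / 32).
    by rewrite mulrAC [leRHS]mulrC ler_pM2l.
  have t3 : cabs (f w - d * h) <= (cabs d * cabs h) / 64.
    by apply: (le_trans fh); rewrite mulrAC.
  have e0 := expR_gt0 (s / 2); rewrite qE in t1 t2.
  apply: lnsq_scale_bound.
    have := cabsB (f w) (f w - d * h); rewrite subKr cabsM.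
    by clear -t1 t3 e0; lra.
  have := cabsD (f w - d * h) (d * h); rewrite subrK cabsM.
  by clear -t2 t3 e0; lra.
rewrite -pE; apply: hB => //.
apply: h3; rewrite -fw; have := h4 w; rewrite -/z0 -/f f0.
by apply; rewrite wE addrAC subrr add0r.
Qed.

(** A single shell contributes at least a multiple of [- s], so letting [s] tend to -oo contradicts
    finiteness. *)
Lemma nonintegrable_at0 : ~ exp_integrable_near (@potential R) 1 (0 : @line R).
Proof.
move=> [c [N [hc [oN N0 Nc]]]].
have [kappa k0 [sigma hk]] := annulus_integral hc (Nc _ N0) (open_nbhs_nbhs (conj oN N0)).
set I := cint_on _ _ => Ifin.
have low (s : R) : s < sigma -> s < - 2 -> ((kappa * expR (- 1) * (- s))%:E <= I)%E.
  move=> ssig s2.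
  (* Slopes are at most 2, so on the shell [profile] exceeds [profile s] by less than 1/2, within
     the margin 1. *)
  pose m := expR (- (profile s + 1)).
  have -> : kappa * expR (- 1) * (- s) = m * (kappa * expR s).
    rewrite /m /profile ifT; last by lra.
    rewrite -[X in _ * X = _](@lnK _ (- s)) ?posrE; last by lra.
    rewrite [RHS]mulrCA -expRD -mulrA -expRD; congr (_ * expR _); ring.
  apply: hk => //; first exact: expR_ge0.
    by move=> y; exact: expeR_ge0.
  move=> p cp Np p0 ps; split; first by exists p.
  rewrite /= cfunK// mul1e /potential /psi (negbTE p0) /= lee_fin ler_expR lerN2.
  move: ps; rewrite ltr_norml => /andP[q1 q2].
  have [le|/ltW le] := leP s (lnsq (crd p)).
    by have /andP[_] := profile_slope le; lra.
  by have /andP[+ _] := profile_slope le; lra.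
have I0 : (0 <= I)%E.
  have s' : Num.min (sigma - 1) (-3) < sigma by rewrite gt_min; apply/orP; left; lra.
  have s'' : Num.min (sigma - 1) (-3) < -2 by rewrite gt_min; apply/orP; right; lra.
  apply: le_trans (low _ s' s''); rewrite lee_fin !mulr_ge0 ?expR_ge0 ?(ltW k0)//.
  lra.
have If : I \is a fin_num by rewrite ge0_fin_numE.
rewrite -(fineK If) in low.
pose b := kappa * expR (-1).
have b0 : 0 < b by rewrite mulr_gt0// expR_gt0.
pose s := - ((`|fine I| + 1) / b + `|sigma| + 3).
have db : 0 <= (`|fine I| + 1) / b.
  by apply: divr_ge0; [have := normr_ge0 (fine I); lra|exact: ltW].
have n1 := normr_ge0 sigma; have n2 := ler_norm (- sigma); rewrite normrN in n2.
have := low s ltac:(rewrite /s; lra) ltac:(rewrite /s; lra).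
rewrite lee_fin -/b.
have : b * ((`|fine I| + 1) / b) <= b * (- s).
  by rewrite ler_pM2l// /s; lra.
rewrite mulrCA divff ?gt_eqF// mulr1; have := ler_norm (fine I); lra.
Qed.

Lemma nonint_locus_potential : nonint_locus (@potential R) = [set (0 : V)].
Proof.
apply/seteqP; split=> x /=.
  move=> nx; apply: contrapT => x0; apply: nx; apply: integrable_away.
  by apply/eqP => cx; apply: x0; rewrite -[LHS]crdK cx; apply/matrixP => i j; rewrite !mxE.
by move=> ->; exact: nonintegrable_at0.
Qed.

End Charts.

(** * The Ohsawa norm *)

Section OhsawaSingular.
Context {R : realType}.
Local Notation V := 'rV[C R]_1.
Local Notation X := (@line R).

Lemma continuous_at0P (h : V -> C R) : {for 0, continuous h} <->
  forall e : R, 0 < e -> exists2 del : R, 0 < del &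
    forall p : V, cabs (crd p) < del -> cabs (h p - h 0) < e.
Proof.
split=> [ch e e0|hh A /nbhsC[e e0 hA]].
  have : nbhs (h 0) [set w | cabs (w - h 0) < e] by apply/nbhsC; exists e.
  move=> /ch /nbhsV[del del0 hd]; exists del => // p pd; apply: hd.
  by rewrite crd0 subr0.
have [del del0 hd] := hh e e0; apply/nbhsV; exists del => // p.
by rewrite crd0 subr0 => /hd /hA.
Qed.

Lemma real_continuous_at0 (h : V -> R) : {for 0, continuous h} ->
  {for 0, continuous (fun p => ((h p)%:C)%C : C R)}.
Proof.
move=> ch; apply/continuous_at0P => e e0.
have : nbhs (h 0) (ball (h 0) e) by exact: nbhsx_ballx.
move=> /ch /nbhsV[del del0 hd]; exists del => // p pd.
rewrite -rmorphB/= cabs_real distrC; apply: hd.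
by rewrite crd0 subr0.
Qed.

Lemma continuous_at0D (f g : V -> C R) : {for 0, continuous f} ->
  {for 0, continuous g} -> {for 0, continuous (f \+ g)}.
Proof.
move=> /continuous_at0P cf /continuous_at0P cg; apply/continuous_at0P => e e0.
have e20 : 0 < e / 2 by rewrite divr_gt0.
have [d1 d10 h1] := cf _ e20; have [d2 d20 h2] := cg _ e20.
exists (Num.min d1 d2); first by rewrite lt_min d10.
move=> p; rewrite lt_min => /andP[/h1 p1 /h2 p2] /=.
rewrite opprD addrACA; apply: (le_lt_trans (cabsD _ _)); lra.
Qed.

Lemma modulus_open (r : R) : open [set p : V | cabs (crd p) < r].
Proof.
have -> : [set p : V | cabs (crd p) < r] = [set p : V | cabs (crd p - 0) < r].
  by apply/seteqP; split=> p /=; rewrite subr0.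
exact: ball_open.
Qed.

Lemma modulus_open_gt (r : R) : open [set p : V | r < cabs (crd p)].
Proof.
rewrite openE => y /= yz; apply/nbhsV; exists (cabs (crd y) - r).
  by rewrite subr_gt0.
move=> w wy /=; have := cabsB (crd w) (crd w - crd y).
by rewrite subKr; lra.
Qed.

Lemma square_compact (r : R) :
  compact [set p : V | `|Re (crd p)| <= r /\ `|Im (crd p)| <= r].
Proof.
pose q (u : R * R) : V := emb ((u.1 +i* u.2)%C : C R).
have -> : [set p : V | `|Re (crd p)| <= r /\ `|Im (crd p)| <= r] =
    q @` (`[- r, r] `*` `[- r, r]).
  apply/seteqP; split=> p /=.
    move=> [p1 p2]; exists (Re (crd p), Im (crd p)).
      by rewrite /= !in_itv/= -!ler_norml.
    by rewrite /q/= -[RHS]crdK; congr emb; apply: ceqP.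
  by move=> [[x y]]; rewrite /= !in_itv/= -!ler_norml => -[x1 y1] <-; rewrite embK.
apply: continuous_compact; last by apply: compact_setX; exact: segment_compact.
apply: continuous_subspaceT => -[x y] A /nbhsV[e e0 hA].
have e20 : 0 < e / 2 by rewrite divr_gt0.
exists (ball x (e / 2), ball y (e / 2)) => /=.
  by split; exact: nbhsx_ballx.
move=> [x' y'] /= [bx by']; apply: hA; rewrite !embK.
apply: (le_lt_trans (cabs_le_ReIm _)); rewrite ReD ReN ImD ImN/=.
move: bx by'; rewrite /ball/= => bx by'.
rewrite (distrC x') (distrC y'); lra.
Qed.

(** Near the origin [F i] is a finite sum, continuous at 0 with value [f i 0]: a term with 0 in
    [U j] takes the value [chi j 0] times [f i 0], the other [chi j] vanish near 0 by the support
    condition, and the weights add up to 1. *)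
Lemma ohsawa_extension_bounded_below (W : set X) (L : hlbundle W)
    (i : lidx L) (f F : lidx L -> X -> C R) :
  open W -> W (0 : V) -> cdom (lchart i) (0 : V) -> f i (0 : V) <> 0 ->
  ohsawa_extension (nonint_locus (@potential R)) f F ->
  exists2 k : R, 0 < k & exists2 r : R, 0 < r & forall p : V,
    cabs (crd p) < r -> W p -> cdom (lchart i) p -> k <= cabs (F i p).
Proof.
move=> oW W0 c0 f0 [J [U [chi [G [[UW Wcov] [chiS chi0 chiU chifin chi1] Gh Gf FE]]]]].
have {chifin} [N [oN N0 finN]] := chifin (0 : V) W0.
pose s : seq J := finmap.enum_fset (fset_set [set j | exists y, [/\ N y, W y & chi j y <> 0]]).
have sumE (T : zmodType) (h : J -> T) p : N p -> W p ->
    (forall j, chi j p = 0 -> h j = 0) ->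
    \sum_(j \in [set: J]) h j = \sum_(j <- s) h j.
  move=> Np Wp hz; rewrite -fsbig_finite//; apply/esym/fsbig_widen => //.
  move=> j [_ /= nj]; apply: hz; apply: contrapT => cj; apply: nj.
  by exists p.
have [r1 r10 hr1] := open_nbhsV oN N0.
have chic j : {for (0 : V), continuous (chi j : V -> R)}.
  have := chiS j idchart erefl 0%N => -[+ _].
  by move=> /(_ (0 : V)); apply; exists (0 : V).
pose t j : V -> C R := fun p => ((chi j p)%:C)%C * G j i p.
have tc j : {for 0, continuous (t j)} /\ t j 0 = ((chi j (0 : V))%:C)%C * f i (0 : V).
  have [U0|U0] := pselect (U j (0 : V)).
    split; last first.
      by rewrite /t Gf// nonint_locus_potential.
    apply: (@continuousM (C R) V (fun p => ((chi j p)%:C)%C : C R) (G j i)).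
      exact: real_continuous_at0.
    have [_ /(_ i) Gj] := Gh j.
    have := Gj (0 : V) (conj U0 c0) idchart erefl I.
    exact: differentiable_continuous.
  have nz : ~ closure [set x | W x /\ chi j x <> 0] (0 : V).
    by move=> cl; apply: U0; apply: chiU.
  have [B [nB dB]] : exists B, nbhs (0 : V) B /\
      ~ ([set x | W x /\ chi j x <> 0] `&` B !=set0).
    move/existsNP: nz => [B /not_implyP[nB dB]]; exists B; split => //.
  have cz : chi j (0 : V) = 0.
    apply: contrapT => cj; apply: dB; exists (0 : V); split => //.
    exact: nbhs_singleton nB.
  have [r0 r00 hr0] : exists2 r, 0 < r & forall p : V, cabs (crd p) < r -> t j p = 0.
    have /nbhsV[e e0 he] : nbhs (0 : V) (B `&` W).
      by apply: filterI => //; exact: open_nbhs_nbhs.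
    exists e => // p pe; have [Bp Wp] : (B `&` W) p by apply: he; rewrite crd0 subr0.
    have -> : t j p = ((chi j p)%:C)%C * G j i p by [].
    suff -> : chi j p = 0 by rewrite mul0r.
    by apply: contrapT => cj; apply: dB; exists p.
  have t0 : t j 0 = 0 by apply: hr0; rewrite crd0 cabs0.
  split; last by rewrite t0 cz mul0r.
  apply/continuous_at0P => e e0; exists r0 => // p /hr0 ->.
  by rewrite t0 subrr cabs0.
have [r2 r20 [k k0 hk]] : exists2 r2 : R, 0 < r2 & exists2 k : R, 0 < k &
  forall p : V, cabs (crd p) < r2 -> k <= cabs (\sum_(j <- s) t j p).
  have cS : {for 0, continuous (fun p : V => \sum_(j <- s) t j p)}.
    elim: (s) => [|j l IH].
      have -> : (fun p : V => \sum_(j <- [::]) t j p) = (fun=> 0).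
        by apply/funext => p; rewrite big_nil.
      exact: cst_continuous.
    have -> : (fun p : V => \sum_(j <- j :: l) t j p) =
        t j \+ (fun p => \sum_(j <- l) t j p).
      by apply/funext => p; rewrite big_cons.
    exact: continuous_at0D (tc j).1 IH.
  have S0 : \sum_(j <- s) t j 0 = f i (0 : V).
    rewrite (eq_bigr (fun j => ((chi j (0 : V))%:C)%C * f i (0 : V))) => [|j _].
      rewrite -mulr_suml -rmorph_sum/= -(sumE _ (chi^~ (0 : V)) (0 : V))//.
      by rewrite chi1// mul1r.
    exact: (tc j).2.
  have a0 : 0 < cabs (f i (0 : V)) by rewrite cabs_gt0; apply/eqP.
  have /continuous_at0P := cS => /(_ _ (divr_gt0 a0 (ltr0n _ 2)))[r r0 hr].
  exists r => //; exists (cabs (f i (0 : V)) / 2); first by rewrite divr_gt0.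
  move=> p /hr; rewrite S0 => h.
  have := cabsB (\sum_(j <- s) t j p) (\sum_(j <- s) t j p - f i (0 : V)).
  by rewrite subKr; lra.
exists k => //; exists (Num.min r1 r2); first by rewrite lt_min r10.
move=> p; rewrite lt_min => /andP[p1 p2] Wp cp.
have Np : N p by apply: hr1; rewrite crd0 subr0.
rewrite FE//= (sumE _ _ p)//; first exact: hk.
by move=> j ->; rewrite mul0r.
Qed.

Lemma lnsq_shell (z : C R) (s : R) : z != 0 ->
  (expR ((s - 1 / 4) / 2) < cabs z < expR ((s + 1 / 4) / 2)) =
  (`|lnsq z - s| < 1 / 4).
Proof.
move=> z0; rewrite (cabs_lnsq z0) !ltr_expR ltr_norml.
by apply/idP/idP => /andP[? ?]; apply/andP; split; lra.
Qed.

Lemma profile_shell (s t : R) : `|t - s| < 1 / 4 ->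
  `|profile t - profile s| < 1 / 2.
Proof.
rewrite !ltr_norml => /andP[q1 q2].
by have [le|/ltW le] := leP s t; have /andP[] := profile_slope le; lra.
Qed.

(** Covers at once the trivial bundle on a small open set, for the singularity at the origin, and a
    global bundle, for the vanishing of sections of finite norm. The norm being an infimum, every
    admissible extension has to be shown infinite. *)
Lemma ohsawa_norm_infinite (W : set X) (L : hlbundle W) (i : lidx L)
    (f : lidx L -> X -> C R) : open W ->
  W (0 : V) -> cdom (lchart i) (0 : V) -> f i (0 : V) <> 0 ->
  ohsawa_norm (@potential R) f = +oo%E.
Proof.
move=> oW W0 c0 f0; apply/ereal_inf_pinfty => _ [F FE <-] /=.
have [k k0 [r1 r10 hk]] := ohsawa_extension_bounded_below oW W0 c0 f0 FE.
have hc := lchartP i; set c := lchart i in c0 hk hc.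
have [r2 r20 hr2] : exists2 r, 0 < r & forall p : V, cabs (crd p) < r -> W p.
  have [r r0 h] := open_nbhsV oW W0; exists r => // p pr; apply: h.
  by rewrite crd0 subr0.
have [r3 r30 hr3] : exists2 r, 0 < r & forall p : V, cabs (crd p) < r ->
    lweight i p <= lweight i (0 : V) + 1.
  have := @lweight_smooth _ _ _ _ L i idchart erefl 0%N => -[+ _].
  move=> /(_ (0 : V)) cw.
  have {}cw : {for (0 : V), continuous (lweight i : V -> R)}.
    by apply: cw; exists (0 : V).
  have /continuous_at0P /(_ 1 ltr01)[r r0 h] := real_continuous_at0 cw.
  exists r => // p /h; rewrite -rmorphB/= cabs_real ltr_norml; lra.
pose rho := Num.min (Num.min r1 r2) r3 / 2.
have rho0 : 0 < rho by rewrite divr_gt0// !lt_min r10 r20 r30.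
have rhoP (p : V) : cabs (crd p) < 2 * rho ->
    [/\ cabs (crd p) < r1, cabs (crd p) < r2 & cabs (crd p) < r3].
  rewrite /rho mulrC divfK// => h.
  by move: h; rewrite !lt_min => /andP[/andP[-> ->] ->].
pose K : set V := [set p : V | `|Re (crd p)| <= rho / 2 /\ `|Im (crd p)| <= rho / 2].
have KW : K `<=` W.
  move=> p [p1 p2]; have := cabs_le_ReIm (crd p) => h.
  have [_ h2 _] := rhoP p ltac:(lra).
  exact: hr2.
have nK : nbhs (0 : V) [set p : V | cabs (crd p) < rho / 2].
  apply/nbhsV; exists (rho / 2); first by rewrite divr_gt0.
  by move=> p; rewrite crd0 subr0.
(* Lower bound near 0 of the density without the factor exp (- Psi); the 2 is [2 ^+ n] in dimension
   one. *)
pose m0 := 2 * k ^+ 2 * expR (- (lweight i (0 : V) + 1)).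
have m00 : 0 < m0 by rewrite !mulr_gt0 ?expR_gt0 ?exprn_gt0.
have [kappa kap0 [sigma hs]] := annulus_integral hc c0 nK.
apply/eqyP => A A0.
apply: (le_trans _ (ereal_sup_ubound _)); last first.
  by exists K => //; split=> //; exact: square_compact.
(* The upper limit is an infimum over neighbourhoods of -oo, each containing all reals below some
   [M]; one large value at some [t < M] is enough for each. *)
apply: le_ereal_inf_tmp => _ [B [M [_ hM]] <-].
pose b := m0 * kappa * expR (- (1 / 2)).
have b0 : 0 < b by rewrite !mulr_gt0 ?expR_gt0.
(* Below -1, [sigma] and [M], and so far out that [b * (- s)] exceeds [A]. *)
pose s := - (`|A| / b + `|sigma| + `|M| + 3).
have n1 := normr_ge0 sigma; have n2 := ler_norm (- sigma); rewrite normrN in n2.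
have n3 := normr_ge0 M; have n4 := ler_norm (- M); rewrite normrN in n4.
have n5 : 0 <= `|A| / b by rewrite divr_ge0// ltW.
have s1 : s <= -1 by rewrite /s; lra.
have ps := profile_le s1.
(* [profile] has slopes in [[1, 2]], so the shell [|log |z|^2 - s| < 1/4] lies
   in [{t < Psi < t + 1}], where the density is at least of order
   [(- s) exp (- s)]. *)
pose t := profile s - 1 / 2.
apply: (le_trans _ (ereal_sup_ubound _)); last first.
  by exists t => //; apply: hM; rewrite /t /s in ps *; lra.
pose lo := expR ((s - 1 / 4) / 2); pose hi := expR ((s + 1 / 4) / 2).
pose P : set V := (cdom c `&` [set p : V | cabs (crd p) < rho / 2]) `&`
  ([set p : V | lo < cabs (crd p)] `&` [set p : V | cabs (crd p) < hi]).
have oP : open P.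
  apply: openI; apply: openI.
  - exact: cdom_open.
  - exact: modulus_open.
  - exact: modulus_open_gt.
  - exact: modulus_open.
have shell (p : V) : crd p != 0 ->
    (lo < cabs (crd p) < hi) = (`|lnsq (crd p) - s| < 1 / 4).
  exact: lnsq_shell.
have psiP (p : V) : crd p != 0 -> `|lnsq (crd p) - s| < 1 / 4 ->
    potential (p : X) = (profile (lnsq (crd p)))%:E /\
    `|profile (lnsq (crd p)) - profile s| < 1 / 2.
  by move=> p0 ps'; rewrite /potential /psi (negbTE p0); split=> //; exact: profile_shell.
pose m := m0 * expR (- (profile s + 1 / 2)).
have mb : A <= m * (kappa * expR s).
  have -> : m * (kappa * expR s) = b * (- s).
    rewrite /m /b /profile s1.
    rewrite -[X in _ = _ * X](@lnK _ (- s)) ?posrE; last by lra.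
    rewrite mulrACA -expRD -[RHS]mulrA -expRD; congr (_ * expR _); ring.
  have h : b * (`|A| / b) <= b * (- s) by rewrite ler_pM2l// /s; lra.
  apply: le_trans h; rewrite mulrCA divff ?gt_eqF// mulr1.
  exact: ler_norm.
apply: (@le_trans _ _ (m * (kappa * expR s))%:E); first by rewrite lee_fin.
apply: (le_trans _ (ereal_sup_ubound _)); last first.
  (* The integral is a supremum over families of pieces lying in charts, so a single open piece of
     the shell bounds it below. *)
  exists 1%N, (fun=> P), (fun=> i); split.
  - by move=> j k' _ _ _; rewrite !ord1.
  - by move=> _; apply: sub_sigma_algebra.
  - move=> _ p [[cp pr] [plo phi]]; split => //.
    have p0 : crd p != 0 by rewrite -cabs_gt0 (lt_trans _ plo)// expR_gt0.
    have psh : `|lnsq (crd p) - s| < 1 / 4 by rewrite -shell// plo phi.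
    have [pE pb] := psiP p p0 psh; split.
      rewrite /= pE !lte_fin /t; move: pb; rewrite ltr_norml.
      by move=> /andP[? ?]; split; lra.
    split; apply: (@le_trans _ _ (cabs (crd p))); rewrite ?(ltW pr)//.
      exact: Re_le_cabs.
    exact: Im_le_cabs.
  - reflexivity.
rewrite big_ord1; apply: hs.
- by rewrite /s; lra.
- by rewrite mulr_ge0 ?expR_ge0// ltW.
- move=> y; rewrite /= /kl_density mule_ge0 ?expeR_ge0// lee_fin.
  by rewrite expr1; apply: mulr_ge0 (expR_ge0 _); rewrite mulr_ge0// sqr_ge0.
move=> p cp pr p0 ps'; split.
  exists p => //; split; first by split.
  by move: (shell p p0); rewrite ps' => /andP[].
rewrite /= cfunK// /kl_density; have [-> pb] := psiP p p0 ps'.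
have [pr1 pr2 pr3] := rhoP p ltac:(rewrite /= in pr; lra).
rewrite /m EFinM /=; apply: lee_pmul; rewrite ?lee_fin ?expR_ge0//.
- exact: ltW.
- rewrite /m0 expr1; apply: ler_pM; rewrite ?expR_ge0 ?mulr_ge0 ?sqr_ge0 ?(ltW k0)//.
    rewrite ler_pM2l// lerXn2r ?nnegrE ?cabs_ge0// ?(ltW k0)//.
    by apply: hk => //; exact: hr2.
  by rewrite ler_expR lerN2 hr3.
- by rewrite ler_expR lerN2; move: pb; rewrite ltr_norml; lra.
Qed.

Lemma potential_ohsawa_singular : ohsawa_singular (@potential R) (0 : V).
Proof.
move=> c W hc Wc f oW W0 _ f0.
by apply: (@ohsawa_norm_infinite W (triv_bundle hc Wc) tt) => //; exact: Wc.
Qed.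

Lemma potential_entirely_singular :
  entirely_singular (@potential R) [set (0 : V)].
Proof.
apply/seteqP; split=> x; first by case.
move=> -> /=; split => //; split; last exact: potential_ohsawa_singular.
by rewrite nonint_locus_potential.
Qed.

End OhsawaSingular.

(** * Log canonical places *)

Section Valuations.
Context {R : realType}.
Local Notation V := 'rV[C R]_1.
Local Notation X := (@line R).
Local Notation stratum v := (@qstratum R 1 X v).
Local Notation model v := (@qmap R 1 X v).
Implicit Types (v : qmval X) (u : X -> \bar R).

Definition logsq (f : X -> C R) : X -> \bar R := fun y => lne (cabs (f y) ^+ 2)%:E.

Lemma logsqE (f : X -> C R) y : logsq f y =
  if f y == 0 then -oo%E else (lnsq (f y))%:E.
Proof.
rewrite /logsq; case: ifPn => [/eqP ->|f0].
  by rewrite cabs0 expr0n le0_lneNy.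
by rewrite lne_EFin// exprn_gt0// cabs_gt0.
Qed.

Lemma qbound_transfer v u u' (t kappa K : R) (p : qspace v) : 0 < kappa ->
  (\forall y \near (model v p : X), (u' y <= kappa%:E * u y + K%:E)%E) ->
  qbound u t p -> qbound u' (kappa * t) p.
Proof.
move=> k0 uu' [w [M [wE hM]]]; exists w, (kappa * M + K); split=> //.
have cq : {for p, continuous (model v)}.
  by have [_ _ hm _ _] := qmap_bimero v; have [] := hm p I.
have := cq _ uu'; move: hM; apply: filterS2 => q h1 h2.
apply: (le_trans h2); rewrite [leRHS](_ : _ = (kappa%:E *
  (t%:E * lne (\big[Num.max/0]_(i < qrank v)
     (cabs (w i q) `^ (2 / qweight i))%R)%:E + M%:E) + K%:E)%E).
  by rewrite leeD2r// lee_wpmul2l// lee_fin ltW.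
by rewrite muleDr ?fin_num_adde_defl// muleA -!EFinM EFinD addeA.
Qed.

(** A bound of slope t for [u] gives one of slope [kappa * t] for [u'], constants going into the
    O(1) term. Values are compared with that of the coordinate through this monotonicity. *)
Lemma qvalue_scale v (S : set X) u u' (kappa K : R) : 0 < kappa ->
  (forall p, stratum v p -> S (model v p) ->
     \forall y \near (model v p : X), (u' y <= kappa%:E * u y + K%:E)%E) ->
  (kappa%:E * qvalue v S u <= qvalue v S u')%E.
Proof.
move=> k0 uu'; rewrite -lee_pdivlMl//; apply: ge_ereal_sup => _ [t [t0 ht] <-].
rewrite lee_pdivlMl// -EFinM; apply: ereal_sup_ubound.
exists (kappa * t) => //; split; first by rewrite mulr_ge0// ltW.
by move=> p sp Sp; apply: (qbound_transfer k0 (uu' p sp Sp)); exact: ht.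
Qed.

Lemma qcenter_point v p : qcenter v = [set (0 : V)] -> stratum v p ->
  model v p = (0 : V) :> X.
Proof.
move=> vc sp; suff : qcenter v (model v p) by rewrite vc.
by apply: subset_closure; exists p.
Qed.

(** The whole stratum lies over the origin, so the value of the potential and the values of germs at
    0 are suprema over conditions at the same points. *)
Lemma qvalue_point v u : qcenter v = [set (0 : V)] ->
  qvalue v setT u = qvalue v [set (0 : V)] u.
Proof.
move=> vc; rewrite /qvalue; congr (ereal_sup (_ @` _)).
apply/seteqP; split=> t [t0 h]; split=> // p sp _.
  by apply: h.
by apply: h => //; exact: qcenter_point.
Qed.

Lemma near0S (P Q : V -> Prop) : (forall y, P y -> Q y) ->
  (\forall y \near (0 : V), P y) -> \forall y \near (0 : V), Q y.
Proof. by move=> PQ; apply: filterS. Qed.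

Lemma nbhs_lnsq_small (s : R) : \forall y \near (0 : V),
  crd y != 0 -> lnsq (crd y) < s.
Proof.
apply/nbhsV; exists (expR (s / 2)); first exact: expR_gt0.
by move=> y; rewrite crd0 subr0 => h y0; rewrite -lnsq_lt.
Qed.

Lemma near_cabs_small (del : R) : 0 < del ->
  \forall y \near (0 : V), cabs (crd y) < del.
Proof.
by move=> d0; apply/nbhsV; exists del => // y; rewrite crd0 subr0.
Qed.

(** The rank is positive, so the sum of positive terms is not empty; hence a log canonical place has
    a positive value on the potential. *)
Lemma log_discrepancy_gt0 v (a : R) : log_discrepancy v a -> 0 < a.
Proof.
move=> [k [_ ->]].
have pos i : 0 < qweight i * (1 + (k i)%:R) :> R.
  by apply: mulr_gt0; [exact: qweight_gt0|rewrite ltr_wpDr].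
rewrite (bigD1 (Ordinal (qrank_gt0 v)))//= ltr_wpDr//.
by apply: sumr_ge0 => i _; exact: ltW.
Qed.

(** Used for germs that do not vanish at the origin: it forces their value to be at most 0. *)
Lemma qbound_unbounded v u (t c : R) (p : qspace v) : stratum v p ->
  0 <= t -> (c%:E <= u (model v p))%E -> qbound u t p -> t = 0.
Proof.
move=> sp t0 cu [w [M [wE /nbhs_singleton hM]]].
apply/eqP; rewrite eq_le t0 andbT leNgt; apply/negP => t1.
(* At [p] itself all local equations vanish, so the bound is [-oo] there. *)
have w0 i : w i p = 0.
  have [N [c' [[oN Np] _ EN _ _]]] := wE i.
  have [_ /(_ p sp) pE _] := qstratumP v.
  have : (qdiv i `&` N) p by split => //; exact: pE.
  by rewrite EN => -[].
have m0 : \big[Num.max/0]_(i < qrank v) (cabs (w i p) `^ (2 / qweight i))%R = 0 :> R.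
  apply: (big_ind (fun x : R => x = 0)) => // [x y -> ->|i _].
    by rewrite /Num.max ltxx.
  by rewrite w0 cabs0 powR0// gt_eqF// divr_gt0// qweight_gt0.
move: hM; rewrite m0 le0_lneNy// gt0_muleNy ?lte_fin// addNye leeNy_eq => /eqP uN.
by move: cu; rewrite uN.
Qed.

(** A bound includes local equations at [p]; they are borrowed from a bound already known for
    another function, here and in [qboundNy]. *)
Lemma qbound0 v u u' (t M : R) (p : qspace v) :
  (\forall y \near (model v p : X), (u' y <= M%:E)%E) ->
  qbound u t p -> qbound u' 0 p.
Proof.
move=> uu' [w [_ [wE _]]]; exists w, M; split=> //.
have cq : {for p, continuous (model v)}.
  by have [_ _ hm _ _] := qmap_bimero v; have [] := hm p I.
have {}uu' : \forall q \near p, (u' (model v q) <= M%:E)%E := cq _ uu'.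
apply: filterS uu' => q h.
by rewrite mul0e add0e.
Qed.

Lemma qboundNy v u u' (t s : R) (p : qspace v) :
  (\forall y \near (model v p : X), u' y = -oo%E) ->
  qbound u t p -> qbound u' s p.
Proof.
move=> uu' [w [_ [wE _]]]; exists w, 0; split=> //.
have cq : {for p, continuous (model v)}.
  by have [_ _ hm _ _] := qmap_bimero v; have [] := hm p I.
have {}uu' : \forall q \near p, u' (model v q) = -oo%E := cq _ uu'.
apply: filterS uu' => q ->.
exact: leNye.
Qed.

(* Near the origin [2 log|z|^2 + 1 <= Psi <= log|z|^2], so a place with finite
   positive value on [Psi] has a finite positive value [b] on the coordinate,
   and then the value of [f] is [b] times its order of vanishing. *)
Lemma lc_place_value v : lc_place (@potential R) [set (0 : V)] v ->
  exists2 b : R, 0 < b & forall f : X -> C R,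
    ((\forall y \near (0 : V), f y = 0) -> qvalue_germ v 0 f = +oo%E) /\
    forall (m : nat) (c K : R), 0 < c -> 0 < K ->
      (\forall y \near (0 : V), c * cabs (crd y) ^+ m <= cabs (f y) /\
         cabs (f y) <= K * cabs (crd y) ^+ m) ->
      qvalue_germ v 0 f = (b * m%:R)%:E.
Proof.
move=> [vc [a /log_discrepancy_gt0 a0 va]].
have sv p : stratum v p -> model v p = (0 : V) :> X by exact: qcenter_point.
have [p0 sp0] : stratum v !=set0 by have [[]] := qstratumP v.
rewrite qvalue_point// in va.
(* Without any bound, the value on the potential would be the supremum of the empty set, -oo,
   instead of [a]. The bound found here later supplies local equations along the stratum. *)
have [t0 [t00 ht0]] : exists t : R, 0 <= t /\ forall p, stratum v p ->
    qbound (@potential R) t p.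
  apply: contrapT => nt; move: va; rewrite /qvalue (_ : [set t | _] = set0).
    by rewrite image_set0 ereal_sup0.
  apply/seteqP; split=> t //= [t1 h]; apply: nt; exists t; split=> // p sp.
  by apply: h => //; exact: sv.
pose b := qvalue v [set (0 : V)] (logsq crd).
have b1 : ((2^-1 * a)%:E <= b)%E.
  rewrite EFinM -va; apply: (@qvalue_scale _ _ _ _ _ 0) => // p sp _.
  rewrite (sv p sp); apply: (near0S _ (near_cabs_small ltr01)) => y _; rewrite logsqE /potential /psi.
  case: eqP => [_|/eqP y0]; first exact: leNye.
  rewrite -EFinM -EFinD lee_fin.
  have := profile_ge (lnsq (crd y)); lra.
have b2 : (b <= a%:E)%E.
  rewrite -va -[leLHS]mul1e; apply: (@qvalue_scale _ _ _ _ _ 0) => // p sp _.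
  rewrite (sv p sp); apply: (near0S _ (nbhs_lnsq_small (-1))) => y hy.
  rewrite logsqE /potential /psi mul1e adde0.
  by case: ifPn => // y0; rewrite lee_fin profile_le// ltW// hy.
have bf : b \is a fin_num.
  by rewrite fin_numE; apply/andP; split; apply/eqP => bE; move: b1 b2; rewrite bE.
rewrite -(fineK bf) !lee_fin in b1 b2.
exists (fine b); first by apply: lt_le_trans b1; rewrite mulr_gt0.
move=> f; split=> [fz|m c K c0 K0 fm].
  apply/eqyP => s s0; apply: ereal_sup_ubound; exists s => //.
  split; first exact: ltW.
  move=> p sp _; apply: (qboundNy _ _ (ht0 p sp)); rewrite (sv p sp).
  by apply: (near0S _ fz) => y fy; rewrite fy cabs0 expr0n le0_lneNy.
(* Order 0 is treated apart, since a comparison with 0 times log |z|^2 falls outside [qvalue_scale],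
   where [kappa] is positive. *)
have [m0|m0] := posnP m.
  rewrite m0 mulr0; apply/eqP; rewrite eq_le; apply/andP; split.
    apply: ge_ereal_sup => _ [t [t1 ht] <-]; rewrite lee_fin.
    have := ht p0 sp0 (sv p0 sp0).
    have /nbhs_singleton := fm; rewrite m0 expr0 !mulr1 => -[fc _].
    move=> /(@qbound_unbounded _ _ _ (ln (c ^+ 2)) _ sp0 t1) -> //.
    rewrite sv// lne_EFin ?exprn_gt0//; last by apply: lt_le_trans fc.
    rewrite lee_fin ler_ln ?posrE ?exprn_gt0//; last exact: lt_le_trans fc.
    by rewrite lerXn2r// nnegrE ?cabs_ge0// ltW.
  apply: ereal_sup_ubound; exists 0 => //; split=> // p sp _.
  apply: (@qbound0 _ _ _ _ (ln (K ^+ 2)) _ _ (ht0 p sp)).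
  rewrite sv//; apply: (near0S _ fm) => y; rewrite m0 expr0 !mulr1 => -[fc fK].
  rewrite lne_EFin ?exprn_gt0//; last by apply: lt_le_trans fc.
  rewrite lee_fin ler_ln ?posrE ?exprn_gt0//; last exact: lt_le_trans fc.
  by rewrite lerXn2r// nnegrE ?cabs_ge0// ltW.
have mR : 0 < m%:R :> R by rewrite ltr0n.
have lb (y : V) k : 0 < k -> crd y != 0 ->
    ln ((k * cabs (crd y) ^+ m) ^+ 2) = m%:R * lnsq (crd y) + ln (k ^+ 2) :> R.
  move=> k0 y0; have cy : 0 < cabs (crd y) by rewrite cabs_gt0.
  rewrite exprMn lnM ?posrE ?exprn_gt0// addrC -exprM mulnC exprM lnXn ?exprn_gt0//.
  by rewrite -[ln _ *+ m]mulr_natl.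
have key : \forall y \near (0 : V), (f y == 0) = (crd y == 0) /\
    (crd y != 0 -> m%:R * lnsq (crd y) + ln (c ^+ 2) <= lnsq (f y) /\
      lnsq (f y) <= m%:R * lnsq (crd y) + ln (K ^+ 2)).
  apply: (near0S _ fm) => y [fc fK].
  have [y0|y0] := eqVneq (crd y) 0.
    move: fK; rewrite y0 cabs0 expr0n gtn_eqF// mulr0.
    by rewrite le_eqVlt ltNge cabs_ge0 orbF cabs_eq0 => ->.
  have cy : 0 < cabs (crd y) by rewrite cabs_gt0.
  have fp : 0 < cabs (f y) by apply: lt_le_trans fc; rewrite mulr_gt0 ?exprn_gt0.
  split; first by apply/negbTE; rewrite -cabs_gt0.
  move=> _; rewrite -!lb// /lnsq.
  by split; rewrite ler_ln ?posrE ?exprn_gt0 ?mulr_gt0 ?exprn_gt0//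
    lerXn2r// nnegrE ?cabs_ge0// mulr_ge0 ?exprn_ge0 ?cabs_ge0// ltW.
(* Near 0, log |f|^2 is [m] times log |z|^2 up to a bounded term; the two inequalities use this in
   opposite directions. *)
have q1 : (m%:R%:E * b <= qvalue_germ v (0 : V)%R f)%E.
  apply: (@qvalue_scale _ _ _ _ _ (ln (K ^+ 2))) => // p sp _.
  rewrite sv//; apply: (near0S _ key) => y [yE h].
  rewrite -/(logsq f y) !logsqE yE; case: ifPn => [_|/h[_ h2]]; first exact: leNye.
  by rewrite -EFinM -EFinD lee_fin.
have q2 : (m%:R^-1%:E * qvalue_germ v (0 : V)%R f <= b)%E.
  apply: (@qvalue_scale _ _ _ _ _ (- (m%:R^-1 * ln (c ^+ 2)))) => //.
    by rewrite invr_gt0.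
  move=> p sp _; rewrite sv//; apply: (near0S _ key) => y [yE h].
  rewrite -/(logsq f y) !logsqE yE; case: ifPn => [_|/h[h1 _]]; first exact: leNye.
  rewrite -EFinM -EFinD lee_fin -mulrBr ler_pdivlMl//.
  by rewrite lerBrDr.
apply/eqP; rewrite eq_le mulrC EFinM fineK// q1 andbT.
by move: q2; rewrite -lee_pdivlMl ?invr_gt0// invrK.
Qed.

Lemma holomorphic_near0 (N : set X) (f : X -> C R) : open N -> N (0 : V) ->
  holo_on N f -> exists2 r : R, 0 < r &
    forall w : C R, cabs w < r -> exists d, cdiff (f \o emb) w d.
Proof.
move=> oN N0 hf; have [r r0 hr] := open_nbhsV oN N0; exists r => // w wr.
have Nw : N (emb w) by apply: hr; rewrite embK crd0 subr0.
have := hf _ Nw idchart erefl I.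
by move=> /differentiable_cdiff; rewrite /= embK.
Qed.

(** By [holomorphic_dichotomy] a germ is zero near 0, with value +oo for both places, or has an
    order [m], with values [b * m] and [b' * m]; the factor [b' / b] fits both cases. *)
Lemma lc_place_unique v v' : lc_place (@potential R) [set (0 : V)] v ->
  lc_place (@potential R) [set (0 : V)] v' -> qequiv v' v.
Proof.
move=> hv hv'; have [b b0 hb] := lc_place_value hv.
have [b' b'0 hb'] := lc_place_value hv'.
exists (b' / b); first by rewrite divr_gt0.
move=> x [p sp px] _ N f oN Nx hf.
have x0 : x = (0 : V) by rewrite -px; apply: qcenter_point sp; case: hv'.
rewrite x0 in Nx *; have [r r0 fr] := holomorphic_near0 oN Nx hf.
have [b'f1 b'f2] := hb' f; have [bf1 bf2] := hb f.
have r20 : 0 < r / 2 by rewrite divr_gt0.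
have r2r : r / 2 < r by lra.
have [[del d0 fz]|[m [c [K [del [c0 K0 d0 fm]]]]]] :=
    holomorphic_dichotomy r20 r2r fr.
  have fN : \forall y \near (0 : V), f y = 0.
    apply: (near0S _ (near_cabs_small d0)) => y /fz.
    by rewrite /= crdK.
  by rewrite b'f1// bf1// gt0_muley// lte_fin divr_gt0.
have fN : \forall y \near (0 : V), c * cabs (crd y) ^+ m <= cabs (f y) /\
         cabs (f y) <= K * cabs (crd y) ^+ m.
  apply: (near0S _ (near_cabs_small d0)) => y /fm.
  by rewrite /= crdK.
rewrite (b'f2 m c K)// (bf2 m c K)// -EFinM; congr EFin.
by rewrite mulrA divfK// gt_eqF.
Qed.

End Valuations.

(** * The order of vanishing at the origin as a log canonical place *)

Section OriginPlace.
Context {R : realType}.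
Local Notation V := 'rV[C R]_1.
Local Notation X := (@line R).

Lemma crd_eq0 (y : V) : crd y = 0 -> y = 0.
Proof.
by move=> y0; rewrite -[LHS]crdK y0; apply/matrixP => i j; rewrite !mxE.
Qed.

Lemma holo_on_crd (N : set X) : holo_on N (@crd R).
Proof. by move=> x _ c -> _; exact: crd_differentiable. Qed.

Lemma analytic_origin : @analytic_in R 1 X setT [set (0 : V)].
Proof.
split=> // x _; exists setT, 1%N, (fun=> @crd R); split=> //.
- exact: openT.
- by move=> _; exact: holo_on_crd.
apply/seteqP; split=> y /=; first by move=> [-> _]; split=> // _; exact: crd0.
by move=> [_ /(_ ord0) /crd_eq0].
Qed.

Lemma irreducible_origin : @irreducible R 1 X [set (0 : V)].
Proof.
split; first exact: analytic_origin.
  by exists (0 : V).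
move=> A B _ _ AB.
have [A0|nA] := pselect (A (0 : V)).
  left; apply/seteqP; split=> y; first by move=> ->.
  by move=> Ay; rewrite AB; left.
right; apply/seteqP; split=> y.
  by move=> ->; have : [set (0 : V)] (0 : V) by []; rewrite {1}AB => -[].
by move=> By; rewrite AB; right.
Qed.

Lemma irreducible_component_origin :
  @irreducible_component R 1 X [set (0 : V)] [set (0 : V)].
Proof.
split=> //; first exact: irreducible_origin.
by move=> S _ h1 h2; apply/seteqP; split.
Qed.

Lemma det_jacobian (F : V -> V) (y : V) d : differentiable F y ->
  cdiff (crd \o F \o emb) (crd y) d -> \det (jacobian F y) = d.
Proof.
move=> dF /cdiff_derivable[gd gE].
pose v : V := delta_mx 0 0.
have crdv : crd v = 1 by rewrite /crd mxE !eqxx.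
have h1 : h^-1 *: (F (h *: v + y) - F y) @[h --> (0 : C R)^'] --> 'D_v F y.
  exact: (diff_derivable dF).
have h2 : crd (h^-1 *: (F (h *: v + y) - F y)) @[h --> (0 : C R)^'] --> crd ('D_v F y).
  by apply: (cvg_comp _ _ h1); exact: crd_continuous.
have h3 : crd (h^-1 *: (F (h *: v + y) - F y)) @[h --> (0 : C R)^'] --> d.
  rewrite -gE; move: gd; rewrite /derivable /derive.
  rewrite (_ : (fun h => _) = (fun h => crd (h^-1 *: (F (h *: v + y) - F y)))) //.
  apply/funext => h; rewrite /= crdZ crdB crdK; congr (_ * (crd (F _) - _)).
  by rewrite -[RHS]crdK crdD crdZ crdv.
rewrite det_mx11 mxE -deriveE//.
exact: (cvg_unique _ h2 h3).
Qed.

Lemma nbhsVI (x : V) (A B : set V) : nbhs x A -> nbhs x B ->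
  exists2 r : R, 0 < r & forall y, cabs (crd y - crd x) < r -> A y /\ B y.
Proof.
move=> /nbhsV[r1 r10 h1] /nbhsV[r2 r20 h2].
exists (Num.min r1 r2); first by rewrite lt_min r10.
by move=> y; rewrite lt_min => /andP[/h1 + /h2].
Qed.

Lemma cdiff_shift a (g : C R -> C R) z d :
  cdiff (fun w => g (a + w)) z d <-> cdiff g (a + z) d.
Proof.
split=> h e /h[del d0 hd]; exists del => // k /hd; by rewrite addrA.
Qed.

Lemma transition_jacobian (c c' : chart R 1 X) (q : X) : hchart c -> hchart c' ->
  cdom c q -> cdom c' q ->
  exists2 J : C R, J != 0 &
    cdiff (crd \o (cfun c' \o id \o cinv c) \o emb) (crd (cfun c q)) J /\
    \det (jacobian (cfun c' \o id \o cinv c) (cfun c q)) = J.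
Proof.
move=> hc hc' cq c'q.
have [d [e [hd _ de]]] := chart_cdiff hc cq.
have [d' [e' [_ he' de']]] := chart_cdiff hc' c'q.
have gd : cdiff (crd \o (cfun c' \o id \o cinv c) \o emb) (crd (cfun c q)) (e' * d).
  have -> : crd \o (cfun c' \o id \o cinv c) \o emb =
      (crd \o cfun c' \o emb) \o (crd \o cinv c \o emb).
    by apply/funext => w; rewrite /= crdK.
  by apply: cdiff_comp hd _; rewrite /= crdK cfunK.
exists (e' * d).
  rewrite mulf_neq0//.
    by apply: contra_eq_neq de' => ->; rewrite mulr0 eq_sym oner_eq0.
  by apply: contra_eq_neq de => ->; rewrite mul0r eq_sym oner_eq0.
split=> //; apply: det_jacobian => //.
have -> : cfun c' \o id \o cinv c = emb \o (crd \o (cfun c' \o id \o cinv c)).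
  by apply/funext => w; rewrite /= crdK.
apply: differentiable_comp; first exact: cdiff_differentiable gd.
exact: emb_differentiable.
Qed.

(** The Jacobian of a change of charts is nonzero at 0, so [w] does not divide it. Divisibility by
    the 0-th power still asks that the Jacobian be holomorphic in the point, which
    [derivative_holomorphic] supplies. *)
Lemma jacobian_order_id : @jacobian_order R 1 X X id [set (0 : V)] 0.
Proof.
move=> p c c' w -> hc hc' c0 c'0 [N [_ [[_ N0] _ EN _ _]]] Jac divides.
have w0 : w (0 : V) = 0.
  have : ([set (0 : V)] `&` N) (0 : V) by split.
  by rewrite EN => -[].
have [J J0 [_ JE]] := transition_jacobian hc hc' c0 c'0.
split; last first.
  move=> [N1 [g [_ N10 _ /(_ _ N10)]]]; rewrite w0 expr1 mul0r => J1.
  by move: J0; rewrite -JE -/(Jac (0 : V)) J1 eqxx.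
set z0 := crd (cfun c (0 : V)).
pose g := crd \o (cfun c' \o id \o cinv c) \o emb.
have [r r0 hr] : exists2 r, 0 < r & forall y, cabs (crd y - z0) < r ->
    (cfun c @` cdom c) y /\ cdom c' (cinv c y).
  have I0 : (cfun c @` cdom c) (cfun c (0 : V)) by exists (0 : V).
  have n1 : nbhs (cfun c (0 : V)) (cfun c @` cdom c).
    by apply: open_nbhs_nbhs; split=> //; exact: cimg_open.
  have n2 : nbhs (cfun c (0 : V)) [set y | cdom c' (cinv c y)].
    apply: (cinv_continuous I0); rewrite cfunK//.
    by apply: open_nbhs_nbhs; split=> //; exact: cdom_open.
  exact: nbhsVI n1 n2.
have gd u : cabs u < r -> exists d, cdiff (fun u => g (z0 + u)) u d.
  move=> ur; have [|[q cq qE] c'q] := hr (emb (z0 + u)).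
    by rewrite embK addrAC subrr add0r.
  rewrite -qE cfunK// in c'q.
  have [d _ [dd _]] := transition_jacobian hc hc' cq c'q.
  by exists d; apply/cdiff_shift; rewrite -[z0 + u]embK -qE.
have r20 : 0 < r / 2 by rewrite divr_gt0.
have r2r : r / 2 < r by lra.
have [f1 hf1] := derivative_holomorphic r20 r2r gd.
(* [f1] is the derivative of the transition map translated so that its disc is centred at 0; [gg]
   reads it at the chart coordinate of [q]. *)
pose gg (q : X) : C R := f1 (- z0 + crd (cfun c q)).
have [del d0 hdel] : exists2 del, 0 < del & forall q : V, cabs (crd q - 0) < del ->
    cdom c q /\ cabs (crd (cfun c q) - z0) < r / 2 / 2.
  have n1 : nbhs (0 : V) (cdom c).
    by apply: open_nbhs_nbhs; split=> //; exact: cdom_open.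
  have n2 : nbhs (0 : V) [set q | cabs (crd (cfun c q) - z0) < r / 2 / 2].
    have n0 : nbhs (cfun c (0 : V)) [set y | cabs (crd y - z0) < r / 2 / 2].
      by apply/nbhsV; exists (r / 2 / 2) => //; rewrite !divr_gt0.
    exact: (cfun_continuous c0 n0).
  by have [del d0 h] := nbhsVI n1 n2; exists del => // q; rewrite -crd0; exact: h.
exists [set q : V | cabs (crd q - 0) < del], gg; split.
- exact: ball_open.
- by rewrite /= crd0 subrr cabs0.
- move=> q /hdel[cq qr] _ -> _.
  have [_ [e [_ he _]]] := chart_cdiff hc cq.
  have [_ [e1 he1]] : cdiff (fun u => g (z0 + u)) (crd (cfun c q) - z0)
      (f1 (crd (cfun c q) - z0)) /\ exists d, cdiff f1 (crd (cfun c q) - z0) d.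
    exact: hf1.
  apply: (@cdiff_differentiable _ _ _ (e1 * e)).
  have -> : (gg \o cinv idchart) \o emb =
      (fun u => f1 (- z0 + u)) \o (crd \o cfun c \o emb) by [].
  apply: cdiff_comp he _; apply/cdiff_shift.
  by rewrite /= crdK addrC.
move=> q /hdel[cq qr]; rewrite expr0 mul1r.
have [q1 _] := hf1 _ qr.
have c'q : cdom c' q by have [_] := hr (cfun c q) ltac:(lra); rewrite cfunK.
have [Jq _ [Jd JqE]] := transition_jacobian hc hc' cq c'q.
rewrite /Jac JqE /gg addrC; apply: cdiff_unique Jd _.
by move/cdiff_shift: q1; rewrite addrCA subrr addr0.
Qed.

Lemma proper_bimeromorphic_id : @proper_bimeromorphic R 1 X X setT id.
Proof.
have hid (W : set X) : @holo_map R 1 X X W id.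
  move=> x _; split; first exact: cvg_id.
  by move=> c c' -> -> _ _; change (differentiable (@id V) (x : V)); exact: ex_diff.
split=> //; first exact: openT.
exists set0, id; split=> //.
- split; first exact: sub0set.
  move=> x _; exists setT, 1%N, (fun (_ : 'I_1) (_ : X) => 1 : C R); split.
  + exact: openT.
  + by [].
  + by [].
  + by move=> _ y _ c _ _; exact: differentiable_cst.
  apply/seteqP; split=> y [] // _ /(_ ord0) /eqP.
  by rewrite oner_eq0.
- exact: interior0.
- by rewrite preimage_set0; exact: interior0.
Qed.

Lemma snc_origin : @snc R 1 X 1 (fun=> [set (0 : V)]).
Proof.
split; first by move=> _; exact: irreducible_origin.
move=> p; exists idchart, id; split=> //.
- exact: hchart_id.
- move=> i _; rewrite setIT; apply/seteqP; split=> y /=.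
    by move=> ->; split=> //; rewrite ord1 mxE.
  by rewrite ord1 => -[_ /crd_eq0].
Qed.

Lemma bigcap_origin : \bigcap_(i in [set: 'I_1]) [set (0 : V)] = [set (0 : V)].
Proof. by apply/seteqP; split=> y; [move/(_ ord0 I)|move=> -> i _]. Qed.

Lemma stratum_origin : @irreducible_component R 1 X
  (\bigcap_(i in [set: 'I_1]) [set (0 : V)]) [set (0 : V)].
Proof. by rewrite bigcap_origin; exact: irreducible_component_origin. Qed.

(** The valuation ord_0: on a curve the point is already a divisor, so the line is its own model. *)
Definition origin_place : qmval X := @QMVal R 1 X X setT id
  proper_bimeromorphic_id 1 isT (fun=> [set (0 : V)]) snc_origin [set (0 : V)]
  stratum_origin (fun=> 1) (fun=> ltr01).

Lemma qcenter_origin_place : qcenter origin_place = [set (0 : V)].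
Proof.
rewrite /qcenter /= image_id; apply/seteqP; split; last first.
  move=> _ -> B nB; exists (0 : V); split=> //.
  exact: nbhs_singleton nB.
move=> y hy; apply: contrapT => y0.
have c0 : 0 < cabs (crd y) by rewrite cabs_gt0; apply/eqP => /crd_eq0.
have ny : nbhs (y : V) [set p | cabs (crd p - crd y) < cabs (crd y)].
  by apply/nbhsV; exists (cabs (crd y)).
by have [_ [->]] := hy _ ny; rewrite /= crd0 sub0r cabsN ltxx.
Qed.

Lemma log_discrepancy_origin_place : log_discrepancy origin_place 1.
Proof.
exists (fun=> 0%N); split; first by move=> i; exact: jacobian_order_id.
by rewrite /= big_ord1 addr0 mulr1.
Qed.

Lemma local_equation_crd : @local_equation R 1 X [set (0 : V)] (0 : V) (@crd R).
Proof.
exists setT, idchart; split=> //.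
- by split=> //; exact: openT.
- exact: holo_on_crd.
- rewrite setIT; apply/seteqP; split=> y /=; first by move=> ->; rewrite crd0.
  by move=> [_ /crd_eq0].
exists (emb 1).
have -> : 'D_(emb 1) (@crd R \o cinv idchart) (cfun idchart (0 : V)) = 'D_1 id (crd (0 : V)).
  rewrite /derive; congr (lim (_ @ (0 : C R)^')).
  by apply/funext => h; rewrite /= crdD crdZ embK.
by rewrite derive_id; apply/eqP; exact: oner_neq0.
Qed.

Lemma model_bigmax (w : 'I_1 -> X -> C R) q :
  \big[Num.max/0]_(i < 1) (cabs (w i q) `^ (2 / 1))%R = cabs (w ord0 q) ^+ 2 :> R.
Proof.
rewrite big_ord_recl big_ord0 divr1 -[2]/(2%:R) powR_mulrn ?cabs_ge0//.
by apply/max_idPl; exact: exprn_ge0 (cabs_ge0 _).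
Qed.

Lemma qbound_potential : @qbound R 1 X origin_place (@potential R) 1 (0 : V).
Proof.
exists (fun=> @crd R), 0; split; first by move=> i; exact: local_equation_crd.
have h (y : X) : (crd y != 0 -> lnsq (crd y) < -1) -> (potential y <= 1%:E *
    lne (\big[Num.max/0]_(i < 1) (cabs (crd y) `^ (2 / 1))%R)%:E + 0%:E)%E.
  rewrite (model_bigmax (fun=> @crd R)) mul1e adde0 -/(logsq (@crd R) y) logsqE.
  rewrite /potential /psi => hy.
  by case: eqP => // /eqP y0; rewrite lee_fin profile_le// ltW// hy.
exact: near0S h (nbhs_lnsq_small (-1)).
Qed.

(** A local equation is O(|z|), so at a point of modulus e^(s/2) the bound implies s - log (-s) <= t
    s + O(1). For t > 1 this fails as s tends to -oo, the logarithm being negligible against (t -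
    1)(-s). *)
Lemma qbound_potential_le1 (t : R) : 0 <= t ->
  @qbound R 1 X origin_place (@potential R) t (0 : V) -> t <= 1.
Proof.
move=> t0 [w [M [wE hM]]]; rewrite leNgt; apply/negP => t1.
have [N [c [[oN N0] hw EN _ _]]] := wE ord0.
have w0 : w ord0 (0 : V) = 0.
  have : ([set (0 : V)] `&` N) (0 : V) by split.
  by rewrite EN => -[].
have [d hd] : exists d, cdiff (w ord0 \o emb) 0 d.
  have := hw _ N0 idchart erefl I.
  by move=> /differentiable_cdiff; rewrite crd0.
have [r1 r10 h1] := hd 1 ltr01.
have /nbhsV[r2 r20 hr2] := hM.
have h2 (y : X) : cabs (crd y) < r2 ->
    (potential y <= t%:E * lne (cabs (w ord0 y) ^+ 2)%:E + M%:E)%E.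
  by rewrite -(model_bigmax w) => yr; apply: (hr2 y); rewrite crd0 subr0.
pose D := (cabs d + 1) ^+ 2.
have D0 : 0 < D by rewrite exprn_gt0// ltr_wpDl// cabs_ge0.
pose r := Num.min r1 r2.
have r0 : 0 < r by rewrite lt_min r10.
(* Half of the excess [t - 1] absorbs log (-s); the other half beats the constants collected in
   [B]. *)
pose eta := (t - 1) / 2.
have eta0 : 0 < eta by rewrite divr_gt0// subr_gt0.
pose B := t * ln D + M - 1 - ln eta.
pose s := - (`|2 * ln r| + `|B| / eta + 3).
have n1 := ler_norm (- (2 * ln r)); rewrite normrN in n1.
have n2 := normr_ge0 (2 * ln r).
have n3 : 0 <= `|B| / eta by rewrite divr_ge0// ltW.
pose z : C R := ((expR (s / 2))%:C)%C.
have cz : cabs z = expR (s / 2) by rewrite cabs_real ger0_norm// expR_ge0.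
have z0 : z != 0 by rewrite -cabs_gt0 cz expR_gt0.
have zr : cabs z < r.
  by rewrite cz -ltr_ln ?posrE ?expR_gt0// expRK /s; lra.
have ls : lnsq z = s by rewrite /lnsq cz -expRM_natl expRK; lra.
move: (zr); rewrite lt_min => /andP[z1 z2].
have wz : cabs (w ord0 (emb z)) <= (cabs d + 1) * cabs z.
  have := h1 z z1; rewrite add0r mul1r /= (_ : w ord0 (emb 0) = 0); last first.
    by rewrite -[RHS]w0; congr w; apply/matrixP => i j; rewrite !mxE.
  rewrite subr0 => hz; have := cabsD (w ord0 (emb z) - d * z) (d * z).
  by rewrite subrK cabsM; lra.
have := h2 (emb z); rewrite embK => /(_ z2).
rewrite /potential /psi embK (negbTE z0) ls.
have [wz0|wz0] := eqVneq (w ord0 (emb z)) 0.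
  rewrite wz0 cabs0 expr0n le0_lneNy// gt0_muleNy ?lte_fin//; last by lra.
rewrite lne_EFin ?exprn_gt0 ?cabs_gt0// -EFinM -EFinD lee_fin => hle.
have lw : ln (cabs (w ord0 (emb z)) ^+ 2) <= ln D + s.
  have zz : 0 < cabs z ^+ 2 by rewrite exprn_gt0// cabs_gt0.
  have ww : 0 < cabs (w ord0 (emb z)) ^+ 2 by rewrite exprn_gt0// cabs_gt0.
  rewrite -[s]ls /lnsq -(lnM D0 zz) ler_ln ?posrE ?(mulr_gt0 D0 zz)//.
  rewrite -exprMn lerXn2r// nnegrE ?cabs_ge0// mulr_ge0 ?cabs_ge0//.
  by rewrite addr_ge0 ?cabs_ge0.
have := ler_wpM2l t0 lw.
have h3 : ln (- s) <= eta * (- s) - 1 - ln eta.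
  have : ln (eta * (- s)) <= eta * (- s) - 1.
    by apply: ln_le_sub1; rewrite mulr_gt0// /s; lra.
  by rewrite lnM ?posrE//; [lra|rewrite /s; lra].
have h4 : B < eta * (- s).
  have e1 : eta * (`|B| / eta) = `|B| by rewrite mulrCA divff ?gt_eqF// mulr1.
  have e2 : eta * (`|B| / eta + 3) <= eta * (- s).
    by rewrite ler_pM2l// /s; lra.
  have := ler_norm B; rewrite mulrDr e1 in e2; lra.
have sE : s <= -1 by rewrite /s; lra.
move: hle; rewrite /profile sE mulrDr /B in h4 *.
have : t * s = 2 * (eta * s) + s by rewrite /eta; field.
rewrite mulrN in h3 h4; lra.
Qed.

Lemma lc_place_origin : lc_place (@potential R) [set (0 : V)] origin_place.
Proof.
split; first exact: qcenter_origin_place.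
exists 1; first exact: log_discrepancy_origin_place.
apply/eqP; rewrite eq_le; apply/andP; split.
  apply: ge_ereal_sup => _ [t [t0 ht] <-]; rewrite lee_fin.
  by apply: qbound_potential_le1 => //; exact: ht.
apply: ereal_sup_ubound; exists 1 => //; split=> // p -> _.
exact: qbound_potential.
Qed.

End OriginPlace.

Theorem theorem1p4 (R : realType) :
  exists (n : nat) (X : cmanifold R n) (Psi : X -> \bar R) (Y : set X),
    [/\ quasi_psh Psi,
        log_canonical Psi,
        irreducible_component (nonint_locus Psi) Y,
        exists2 v : qmval X, lc_place Psi Y v &
          forall v' : qmval X, lc_place Psi Y v' -> qequiv v' v &
        entirely_singular Psi Y /\
        forall (L : hlbundle [set: X]) (f : lidx L -> X -> C R),
          holo_kl_section_on (nonint_locus Psi) f ->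
          (ohsawa_norm Psi f < +oo)%E ->
          forall i x, Y x -> cdom (lchart i) x -> f i x = 0].
Proof.
exists 1%N, line, (@potential R), [set (0 : 'rV[C R]_1)]; split.
- exact: potential_quasi_psh.
- exact: potential_log_canonical.
- by rewrite nonint_locus_potential; exact: irreducible_component_origin.
- exists origin_place; first exact: lc_place_origin.
  by move=> v; apply: lc_place_unique; exact: lc_place_origin.
split; first exact: potential_entirely_singular.
move=> L f _ fin i x -> cx; apply: contrapT => fx; move: fin.
by rewrite (ohsawa_norm_infinite _ _ cx fx)//; exact: openT.
Qed.
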